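(* Let $u$ be the exact solution of the parabolic problem $\partial_t u = Du+f$ in $\Omega\times(0,T]$, $Bu=b$ on $\partial\Omega\times(0,T]$, $u(\cdot,0)=u_0$, with solution-independent source function $f=f(x)\in H^4(\Omega)$, under the standing assumptions listed in the context. Let $u_{n+1}=\Phi_\tau(u_n)$, $n\ge 0$, be the numerical solution produced by the corrected splitting method $\Phi_\tau$ defined in the context, started from the same initial value $u_0$. Then there is a constant $C>0$, independent of $\tau$ and $n$, such that for all time steps $\tau>0$ (taken small enough, in the sense specified in the context, if $b$ depends on time), with $t_n=n\tau$, $$\|u_n-u(t_n)\|_{L^2(\Omega)}\le C\,\tau^3\,(1+|\log(\tau)|)\qquad\text{for all } 0\le t_n\le T.$$
   Context: **Setting.** $\Omega\subset\mathbb{R}^d$ is a bounded domain with $C^2$-boundary $\partial\Omega$, or a polyhedral convex domain; $T>0$. $D=\sum_{i,j=1}^d a_{ij}(x)\partial_{ij}+\sum_{i=1}^d b_i(x)\partial_i+c(x)I$, with $(a_{ij}(x))\in\mathbb{R}^{d\times d}$ symmetric and $\sum_{i,j}a_{ij}(x)\xi_i\xi_j\ge\lambda|\xi|^2$ for all $x\in\Omega$, $\xi\in\mathbb{R}^d$, for some $\lambda>0$; $a_{ij}\in C^1(\overline\Omega)$; $b_i,c$ uniformly continuous in $\Omega$. $B$ is a boundary operator, either of Dirichlet type $B=\gamma(x)I$, or $B=\sum_{i}\beta_i(x)\partial_i+\gamma(x)I$ with $\inf_{x\in\partial\Omega}|\sum_i\beta_i(x)\nu_i(x)|>0$ (Neumann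 type if $\gamma=0$, Robin type otherwise), $\nu$ the exterior unit normal; $\beta_i,\gamma$ are continuously differentiable. **Operator $A$.** $Av=Dv$ for $v\in D(A)=\{v\in H^2(\Omega): Bv=0\text{ on }\partial\Omega\}$. Standing assumptions: $A$ is densely defined in $L^2(\Omega)$; for some $\theta\in(0,\pi/2)$ its resolvent set contains the closure of $\{z\in\mathbb{C}: z\ne0,\ |\arg z|\le\pi-\theta\}$ (in particular $0$ is in the resolvent set), with $\|(zI-A)^{-1}\|\le M/|z|$ for nonzero $z$ in it; $A$ is symmetric, with eigenvalues $\lambda_j\in(-\infty,0]$ and eigenfunctions $e_j$ forming an orthonormal basis of $L^2(\Omega)$. $e^{tA}$ is the analytic semigroup generated by $A$, also used for complex $t$ with positive real part. For every $g\in L^2(\Omega)$ the problem $Dv=g$ in $\Omega$, $Bv=0$ on $\partial\Omega$, has a unique solution, which lies in $H^2(\Omega)$ and satisfies $\|v\|_{H^2(\Omega)}\le C\|g\|_{L^2(\Omega)}$, with $C$ depending only on $\Omega$ and the coefficients. **Data.** $b\in C^1([0,T],H^2(\partial\Omega))$; $u_0$ satisfies the boundary conditions (if $b=0$: $u_0\in D(A)$); the exact solution satisfies $u\in C^2([0,T],H^2(\Omega))$. There is $z\in C^1([0,T],H^2(\Omega))$ with $Bz=b$ on $\partial\Omega$. Because complex time steps are used, $b$ and $z$ are assumed complex analytic in an open complex neighbourhood of $[0,T]$ with values in $H^2$, and $\tau$ is assumed small enough that the complex times below stay in this neighbourhood. If $b$ is time-independent, $z\in H^2(\Omega)$ is chosen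 time-independent and there is no restriction on $\tau$. Put $z_n(s)=z(t_n+s)$, $t_n=n\tau$. **Method.** Let $a=\frac14\bigl(1-\frac{1}{\sqrt3}i\bigr)$, $\overline a=\frac14\bigl(1+\frac1{\sqrt3}i\bigr)$, $c=\frac12$ (this number $c$ is distinct from the coefficient $c(x)$ of $D$). The correctors $r,q$ are the unique solutions of $$Dr=0\ \text{in }\Omega,\quad B(r-Df)=0\ \text{on }\partial\Omega;\qquad Dq=r\ \text{in }\Omega,\quad B(q-f)=0\ \text{on }\partial\Omega .$$ One step from $t_n$ to $t_{n+1}$ is $$\Phi_\tau=\phi^f_{\overline a\tau}\circ\phi^{-q}_{\overline a\tau}\circ\phi^{D+q}_{2\overline a\tau}\circ\phi^{-q}_{\overline a\tau}\circ\phi^f_{c\tau}\circ\phi^{-q}_{a\tau}\circ\phi^{D+q}_{2a\tau}\circ\phi^{-q}_{a\tau}\circ\phi^f_{a\tau},$$ where $\phi^f_s(w)=w+sf$, $\phi^{-q}_s(w)=w-sq$, and $\phi^{D+q}$ is the exact flow of $\partial_tw=Dw+q$ in $\Omega$, $Bw=b$ on $\partial\Omega$, along complex time: the first one runs from $t_n$ to $t_n+2a\tau$, the second from $t_n+2a\tau$ to $t_n+\tau$, i.e. $$\phi^{D+q}_{2a\tau}(w)=z_n(2a\tau)+e^{2a\tau A}(w-z_n(0))+\int_0^{2a\tau}e^{(2a\tau-s)A}\bigl(Dz_n(s)-\partial_tz_n(s)+q\bigr)\,ds,$$ $$\phi^{D+q}_{2\overline a\tau}(w)=z_n(\tau)+e^{2\overline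 a\tau A}(w-z_n(2a\tau))+\int_{2a\tau}^{\tau}e^{(\tau-s)A}\bigl(Dz_n(s)-\partial_tz_n(s)+q\bigr)\,ds,$$ with integrals along straight segments in $\mathbb{C}$.
   Formalization: The correctors r, q are taken in H² with r−Df in D(A), which amounts to assuming Df in H²(Ω); with coefficients b_i, c only uniformly continuous, f in H⁴ does not give this, and without it the third-order bound fails (for example f = 1 and a rough c(x) in one dimension). *)

(* Defs.v *)
(* Lebesgue measure on R^n, Sobolev spaces, traces and analytic semigroups are not
   in the library and are set up here from their textbook definitions.

   Because of the complex time steps, all function spaces are complex, with
   scalars [R[i]].  Elements of L^2(Om) are represented by functions on the whole
   of R^n, considered on [Om] and up to a.e. equality.  Norms take values in
   [\bar R], so that a bound on a norm is never met by a junk value. *)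
Set Warnings "-all".
From HB Require Import structures.
From mathcomp Require Import all_boot all_order all_algebra.
From mathcomp Require Import complex.
From mathcomp Require Import all_classical all_reals all_analysis.
Set Implicit Arguments.
Unset Strict Implicit.
Unset Printing Implicit Defensive.
Import Order.TTheory GRing.Theory Num.Theory.
Import numFieldNormedType.Exports.
Local Open Scope classical_set_scope.
Local Open Scope ring_scope.
Local Open Scope complex_scope.

Definition cabs (R : realType) (z : R[i]) : R :=
  Num.sqrt (complex.Re z ^+ 2 + complex.Im z ^+ 2).

Definition copen (R : realType) (U : set R[i]) : Prop :=
  forall z, U z ->
    exists2 e : R, 0 < e & forall w, cabs (w - z) < e -> U w.

(* The sigma-algebra generated by the coordinates, i.e. the Borel one. *)
Section rV_measurable.
Variables (R : realType) (n : nat).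
Let coord (i : 'I_n) (x : 'rV[R]_n) : measurableTypeR R := x ord0 i.

Let rV_set0 : g_sigma_preimage coord set0.
Proof. exact: sigma_algebra0. Qed.
Let rV_setC A : g_sigma_preimage coord A -> g_sigma_preimage coord (~` A).
Proof. exact: sigma_algebraC. Qed.
Let rV_bigcup (F : _^nat) : (forall i, g_sigma_preimage coord (F i)) ->
  g_sigma_preimage coord (\bigcup_i (F i)).
Proof. exact: sigma_algebra_bigcup. Qed.

HB.instance Definition _ := @isMeasurable.Build (measure_tuple_display default_measure_display)
  'rV[R]_n (g_sigma_preimage coord) rV_set0 rV_setC rV_bigcup.

Lemma measurable_coord (i : 'I_n) :
  measurable_fun [set: 'rV[R]_n] (fun x => x ord0 i : measurableTypeR R).
Proof.
move=> _ Y mY; rewrite setTI; apply: sub_sigma_algebra => /=.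
rewrite -bigcup_seq/=; exists i => /=; first by rewrite mem_index_enum.
by exists Y => //; rewrite setTI.
Qed.

Lemma measurable_fun_rV d (T : measurableType d) (f : T -> 'rV[R]_n) :
  (forall i, measurable_fun [set: T] (fun t => f t ord0 i : measurableTypeR R)) ->
  measurable_fun [set: T] f.
Proof.
move=> mf.
have sub : g_sigma_preimage (fun i => coord i \o f) `<=` measurable.
  apply: smallest_sub; first exact: sigma_algebra_measurable.
  have mfi i : preimage_set_system setT (coord i \o f) measurable `<=` measurable.
    by move=> A [B mB <-]; exact: mf.
  by elim/big_ind : _ => // A B sA sB; rewrite subUset.
move=> _ A mA; apply: sub.
by rewrite (g_sigma_preimage_comp coord f); exists A.
Qed.
End rV_measurable.

Definition rV_cons (R : realType) (n : nat)
    (p : 'rV[R]_n * measurableTypeR R) : 'rV[R]_n.+1 :=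
  \row_(i < n.+1) oapp (p.1 ord0) (p.2 : R) (unlift ord0 i).

Lemma measurable_rV_cons (R : realType) (n : nat) :
  measurable_fun [set: 'rV[R]_n * measurableTypeR R] (@rV_cons R n).
Proof.
apply: measurable_fun_rV => i; rewrite /rV_cons.
under eq_fun do rewrite mxE.
case: unliftP => [j _|_] /=; last exact: measurable_snd.
exact: (measurableT_comp (measurable_coord j) measurable_fst).
Qed.

Definition leb_succ (R : realType) (n : nat)
    (mu : {measure set 'rV[R]_n -> \bar R}) : set 'rV[R]_n.+1 -> \bar R :=
  pushforward (product_measure1 mu (@lebesgue_measure R)) (@rV_cons R n).

HB.instance Definition _ (R : realType) (n : nat)
    (mu : {measure set 'rV[R]_n -> \bar R}) :=
  Measure.copy (leb_succ mu)
    (measure_function_pushforward__canonical__measure_function_Measure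
       (product_measure1 mu (@lebesgue_measure R)) (@measurable_rV_cons R n)).

Fixpoint leb (R : realType) (n : nat) : {measure set 'rV[R]_n -> \bar R} :=
  match n with
  | 0 => dirac (0 : 'rV[R]_0)
  | m.+1 => leb_succ (leb R m)
  end.

Definition evec (R : realType) (n : nat) (i : 'I_n) : 'rV[R]_n := delta_mx ord0 i.

Definition enorm (R : realType) (n : nat) (x : 'rV[R]_n) : R :=
  Num.sqrt (\sum_i x ord0 i ^+ 2).

Definition dot (R : realType) (n : nat) (x y : 'rV[R]_n) : R :=
  \sum_i x ord0 i * y ord0 i.

Definition pds (R : realType) (n : nat) (s : seq 'I_n) (phi : 'rV[R]_n -> R) :
    'rV[R]_n -> R :=
  foldr (fun i g x => 'D_(evec R i) g x) phi s.

Definition Ck (R : realType) (n k : nat) (phi : 'rV[R]_n -> R) : Prop :=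
  forall s : seq 'I_n, (size s <= k)%N ->
    continuous (pds s phi) /\
    ((size s < k)%N -> forall i x, derivable (pds s phi) x (evec R i)).

Definition Cinfty (R : realType) (n : nat) (phi : 'rV[R]_n -> R) : Prop :=
  forall k, Ck k phi.

Definition test_function (R : realType) (n : nat) (Om : set 'rV[R]_n)
    (phi : 'rV[R]_n -> R) : Prop :=
  Cinfty phi /\
  exists K : set 'rV[R]_n, [/\ compact K, K `<=` Om & forall x, ~ K x -> phi x = 0].

(* C^1 up to the boundary: g is C^1 in Om, and g and its first derivatives
   extend continuously to the closure. *)
Definition C1_closure (R : realType) (n : nat) (Om : set 'rV[R]_n)
    (g : 'rV[R]_n -> R) : Prop :=
  exists (g0 : 'rV[R]_n -> R) (g1 : 'I_n -> 'rV[R]_n -> R),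
    [/\ {within closure Om, continuous g0},
        forall i, {within closure Om, continuous (g1 i)},
        forall x, Om x -> g x = g0 x
      & forall x i, Om x ->
          derivable g x (evec R i) /\ 'D_(evec R i) g x = g1 i x].

Definition unif_continuous_on (R : realType) (n : nat) (Om : set 'rV[R]_n)
    (g : 'rV[R]_n -> R) : Prop :=
  forall e : R, 0 < e -> exists2 dl : R, 0 < dl &
    forall x y, Om x -> Om y -> enorm (x - y) < dl -> `|g x - g y| < e.

Definition bnd (R : realType) (n : nat) (Om : set 'rV[R]_n) : set 'rV[R]_n :=
  closure Om `\` interior Om.

Definition bounded_domain (R : realType) (n : nat) (Om : set 'rV[R]_n) : Prop :=
  [/\ open Om, connected Om, Om !=set0 & bounded_set Om].

Definition C2_boundary (R : realType) (n : nat) (Om : set 'rV[R]_n) : Prop :=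
  forall x0, bnd Om x0 ->
    exists (V : set 'rV[R]_n) (rho : 'rV[R]_n -> R),
      [/\ open V, V x0, Ck 2 rho, exists i, 'D_(evec R i) rho x0 != 0
        & forall x, V x -> (Om x <-> rho x < 0)].

Definition polyhedral_convex (R : realType) (n : nat) (Om : set 'rV[R]_n) : Prop :=
  exists (m : nat) (normal : 'I_m -> 'rV[R]_n) (level : 'I_m -> R),
    Om = [set x | forall k, dot (normal k) x < level k].

Definition admissible_domain (R : realType) (n : nat) (Om : set 'rV[R]_n) : Prop :=
  bounded_domain Om /\ (C2_boundary Om \/ polyhedral_convex Om).

(* nu is the exterior unit normal at x: seen from x, Om is asymptotically the
   half-space (y - x).nu < 0.  There is no such nu on the edges of a polyhedron. *)
Definition exterior_normal (R : realType) (n : nat) (Om : set 'rV[R]_n)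
    (x nu : 'rV[R]_n) : Prop :=
  [/\ bnd Om x, enorm nu = 1
    & forall e : R, 0 < e -> exists2 dl : R, 0 < dl &
        forall y, enorm (y - x) < dl ->
          (dot (y - x) nu < - (e * enorm (y - x)) -> Om y) /\
          (dot (y - x) nu > e * enorm (y - x) -> ~ Om y)].

Section Sobolev.
Variables (R : realType) (n : nat) (Om : set 'rV[R]_n).
Local Notation fn := ('rV[R]_n -> R[i]).

Definition L2norm (f : fn) : \bar R :=
  poweR (\int[leb R n]_(x in Om) ((cabs (f x) ^+ 2)%:E))%E 2^-1.

Definition L2 (f : fn) : Prop :=
  [/\ measurable_fun Om (fun x => complex.Re (f x) : measurableTypeR R),
      measurable_fun Om (fun x => complex.Im (f x) : measurableTypeR R)
    & (L2norm f < +oo)%E].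

Definition aeq (f g : fn) : Prop := ae_eq (leb R n) Om f g.

Definition cint (f : fn) : R[i] :=
  (Rintegral (leb R n) Om (fun x => complex.Re (f x)))
  +i* (Rintegral (leb R n) Om (fun x => complex.Im (f x))).

Definition inner (f g : fn) : R[i] := cint (fun x => f x * conjc (g x)).

Definition mlen (al : 'I_n -> nat) : nat := \sum_i al i.

Definition mseq (al : 'I_n -> nat) : seq 'I_n :=
  flatten [seq nseq (al i) i | i <- enum 'I_n].

Definition weak_derivative (al : 'I_n -> nat) (f g : fn) : Prop :=
  forall phi : 'rV[R]_n -> R, test_function Om phi ->
    cint (fun x => f x * (pds (mseq al) phi x)%:C) =
    (-1) ^+ mlen al * cint (fun x => g x * (phi x)%:C).

Definition Sobolev (k : nat) (f : fn) : Prop :=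
  L2 f /\ forall al : 'I_n -> nat, (mlen al <= k)%N ->
    exists2 g, L2 g & weak_derivative al f g.

(* The weak derivative, determined a.e.; an arbitrary representative is chosen. *)
Definition wD (al : 'I_n -> nat) (f : fn) : fn :=
  xget (fun=> 0) [set g | L2 g /\ weak_derivative al f g].

Definition wD1 (i : 'I_n) : fn -> fn := wD (fun k => (k == i)%N).

Definition wD2 (i j : 'I_n) : fn -> fn := wD (fun k => ((k == i) + (k == j))%N).

Definition Hnorm (k : nat) (f : fn) : \bar R :=
  if `[< Sobolev k f >] then
    poweR (\sum_(al : {ffun 'I_n -> 'I_k.+1} | (mlen (fun i => al i : nat) <= k)%N)
             (L2norm (wD (fun i => al i : nat) f) ^+ 2))%E 2^-1
  else +oo%E.
End Sobolev.

Record nspace (R : realType) (n : nat) := NSpace {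
  nmem : ('rV[R]_n -> R[i]) -> Prop;
  nnorm : ('rV[R]_n -> R[i]) -> \bar R }.

Definition L2sp (R : realType) (n : nat) (Om : set 'rV[R]_n) : nspace R n :=
  NSpace (L2 Om) (L2norm Om).

Definition Hsp (R : realType) (n : nat) (k : nat) (Om : set 'rV[R]_n) : nspace R n :=
  NSpace (Sobolev Om k) (Hnorm Om k).

Section Paths.
Variables (R : realType) (n : nat) (X : nspace R n).
Local Notation fn := ('rV[R]_n -> R[i]).

Definition path_continuous (T : R) (v : R -> fn) : Prop :=
  (forall t, 0 <= t <= T -> nmem X (v t)) /\
  forall t, 0 <= t <= T -> forall e : R, 0 < e -> exists2 dl : R, 0 < dl &
    forall s, 0 <= s <= T -> `|s - t| < dl ->
      (nnorm X (fun x => v s x - v t x)%R <= e%:E)%E.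

Definition path_derivative (T : R) (v v' : R -> fn) : Prop :=
  (forall t, 0 <= t <= T -> nmem X (v t) /\ nmem X (v' t)) /\
  forall t, 0 <= t <= T -> forall e : R, 0 < e -> exists2 dl : R, 0 < dl &
    forall s, 0 <= s <= T -> 0 < `|s - t| < dl ->
      (nnorm X (fun x => ((s - t)^-1)%:C * (v s x - v t x) - v' t x)%R <= e%:E)%E.

Definition path_C1 (T : R) (v : R -> fn) : Prop :=
  exists2 v', path_derivative T v v' & path_continuous T v'.

(* Complex differentiability at every point of the open set U. *)
Definition holomorphic (U : set R[i]) (v v' : R[i] -> fn) : Prop :=
  (forall z, U z -> nmem X (v z) /\ nmem X (v' z)) /\
  forall z, U z -> forall e : R, 0 < e -> exists2 dl : R, 0 < dl &
    forall w, U w -> 0 < cabs (w - z) < dl ->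
      (nnorm X (fun x => (w - z)^-1 * (v w x - v z x) - v' z x)%R <= e%:E)%E.

(* I is the Riemann integral of F along the segment from p1 to p2, as a limit
   in norm of Riemann sums over tagged partitions 0 = s_0 <= ... <= s_N = 1 of
   the parameter interval. *)
Definition segment_integral (p1 p2 : R[i]) (F : R[i] -> fn) (I : fn) : Prop :=
  nmem X I /\
  forall e : R, 0 < e -> exists2 dl : R, 0 < dl &
    forall (N : nat) (s xi : nat -> R), s 0%N = 0 -> s N = 1 ->
      (forall k, (k < N)%N -> s k <= xi k <= s k.+1 /\ s k.+1 - s k < dl) ->
      (nnorm X (fun x =>
         \sum_(k < N) ((p2 - p1) * (s k.+1 - s k)%:C * F (p1 + (xi k)%:C * (p2 - p1)) x)
         - I x)%R <= e%:E)%E.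
End Paths.

(* A regular C^2 parametrization of a relatively open piece of the boundary.
   If the boundary is C^2, finitely many of these cover it; for a polyhedron the
   affine parametrizations of the (relatively open) faces are charts, and they
   cover the boundary up to a null set.  In both cases a finite number of charts
   gives the usual norms, so that null sets, convergence in L^2(bnd Om) and
   membership, convergence and differentiability in H^2(bnd Om) (face by face
   for a polyhedron) can be tested on all charts. *)
Definition boundary_chart (R : realType) (d : nat) (Om : set 'rV[R]_d.+1)
    (V : set 'rV[R]_d) (psi : 'rV[R]_d -> 'rV[R]_d.+1) : Prop :=
  [/\ open V /\ bounded_set V,
      forall i, Ck 2 (fun y => psi y ord0 i),
      forall y, closure V y ->
        \rank (\matrix_(k < d, i < d.+1)
                 'D_(evec R k) (fun y' => psi y' ord0 i) y) = d,
      {in closure V &, injective psi}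
    & exists2 W, open W & psi @` V = W `&` bnd Om].

Section Boundary.
Variables (R : realType) (d : nat) (Om : set 'rV[R]_d.+1).
Local Notation fn := ('rV[R]_d.+1 -> R[i]).

Definition bd_aeq (g h : fn) : Prop :=
  forall V psi, boundary_chart Om V psi -> aeq V (g \o psi) (h \o psi).

(* g is the trace on the boundary of v in H^1(Om): the limit in L^2(bnd Om) of the
   restrictions of functions smooth up to the boundary which tend to v in H^1. *)
Definition trace (v g : fn) : Prop :=
  Sobolev Om 1 v /\
  exists2 phi : nat -> fn,
    (forall k, Cinfty (fun x => complex.Re (phi k x)) /\
               Cinfty (fun x => complex.Im (phi k x))) /\
    Hnorm Om 1 (fun x => phi k x - v x) @[k --> \oo] --> 0%E
  & forall V psi, boundary_chart Om V psi ->
      L2 V (g \o psi) /\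
      L2norm V (fun y => phi k (psi y) - g (psi y)) @[k --> \oo] --> 0%E.

Definition C1_boundary_function (g : 'rV[R]_d.+1 -> R) : Prop :=
  exists2 g1, Ck 1 g1 & forall x, bnd Om x -> g x = g1 x.
End Boundary.

Record coefficients (R : realType) (n : nat) := Coefficients {
  ca : 'I_n -> 'I_n -> 'rV[R]_n -> R;
  cb : 'I_n -> 'rV[R]_n -> R;
  cc : 'rV[R]_n -> R }.

Inductive boundary_operator (R : realType) (n : nat) :=
| Dirichlet (gam : 'rV[R]_n -> R)
| Oblique (bet : 'I_n -> 'rV[R]_n -> R) (gam : 'rV[R]_n -> R).

Section Operators.
Variables (R : realType) (d : nat) (Om : set 'rV[R]_d.+1).
Variables (co : coefficients R d.+1) (B : boundary_operator R d.+1).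
Local Notation fn := ('rV[R]_d.+1 -> R[i]).

Definition elliptic_coefficients : Prop :=
  [/\ forall i j x, Om x -> ca co i j x = ca co j i x,
      exists2 lam : R, 0 < lam & forall x (xi : 'rV[R]_d.+1), Om x ->
        \sum_i \sum_j ca co i j x * xi ord0 i * xi ord0 j >= lam * enorm xi ^+ 2,
      forall i j, C1_closure Om (ca co i j),
      forall i, unif_continuous_on Om (cb co i)
    & unif_continuous_on Om (cc co)].

Definition boundary_coefficients : Prop :=
  match B with
  | Dirichlet gam => C1_boundary_function Om gam
  | Oblique bet gam =>
    [/\ forall i, C1_boundary_function Om (bet i),
        C1_boundary_function Om gam
      & exists2 kap : R, 0 < kap & forall x nu, exterior_normal Om x nu ->
          kap <= `|\sum_i bet i x * nu ord0 i|]
  end.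

Definition Dop (v : fn) : fn := fun x =>
  \sum_i \sum_j (ca co i j x)%:C * wD2 Om i j v x
  + \sum_i (cb co i x)%:C * wD1 Om i v x
  + (cc co x)%:C * v x.

(* B v = g on the boundary, for v in H^2(Om), in the sense of traces. *)
Definition Bop (v g : fn) : Prop :=
  match B with
  | Dirichlet gam =>
    exists2 g0, trace Om v g0 & bd_aeq Om g (fun x => (gam x)%:C * g0 x)
  | Oblique bet gam =>
    exists (g0 : fn) (g1 : 'I_d.+1 -> fn),
      [/\ trace Om v g0, forall i, trace Om (wD1 Om i v) (g1 i)
        & bd_aeq Om g
            (fun x => \sum_i (bet i x)%:C * g1 i x + (gam x)%:C * g0 x)]
  end.

Definition domA (v : fn) : Prop := Sobolev Om 2 v /\ Bop v (fun=> 0).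

Definition resolvent_bound (z : R[i]) (K : R) : Prop :=
  forall w, domA w ->
    (L2norm Om w <= K%:E * L2norm Om (fun x => z * w x - Dop w x)%R)%E.

Definition in_resolvent_set (z : R[i]) : Prop :=
  [/\ forall g, L2 Om g ->
        exists2 w, domA w & aeq Om (fun x => z * w x - Dop w x) g,
      forall w, domA w -> aeq Om (fun x => z * w x - Dop w x) (fun=> 0) ->
        aeq Om w (fun=> 0)
    & exists K : R, resolvent_bound z K].

(* 0 and all nonzero z with |arg z| <= pi - theta. *)
Definition sector (theta : R) : set R[i] :=
  [set z | exists rad phi : R, [/\ 0 <= rad, `|phi| <= pi - theta
                                 & z = (rad * cos phi) +i* (rad * sin phi)]].

Record standing_operator : Prop := StandingOperator {
  so_dense : forall v, L2 Om v -> forall e : R, 0 < e ->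
    exists2 w, domA w & (L2norm Om (fun x => v x - w x)%R < e%:E)%E;
  so_sectorial : exists theta M : R,
    0 < theta < pi / 2 /\
    forall z, sector theta z ->
      in_resolvent_set z /\ (z != 0 -> resolvent_bound z (M / cabs z));
  so_symmetric : forall v w, domA v -> domA w ->
    inner Om (Dop v) w = inner Om v (Dop w);
  so_eigenbasis : exists (lam : nat -> R) (e : nat -> fn),
    [/\ forall j, lam j <= 0,
        forall j, domA (e j) /\ aeq Om (Dop (e j)) (fun x => (lam j)%:C * e j x),
        forall j k, inner Om (e j) (e k) = (j == k)%:R
      & forall v, L2 Om v ->
          L2norm Om (fun x => v x - \sum_(j < N) inner Om v (e j) * e j x)%R
            @[N --> \oo] --> 0%E];
  so_solvable : exists C : R, forall g, L2 Om g ->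
    exists v, [/\ domA v, aeq Om (Dop v) g,
                  (Hnorm Om 2 v <= C%:E * L2norm Om g)%E
                & forall v', domA v' -> aeq Om (Dop v') g -> aeq Om v' v] }.

(* S z = e^(zA), for z = 0 and for z with positive real part: an analytic
   semigroup whose infinitesimal generator is A. *)
Definition semigroup_time (z : R[i]) : Prop := z = 0 \/ 0 < complex.Re z.

Record analytic_semigroup (S : R[i] -> fn -> fn) : Prop := AnalyticSemigroup {
  sg_L2 : forall z v, semigroup_time z -> L2 Om v -> L2 Om (S z v);
  sg_linear : forall z (k : R[i]) v w, semigroup_time z -> L2 Om v -> L2 Om w ->
    aeq Om (S z (fun x => k * v x + w x)) (fun x => k * S z v x + S z w x);
  sg_bounded : forall z, semigroup_time z -> exists K : R, forall v, L2 Om v ->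
    (L2norm Om (S z v) <= K%:E * L2norm Om v)%E;
  sg_0 : forall v, L2 Om v -> aeq Om (S 0 v) v;
  sg_add : forall z w v, semigroup_time z -> semigroup_time w -> L2 Om v ->
    aeq Om (S (z + w) v) (S z (S w v));
  sg_analytic : forall v, L2 Om v ->
    exists v', holomorphic (L2sp Om) [set z | 0 < complex.Re z] (S ^~ v) v';
  sg_continuous : forall v (m : R), L2 Om v -> forall e : R, 0 < e ->
    exists2 dl : R, 0 < dl & forall z, 0 < complex.Re z ->
      `|complex.Im z| <= m * complex.Re z -> cabs z < dl ->
      (L2norm Om (fun x => S z v x - v x)%R <= e%:E)%E;
  sg_generator : forall v w, L2 Om v -> L2 Om w ->
    (L2norm Om (fun x => (t^-1)%:C * (S t%:C v x - v x) - w x)%R @[t --> 0^'+] --> 0%E)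
    <-> (domA v /\ aeq Om (Dop v) w) }.

(* [b] and [z] are analytic on U, an open neighbourhood of [0, T] in the complex
   plane, with z' the derivative of z; for time-independent boundary values, z is
   time-independent and U is the whole plane. *)
Record boundary_data (T : R) (U : set R[i]) (b z z' : R[i] -> fn) : Prop :=
  BoundaryData {
  bd_open : copen U;
  bd_nbhd : forall t : R, 0 <= t <= T -> U t%:C;
  bd_C1 : forall V psi, boundary_chart Om V psi ->
    path_C1 (Hsp 2 V) T (fun t y => b t%:C (psi y));
  bd_analytic : forall V psi, boundary_chart Om V psi ->
    exists b', holomorphic (Hsp 2 V) U (fun s y => b s (psi y)) b';
  bz_C1 : path_C1 (Hsp 2 Om) T (fun t => z t%:C);
  bz_analytic : holomorphic (Hsp 2 Om) U z z';
  bz_lift : forall t : R, 0 <= t <= T -> Bop (z t%:C) (b t%:C);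
  bz_stationary : (forall t : R, 0 <= t <= T -> bd_aeq Om (b t%:C) (b 0)) ->
    U = setT /\ forall s, z s = z 0 }.

Definition exact_solution (T : R) (b : R[i] -> fn) (f u0 : fn) (u : R -> fn) : Prop :=
  exists u' u'' : R -> fn,
    [/\ path_derivative (Hsp 2 Om) T u u' /\ path_derivative (Hsp 2 Om) T u' u'',
        path_continuous (Hsp 2 Om) T u'',
        forall t, 0 < t <= T -> aeq Om (u' t) (fun x => Dop (u t) x + f x),
        forall t, 0 < t <= T -> Bop (u t) (b t%:C)
      & aeq Om (u 0) u0].

(* The condition B(r - Df) = 0 is understood for r - Df in H^2(Om), i.e. as
   r - Df being in the domain of A; likewise for q - f. *)
Definition correctors (f r q : fn) : Prop :=
  [/\ Sobolev Om 2 r /\ Sobolev Om 2 q,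
      aeq Om (Dop r) (fun=> 0), domA (fun x => r x - Dop f x),
      aeq Om (Dop q) r & domA (fun x => q x - f x)].

Definition step_a : R[i] :=
  4%:R^-1 * (1 - ((Num.sqrt 3%:R)^-1)%:C * 'i%C).

Definition step_abar : R[i] :=
  4%:R^-1 * (1 + ((Num.sqrt 3%:R)^-1)%:C * 'i%C).

Definition step_c : R[i] := 2%:R^-1.

Definition shift (s : R[i]) (g w : fn) : fn := fun x => w x + s * g x.

Definition flow_f (f : fn) (s : R[i]) : fn -> fn := shift s f.

Definition flow_Nq (q : fn) (s : R[i]) : fn -> fn := shift s (fun x => - q x).

(* [w'] is the value, at local time p2, of the flow of w_t = D w + q, B w = b which
   equals w at local time p1; [t] is the time at which the step starts.  This and
   [Phi] are the graphs of maps on L^2(Om). *)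
Definition flow_Dq (S : R[i] -> fn -> fn) (z z' : R[i] -> fn) (q : fn)
    (t p1 p2 : R[i]) (w w' : fn) : Prop :=
  L2 Om w' /\
  exists2 I : fn,
    segment_integral (L2sp Om) p1 p2
      (fun s => S (p2 - s) (fun x => Dop (z (t + s)) x - z' (t + s) x + q x)) I
  & aeq Om w' (fun x =>
      z (t + p2) x + S (p2 - p1) (fun y => w y - z (t + p1) y) x + I x).

Definition Phi (S : R[i] -> fn -> fn) (z z' : R[i] -> fn) (f q : fn)
    (tau : R) (k : nat) (w w' : fn) : Prop :=
  let t := (k%:R * tau)%:C in
  let s := tau%:C in
  exists w1 w2 : fn,
    [/\ flow_Dq S z z' q t 0 (2%:R * step_a * s)
          (flow_Nq q (step_a * s) (flow_f f (step_a * s) w)) w1,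
        flow_Dq S z z' q t (2%:R * step_a * s) s
          (flow_Nq q (step_abar * s)
            (flow_f f (step_c * s) (flow_Nq q (step_a * s) w1))) w2,
        L2 Om w'
      & aeq Om w' (flow_f f (step_abar * s) (flow_Nq q (step_abar * s) w2))].

(* The complex times of every step up to time T lie in U.  The triangle spanned
   by t_n, t_n + 2 a tau and t_{n+1} is used, not only its two complex sides;
   for simply connected U this is the same. *)
Definition admissible_step (T : R) (U : set R[i]) (tau : R) : Prop :=
  forall k : nat, k.+1%:R * tau <= T ->
    forall x y : R, 0 <= x -> 0 <= y -> x + y <= 1 ->
      U ((k%:R * tau)%:C + x%:C * (2%:R * step_a * tau%:C) + (y * tau)%:C).
End Operators.

(* Main.v *)
(* In the eigenbasis of A everything becomes scalar.  If (e_j) is the basis and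
   x = tau lam_j, a step of the method differs from the exact evolution over the same
   step, in the j-th coefficient, by tau E(x) <f - q, e_j>, where
     E(x) = a e^x + e^(2 abar x) / 2 + abar - (e^x - 1) / x
   is the error of the three-point quadrature hidden in the splitting.  The inhomogeneous
   boundary data contribute the same amount to both: the integrals of one and the same
   holomorphic function over two sides, respectively the third side, of the triangle
   t_n, t_n + 2 a tau, t_(n+1), which agree by Cauchy's theorem.

   The order conditions make E(x) = O(x^3) near 0, and |E(x)| <= 56 x^2 (1 - e^x) for all
   x < 0.  The factor 1 - e^x cancels the sum of the propagators e^(k x), so that the error
   after any number of steps is at most 56 tau^3 lam_j^2 |<f - q, e_j>|.  Finally
   lam_j^2 <q - f, e_j> = <A (r - D f), e_j>, since q - f and r - D f = D (q - f) are both
   in the domain of A: this is what the correctors are for.  Parseval's inequality gives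
   the bound 112 tau^3 |D (r - D f)| in L^2(Om), even without the logarithm. *)
Require Import Defs.
Set Warnings "-all".
From mathcomp Require Import all_boot all_order all_algebra.
From mathcomp Require Import complex ring lra.
From mathcomp Require Import all_classical all_reals all_analysis.
From mathcomp Require Import measurable_realfun.
Import Order.TTheory GRing.Theory Num.Theory.
Import numFieldNormedType.Exports.
Local Open Scope classical_set_scope.
Local Open Scope ring_scope.
Local Open Scope complex_scope.

Set Implicit Arguments.
Unset Strict Implicit.
Unset Printing Implicit Defensive.

(** * Complex differentiation along subsets of the plane *)

(** The semigroup is given by axioms and the flows by norm limits of Riemann sums. Bounded
    functionals, the coefficients in the eigenbasis, turn holomorphy, path derivatives and segment
    integrals into scalar statements, so that no integral of a vector-valued function has to be
    computed. A scalar line integral is a difference of values of a primitive along one segment; a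
    limit of Riemann sums over arbitrary tags must agree with it, since the mean value theorem
    supplies tags for which the sums are exact. The scalar function integrated over the triangle is
    differentiable at every point of [U], but nothing is known about the continuity of its
    derivative. This is why Cauchy's theorem is proved by Goursat's bisection. [wD] picks an
    arbitrary representative, so even the linearity of D up to null sets rests on the uniqueness of
    weak derivatives, hence on the fundamental lemma of the calculus of variations and on a supply
    of bump functions. No series of local errors is summed: the claimed bound is a fixed point of
    the scalar recursion. *)

Section ComplexCalculus.
Context {R : realType}.
Implicit Types (x y e : R) (z w p q s l : R[i]) (F : R[i] -> R[i]) (A : set R[i]).

Lemma ReD z w : @complex.Re R (z + w) = complex.Re z + complex.Re w.
Proof. by case: z; case: w. Qed.
Lemma ImD z w : @complex.Im R (z + w) = complex.Im z + complex.Im w.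
Proof. by case: z; case: w. Qed.
Lemma ReN z : @complex.Re R (- z) = - complex.Re z.
Proof. by case: z. Qed.
Lemma ImN z : @complex.Im R (- z) = - complex.Im z.
Proof. by case: z. Qed.
Lemma ReM z w : @complex.Re R (z * w) = complex.Re z * complex.Re w - complex.Im z * complex.Im w.
Proof. by case: z; case: w. Qed.
Lemma ImM z w : @complex.Im R (z * w) = complex.Re z * complex.Im w + complex.Im z * complex.Re w.
Proof. by case: z; case: w. Qed.
Definition ReImE := (ReD, ImD, ReN, ImN, ReM, ImM).

Lemma normC_cabs z : `|z| = (cabs z)%:C.
Proof. by rewrite normc_def. Qed.
Lemma lec_real x y : (x%:C <= y%:C) = (x <= y).
Proof. by rewrite lecE /= eqxx. Qed.
Lemma cabs_ge0 z : 0 <= cabs z.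
Proof. exact: sqrtr_ge0. Qed.
Lemma cabsM z w : cabs (z * w) = cabs z * cabs w.
Proof.
have := normrM z w; rewrite !normC_cabs -rmorphM => /(congr1 (@complex.Re R)).
by [].
Qed.
Lemma cabsD z w : cabs (z + w) <= cabs z + cabs w.
Proof. by have := ler_normD z w; rewrite !normC_cabs -rmorphD lec_real. Qed.
Lemma cabsN z : cabs (- z) = cabs z.
Proof. by rewrite /cabs !ReImE !sqrrN. Qed.
Lemma cabsB z w : cabs (z - w) <= cabs z + cabs w.
Proof. by rewrite -(cabsN w) cabsD. Qed.
Lemma cabs_sym z w : cabs (z - w) = cabs (w - z).
Proof. by rewrite -opprB cabsN. Qed.
Lemma cabs0 : cabs (0 : R[i]) = 0.
Proof. by rewrite /cabs /= expr0n addr0 sqrtr0. Qed.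
Lemma cabs_eq0 z : (cabs z == 0) = (z == 0).
Proof.
apply/idP/idP => [/eqP h|/eqP->]; last by rewrite cabs0.
by rewrite -normr_eq0 normC_cabs h.
Qed.
Lemma cabs_gt0 z : (0 < cabs z) = (z != 0).
Proof. by rewrite lt_def cabs_eq0 cabs_ge0 andbT. Qed.
Lemma cabsR x : cabs x%:C = `|x|.
Proof. by rewrite /cabs /= expr0n addr0 sqrtr_sqr. Qed.
Lemma cabsV z : cabs z^-1 = (cabs z)^-1.
Proof.
have [->|z0] := eqVneq z 0; first by rewrite invr0 cabs0 invr0.
apply: (mulfI (x := cabs z)); first by rewrite cabs_eq0.
rewrite -cabsM divff // divff ?cabs_eq0 //.
by rewrite -[1]/(1%:C) cabsR normr1.
Qed.
Lemma cabs_Re z : `|complex.Re z| <= cabs z.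
Proof.
rewrite -sqrtr_sqr ler_wsqrtr // lerDl sqr_ge0 //.
Qed.
Lemma cabs_Im z : `|complex.Im z| <= cabs z.
Proof.
rewrite -sqrtr_sqr ler_wsqrtr // lerDr sqr_ge0 //.
Qed.
Lemma cabs_le z : cabs z <= `|complex.Re z| + `|complex.Im z|.
Proof.
rewrite {1}(complexE z); apply: (le_trans (cabsD _ _)).
by rewrite cabsM !cabsR -[cabs 'i%C]/(Num.sqrt (0 ^+ 2 + 1 ^+ 2)) expr0n expr1n add0r sqrtr1 mul1r.
Qed.
Lemma cabs_sqr z : cabs z ^+ 2 = complex.Re z ^+ 2 + complex.Im z ^+ 2.
Proof. by rewrite sqr_sqrtr // addr_ge0 ?sqr_ge0. Qed.

(* Differentiability relative to A: for A a segment this is the derivative along it, for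
   A open the complex derivative. *)
Definition cderiv A F l s := forall e, 0 < e -> exists2 dl : R, 0 < dl &
  forall w, A w -> cabs (w - s) < dl -> cabs (F w - F s - l * (w - s)) <= e * cabs (w - s).

Lemma cderiv_sub A A' F l s : A' `<=` A -> cderiv A F l s -> cderiv A' F l s.
Proof.
by move=> AA h e e0; have [dl dl0 H] := h e e0; exists dl => // w /AA; apply: H.
Qed.

Lemma cderiv_cst A l s : cderiv A (fun=> l) 0 s.
Proof.
move=> e e0; exists 1 => // w _ _.
by rewrite subrr mul0r subr0 cabs0 mulr_ge0 ?cabs_ge0 ?ltW.
Qed.

Lemma cderiv_id A s : cderiv A id 1 s.
Proof.
move=> e e0; exists 1 => // w _ _.
by rewrite mul1r subrr cabs0 mulr_ge0 ?cabs_ge0 ?ltW.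
Qed.

Lemma cderivD A F G l m s : cderiv A F l s -> cderiv A G m s ->
  cderiv A (fun w => F w + G w) (l + m) s.
Proof.
move=> h k e e0; have e20 : 0 < e / 2 by rewrite divr_gt0.
have [d d0 H] := h _ e20; have [d' d'0 H'] := k _ e20.
exists (Num.min d d'); first by rewrite lt_min d0.
move=> w Aw; rewrite lt_min => /andP[w1 w2].
have -> : F w + G w - (F s + G s) - (l + m) * (w - s) =
  (F w - F s - l * (w - s)) + (G w - G s - m * (w - s)) by ring.
apply: (le_trans (cabsD _ _)).
rewrite [e]splitr mulrDl lerD //; [exact: H|exact: H'].
Qed.

Lemma cderiv_bound A F l s : cderiv A F l s -> exists2 d : R, 0 < d &
  forall w, A w -> cabs (w - s) < d -> cabs (F w - F s) <= (1 + cabs l) * cabs (w - s).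
Proof.
move=> /(_ 1 ltr01)[d d0 H]; exists d => // w Aw wd.
have -> : F w - F s = (F w - F s - l * (w - s)) + l * (w - s) by ring.
apply: (le_trans (cabsD _ _)).
by rewrite mulrDl cabsM lerD ?H.
Qed.

Lemma cderiv_continuous A F l s : cderiv A F l s -> forall e, 0 < e ->
  exists2 d : R, 0 < d & forall w, A w -> cabs (w - s) < d -> cabs (F w - F s) <= e.
Proof.
move=> /cderiv_bound[d d0 H] e e0.
have L0 : 0 < 1 + cabs l by rewrite ltr_pwDl ?cabs_ge0.
exists (Num.min d (e / (1 + cabs l))).
  by rewrite lt_min d0 divr_gt0.
move=> w Aw; rewrite lt_min => /andP[w1 w2].
apply: (le_trans (H w Aw w1)).
by rewrite mulrC -ler_pdivlMr // ltW.
Qed.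

Lemma cderivM A F G l m s : cderiv A F l s -> cderiv A G m s ->
  cderiv A (fun w => F w * G w) (l * G s + F s * m) s.
Proof.
move=> h k e e0.
have [d1 d10 H1] := cderiv_bound h.
(* K / 3 dominates each of |F s|, |G s| and 1 + |l|, the factors that multiply the three errors
   below; each error term then costs at most a third of e. *)
pose K := 3 * (1 + cabs (F s) + cabs (G s) + cabs m + cabs l).
have K0 : 0 < K.
  by rewrite mulr_gt0 // -!addrA ltr_pwDl // !addr_ge0 ?cabs_ge0.
have K1 : cabs (F s) <= K / 3.
  rewrite /K mulrC mulKf // -!addrA addrCA lerDl !addr_ge0 ?cabs_ge0 //.
have K2 : cabs (G s) <= K / 3.
  rewrite /K mulrC mulKf // -!addrA; have := cabs_ge0 (F s); have := cabs_ge0 m; have := cabs_ge0 l; lra.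
have K3 : 1 + cabs l <= K / 3.
  rewrite /K mulrC mulKf // -!addrA; have := cabs_ge0 (F s); have := cabs_ge0 m; have := cabs_ge0 (G s); lra.
have eK : 0 < e / K by rewrite divr_gt0.
have [d2 d20 H2] := h _ eK.
have [d3 d30 H3] := k _ eK.
have [d4 d40 H4] := cderiv_continuous k eK.
exists (Num.min (Num.min d1 d2) (Num.min d3 d4)); first by rewrite !lt_min d10 d20 d30.
move=> w Aw; rewrite !lt_min => /andP[/andP[w1 w2] /andP[w3 w4]].
have -> : F w * G w - F s * G s - (l * G s + F s * m) * (w - s) =
  (F w - F s - l * (w - s)) * G s + F s * (G w - G s - m * (w - s))
  + (F w - F s) * (G w - G s) by ring.
apply: (le_trans (cabsD _ _)); rewrite [in X in _ <= X]mulrC.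
apply: (@le_trans _ _ (cabs (w - s) * ((e / K) * (K / 3)) *+ 3)); last first.
  rewrite -mulrnAr ler_wpM2l ?cabs_ge0 // mulrA divfK ?gt_eqF //.
  by rewrite -mulr_natr divfK ?pnatr_eq0.
rewrite mulrSr lerD //.
  rewrite mulr2n; apply: (le_trans (cabsD _ _)); rewrite lerD //.
    rewrite cabsM mulrA ler_pM ?cabs_ge0 //.
    by rewrite [leRHS]mulrC H2.
  rewrite cabsM [leLHS]mulrC mulrA ler_pM ?cabs_ge0 //.
  by rewrite [leRHS]mulrC H3.
rewrite cabsM (mulrC (e / K)) mulrA ler_pM ?cabs_ge0 //; last exact: H4.
by rewrite [leRHS]mulrC (le_trans (H1 _ Aw w1)) // ler_wpM2r ?cabs_ge0.
Qed.

Lemma cderivZ A F l c s : cderiv A F l s -> cderiv A (fun w => c * F w) (c * l) s.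
Proof.
move=> h; have := cderivM (cderiv_cst A c s) h.
by rewrite mul0r add0r.
Qed.

Lemma cderivN A F l s : cderiv A F l s -> cderiv A (fun w => - F w) (- l) s.
Proof.
move=> /(cderivZ (-1)); rewrite mulN1r; congr (cderiv _ _ _ _).
by apply/funext => w; rewrite mulN1r.
Qed.

Lemma cderivB A F G l m s : cderiv A F l s -> cderiv A G m s ->
  cderiv A (fun w => F w - G w) (l - m) s.
Proof. by move=> h k; apply: cderivD => //; apply: cderivN. Qed.

Lemma cderiv_shift A F l s c : cderiv A F l (c + s) ->
  cderiv [set w | A (c + w)] (fun w => F (c + w)) l s.
Proof.
move=> h e e0; have [d d0 H] := h e e0; exists d => // w Aw wd.
have E : c + w - (c + s) = w - s by ring.
by have := H _ Aw; rewrite E; apply.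
Qed.

(** Composing with this retraction onto [0, 1] extends a function known along a segment to a
    continuous function on the whole line, as the real mean value theorem and the fundamental
    theorem of calculus are applied to it. *)
Definition clamp x : R := Num.max 0 (Num.min 1 x).
Lemma clamp_itv x : 0 <= clamp x <= 1.
Proof.
by rewrite /clamp le_max lexx /= ge_max ler01 ge_min lexx.
Qed.
Lemma clampK x : 0 <= x <= 1 -> clamp x = x.
Proof. by move=> /andP[x0 x1]; rewrite /clamp (min_idPr x1) (max_idPr x0). Qed.
Lemma clamp_lip x y : `|clamp x - clamp y| <= `|x - y|.
Proof.
have := ler_norm (x - y); have := ler_norm (y - x); rewrite (distrC y x) => h1 h2.
rewrite ler_norml /clamp /Num.max /Num.min.
case: (ltP 1 x) => ? /=; case: (ltP 1 y) => ? /=; rewrite ?ltr01;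
  case: (ltP 0 x) => ?; case: (ltP 0 y) => ?; apply/andP; split; lra.
Qed.

Lemma continuous_eps (f : R -> R) : (forall x e, 0 < e ->
  exists2 d : R, 0 < d & forall y, `|y - x| < d -> `|f y - f x| <= e) -> continuous f.
Proof.
move=> h x; apply/cvgrPdist_le => e e0.
have [d d0 H] := h x e e0; near=> y.
rewrite distrC; apply: H.
near: y; apply/nbhs_normP; exists d => //= y; by rewrite /ball_ /= distrC.
Unshelve. all: by end_near. Qed.

Lemma is_derive_eps (f : R -> R) x (l : R) : (forall e, 0 < e ->
  exists2 d : R, 0 < d & forall h, `|h| < d -> `|f (x + h) - f x - l * h| <= e * `|h|) ->
  is_derive x 1 f l.
Proof.
move=> H.
have C : (fun h => h^-1 *: (f (h *: 1 + x) - f x)) @ 0^' --> l.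
  apply/cvgrPdist_le => e e0; have [d d0 K] := H e e0; near=> h.
  have h0 : h != 0 by near: h; exact: nbhs_dnbhs_neq.
  have hd : `|h| < d.
    near: h; apply: dnbhs0_lt => //.
  rewrite distrC /GRing.scale /= mulr1 (addrC h).
  have -> : h^-1 * (f (x + h) - f x) - l = h^-1 * (f (x + h) - f x - l * h) by field.
  rewrite normrM normfV ler_pdivrMl ?normr_gt0 // [leRHS]mulrC; exact: K.
by apply: DeriveDef; [apply/cvg_ex; exists l|apply: cvg_lim].
Unshelve. all: by end_near. Qed.

Definition pt p q x : R[i] := p + x%:C * (q - p).
Definition seg p q : set R[i] := [set w | exists2 x, 0 <= x <= 1 & w = pt p q x].

Lemma pt0 p q : pt p q 0 = p.
Proof. by rewrite /pt mul0r addr0. Qed.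
Lemma pt1 p q : pt p q 1 = q.
Proof. by rewrite /pt mul1r addrC subrK. Qed.
Lemma seg_pt p q x : 0 <= x <= 1 -> seg p q (pt p q x).
Proof. by exists x. Qed.
Lemma seg_left p q : seg p q p.
Proof. by exists 0; rewrite ?lexx ?ler01 ?pt0. Qed.
Lemma seg_right p q : seg p q q.
Proof. by exists 1; rewrite ?lexx ?ler01 ?pt1. Qed.
Lemma ptB p q x y : pt p q x - pt p q y = (x - y)%:C * (q - p).
Proof. rewrite /pt rmorphB /=; ring. Qed.
Lemma cabs_ptB p q x y : cabs (pt p q x - pt p q y) = `|x - y| * cabs (q - p).
Proof. by rewrite ptB cabsM cabsR. Qed.

(* There is no mean value theorem for complex values: the intermediate points for the
   real and the imaginary part are different. *)
Lemma segMVT F F' p q :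
  (forall x, 0 <= x <= 1 -> exists l, cderiv (seg p q) F l (pt p q x)) ->
  (forall x, 0 < x < 1 -> cderiv (seg p q) F (F' (pt p q x)) (pt p q x)) ->
  exists2 xi : R, 0 < xi < 1 &
    complex.Re (F q - F p) = complex.Re ((q - p) * F' (pt p q xi)).
Proof.
move=> hc hd; pose f x := complex.Re (F (pt p q (clamp x))).
have D0 : 0 < 1 + cabs (q - p) by rewrite ltr_pwDl ?cabs_ge0.
have fc : continuous f.
  apply: continuous_eps => x e e0.
  have [l /cderiv_continuous/(_ _ e0)[d d0 H]] := hc _ (clamp_itv x).
  exists (d / (1 + cabs (q - p))); first by rewrite divr_gt0.
  move=> y yx; rewrite -ReN -ReD; apply: (le_trans (cabs_Re _)).
  apply: H; first exact: seg_pt (clamp_itv _).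
  rewrite cabs_ptB; apply: (@le_lt_trans _ _ (`|y - x| * (1 + cabs (q - p)))).
    by rewrite ler_pM ?cabs_ge0 ?clamp_lip // lerDr.
  by rewrite -ltr_pdivlMr.
have fd x : x \in `]0, 1[%R -> is_derive x 1 f (complex.Re ((q - p) * F' (pt p q x))).
  rewrite in_itv /= => x01; have x01' : 0 <= x <= 1 by case/andP: x01 => /ltW-> /ltW->.
  apply: is_derive_eps => e e0.
  have [d d0 H] := hd x x01 _ (divr_gt0 e0 D0).
  exists (Num.min (Num.min x (1 - x)) (d / (1 + cabs (q - p)))).
    by rewrite !lt_min divr_gt0 // subr_gt0 andbT; case/andP: x01 => -> ->.
  move=> h; rewrite !lt_min => /andP[/andP[h1 h2] h3].
  have xh : 0 <= x + h <= 1.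
    move: h1 h2; rewrite !ltr_norml => /andP[h1 _] /andP[_ h2].
    by apply/andP; split; lra.
  rewrite /f !clampK //.
  have E : pt p q (x + h) - pt p q x = h%:C * (q - p) by rewrite ptB addrC addKr.
  have -> : complex.Re (F (pt p q (x + h))) - complex.Re (F (pt p q x)) -
     complex.Re ((q - p) * F' (pt p q x)) * h =
     complex.Re (F (pt p q (x + h)) - F (pt p q x) - F' (pt p q x) * (pt p q (x + h) - pt p q x)).
    rewrite E !ReImE /=; ring.
  apply: (le_trans (cabs_Re _)).
  have lh : cabs (pt p q (x + h) - pt p q x) <= `|h| * (1 + cabs (q - p)).
    by rewrite E cabsM cabsR ler_wpM2l // lerDr.
  apply: (le_trans (H _ _ _)); first exact: seg_pt.
    by apply: (le_lt_trans lh); rewrite -ltr_pdivlMr.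
  apply: (@le_trans _ _ (e / (1 + cabs (q - p)) * (`|h| * (1 + cabs (q - p))))).
    by rewrite ler_wpM2l // divr_ge0 // ltW.
  by rewrite mulrCA divfK ?gt_eqF // mulrC.
have [xi xi01 E] := MVT ltr01 fd (continuous_subspaceT fc).
exists xi; first by rewrite in_itv in xi01.
by rewrite subr0 mulr1 in E; rewrite -E /f !clampK ?lexx ?ler01 // pt0 pt1 ReD ReN.
Qed.

Lemma segMVT_Im F F' p q :
  (forall x, 0 <= x <= 1 -> exists l, cderiv (seg p q) F l (pt p q x)) ->
  (forall x, 0 < x < 1 -> cderiv (seg p q) F (F' (pt p q x)) (pt p q x)) ->
  exists2 xi : R, 0 < xi < 1 &
    complex.Im (F q - F p) = complex.Im ((q - p) * F' (pt p q xi)).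
Proof.
move=> hc hd.
(* The real part of -i F is the imaginary part of F. *)
have [x x01|x x01|xi xi01 H] := @segMVT (fun w => - 'i%C * F w) (fun w => - 'i%C * F' w) p q.
- by have [l hl] := hc x x01; exists (- 'i%C * l); apply: cderivZ.
- exact: cderivZ (hd x x01).
exists xi => //; move: H; rewrite -mulrBr mulrCA !(ReM (- 'i%C)) /=.
by rewrite oppr0 !mul0r !sub0r !mulN1r !opprK.
Qed.

(** The factor 2 is the price of two different intermediate points, one for the real and one for the
    imaginary part. *)
Lemma seg_mean_bound F F' p q (K : R) :
  (forall x, 0 <= x <= 1 -> exists l, cderiv (seg p q) F l (pt p q x)) ->
  (forall x, 0 < x < 1 -> cderiv (seg p q) F (F' (pt p q x)) (pt p q x)) ->
  (forall x, 0 < x < 1 -> cabs (F' (pt p q x)) <= K) ->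
  cabs (F q - F p) <= 2 * K * cabs (q - p).
Proof.
move=> hc hd hK; have [x x01 E] := segMVT hc hd; have [y y01 E'] := segMVT_Im hc hd.
apply: (le_trans (cabs_le _)); rewrite E E' -mulrA mulr_natl mulr2n lerD //.
  by apply: (le_trans (cabs_Re _)); rewrite cabsM mulrC ler_wpM2r ?cabs_ge0 ?hK.
by apply: (le_trans (cabs_Im _)); rewrite cabsM mulrC ler_wpM2r ?cabs_ge0 ?hK.
Qed.

Lemma seg_const F p q :
  (forall x, 0 <= x <= 1 -> exists l, cderiv (seg p q) F l (pt p q x)) ->
  (forall x, 0 < x < 1 -> cderiv (seg p q) F 0 (pt p q x)) ->
  F q = F p.
Proof.
move=> hc hd; apply/eqP; rewrite -subr_eq0 -cabs_eq0 eq_le cabs_ge0 andbT.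
have := @seg_mean_bound F (fun=> 0) p q 0 hc hd.
by rewrite cabs0 mulr0 mul0r; apply.
Qed.

End ComplexCalculus.

(** * Primitives along segments and Cauchy's theorem for triangles *)

Section Primitives.
Context {R : realType}.
Implicit Types (x y e : R) (z w p q s l : R[i]) (F : R[i] -> R[i]) (A : set R[i]).

Lemma is_derive_epsP (f : R -> R) x (l : R) : is_derive x 1 f l -> forall e, 0 < e ->
  exists2 d : R, 0 < d & forall h, `|h| < d -> `|f (x + h) - f x - l * h| <= e * `|h|.
Proof.
move=> [/cvg_ex[l' cl] dl] e e0.
have El : l' = l by rewrite -dl; apply/esym/cvg_lim.
move: cl; rewrite El => /cvgrPdist_le/(_ e e0) /nbhs_ballP[d /= d0 H].
exists d => // h hd.
have [->|h0] := eqVneq h 0; first by rewrite addr0 subrr mulr0 subr0 normr0 mulr0.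
have := H h; rewrite /ball /= sub0r normrN => /(_ hd h0).
rewrite /GRing.scale /= mulr1 (addrC h) distrC.
have -> : f (x + h) - f x - l * h = (h^-1 * (f (x + h) - f x) - l) * h by field.
by rewrite normrM => H'; rewrite ler_wpM2r.
Qed.

Lemma continuous_primitive (f : R -> R) : continuous f ->
  exists G : R -> R, forall x, 0 <= x <= 1 -> is_derive x 1 G (f x).
Proof.
(* Integrating from -1, inside the interval from -1 to x + something up to 2, keeps 0 and 1
   interior, so that the derivative is two-sided there. *)
move=> fc; pose G (x : R) := \int[lebesgue_measure]_(t in [set` `[(-1), x]]) (f t).
exists G => x /andP[x0 x1].
have [|||d E] := @continuous_FTC1_closed R f (-1) x 2 _ _ _ (fc x); [lra| |lra|].
  apply: continuous_compact_integrable; first exact: segment_compact.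
  exact: continuous_subspaceT.
split; first exact: d.
by move: E; rewrite derive1E.
Qed.

(** The line integral of F from p to q, encoded by a primitive that is required along this one
    segment only; different segments may use unrelated primitives. *)
Definition segprim F p q v := exists2 L : R[i] -> R[i],
  (forall w, seg p q w -> cderiv (seg p q) L (F w) w) & v = L q - L p.

Lemma seg_sub p q x y : 0 <= x <= 1 -> 0 <= y <= 1 ->
  seg (pt p q x) (pt p q y) `<=` seg p q.
Proof.
move=> /andP[x0 x1] /andP[y0 y1] _ [t /andP[t0 t1] ->].
exists (x + t * (y - x)); last by rewrite /pt !(rmorphD, rmorphM, rmorphB, rmorphN) /=; ring.
apply/andP; split; nra.
Qed.

Lemma segC p q : seg p q = seg q p.
Proof.
suff H : forall p q, seg p q `<=` seg q p by apply/seteqP; split; apply: H.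
move=> {}p {}q _ [x /andP[x0 x1] ->]; exists (1 - x); first by lra.
by rewrite /pt !(rmorphB, rmorph1) /=; ring.
Qed.

Lemma segprim_uniq F p q v v' : segprim F p q v -> segprim F p q v' -> v = v'.
Proof.
move=> [L hL ->] [L' hL' ->].
suff : (fun w => L w - L' w) q = (fun w => L w - L' w) p.
  by move=> /= E; rewrite -[L q](subrK (L' q)) E; ring.
have H x : 0 <= x <= 1 -> cderiv (seg p q) (fun w => L w - L' w) 0 (pt p q x).
  move=> x01; rewrite -(subrr (F (pt p q x))).
  by apply: cderivB; [apply: hL|apply: hL']; apply: seg_pt.
apply: (@seg_const _ (fun w => L w - L' w)) => x; first by exists 0; apply: H.
by case/andP => x0 x1; apply: H; rewrite !ltW.
Qed.

Lemma segprim_sym F p q v : segprim F p q v -> segprim F q p (- v).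
Proof. by move=> [L hL ->]; exists L; rewrite 1?segC // opprB. Qed.

Lemma segprim_split F p q x v : 0 <= x <= 1 -> segprim F p q v ->
  exists v1 v2, [/\ segprim F p (pt p q x) v1, segprim F (pt p q x) q v2 & v = v1 + v2].
Proof.
move=> x01 [L hL ->]; exists (L (pt p q x) - L p), (L q - L (pt p q x)).
have i0 : 0 <= (0 : R) <= 1 by rewrite lexx ler01.
have i1 : 0 <= (1 : R) <= 1 by rewrite lexx ler01.
split; last by ring.
- exists L => // w; have := seg_sub (p := p) (q := q) i0 x01; rewrite pt0 => S /S/hL.
  exact: cderiv_sub.
- exists L => // w; have := seg_sub (p := p) (q := q) x01 i1; rewrite pt1 => S /S/hL.
  exact: cderiv_sub.
Qed.

Lemma segprim_exists F p q :
  (forall w, seg p q w -> exists l, cderiv (seg p q) F l w) -> exists v, segprim F p q v.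
Proof.
move=> hF; have [<-|pq] := eqVneq p q.
  exists 0, (fun w => F p * w); last by rewrite subrr.
  move=> w [x _ wx]; have -> : w = p by rewrite wx /pt subrr mulr0 addr0.
  by have := cderivZ (F p) (@cderiv_id _ (seg p p) p); rewrite mulr1.
have qp : q - p != 0 by rewrite subr_eq0 eq_sym.
have N0 : 0 < cabs (q - p) by rewrite cabs_gt0.
have clampF x e : 0 < e -> exists2 d : R, 0 < d & forall y, `|y - x| < d ->
    cabs ((q - p) * F (pt p q (clamp y)) - (q - p) * F (pt p q (clamp x))) <= e.
  move=> e0; have [l hl] := hF _ (seg_pt p q (clamp_itv x)).
  have [d d0 H] := cderiv_continuous hl (divr_gt0 e0 N0).
  exists (d / cabs (q - p)); first exact: divr_gt0.
  move=> y yd; rewrite -mulrBr cabsM mulrC -ler_pdivlMr //; apply: H.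
    exact: seg_pt (clamp_itv _).
  by rewrite cabs_ptB -ltr_pdivlMr // (le_lt_trans (clamp_lip _ _)).
have [|G1 h1] := @continuous_primitive (fun x => complex.Re ((q - p) * F (pt p q (clamp x)))).
  apply: continuous_eps => x e e0; have [d d0 H] := clampF x e e0; exists d => // y /H.
  by apply: le_trans; rewrite -ReN -ReD cabs_Re.
have [|G2 h2] := @continuous_primitive (fun x => complex.Im ((q - p) * F (pt p q (clamp x)))).
  apply: continuous_eps => x e e0; have [d d0 H] := clampF x e e0; exists d => // y /H.
  by apply: le_trans; rewrite -ImN -ImD cabs_Im.
(* On the segment, (w - p) / (q - p) is the real parameter of w. *)
pose L w := let x := complex.Re ((w - p) / (q - p)) in G1 x +i* G2 x.
have LE x : L (pt p q x) = G1 x +i* G2 x.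
  by rewrite /L /pt addrAC subrr add0r mulfK.
exists (L q - L p), L => // _ [x x01 ->] e e0.
have e2 : 0 < e * cabs (q - p) / 2 by rewrite divr_gt0 // mulr_gt0.
have [d1 d10 H1] := is_derive_epsP (h1 _ x01) e2.
have [d2 d20 H2] := is_derive_epsP (h2 _ x01) e2.
exists (Num.min d1 d2 * cabs (q - p)); first by rewrite mulr_gt0 // lt_min d10.
move=> _ [y y01 ->]; rewrite cabs_ptB ltr_pM2r // lt_min => /andP[yd1 yd2].
rewrite !LE; apply: (le_trans (cabs_le _)).
have := H1 _ yd1; have := H2 _ yd2; rewrite [x + _]addrC subrK clampK // => K2 K1.
have -> : e * (`|y - x| * cabs (q - p)) =
   e * cabs (q - p) / 2 * `|y - x| + e * cabs (q - p) / 2 * `|y - x| by field.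
rewrite ptB !ReImE /= !mul0r ?subr0 ?addr0 in K1 K2 *.
rewrite lerD //.
  move: K1; congr (`|_| <= _); ring.
move: K2; congr (`|_| <= _); ring.
Qed.

(** [H] is a primitive of the affine function al + be (w - s0), so the difference is the integral of
    the remainder alone. With s0 the limit point of the bisection, this is the local estimate behind
    Goursat's theorem. *)
Lemma segprim_bound F p q v s0 (al be : R[i]) (eta : R) (H : R[i] -> R[i]) :
  H = (fun w => al * w + be / 2 * (w - s0) ^+ 2) ->
  (forall w, seg p q w -> cabs (F w - al - be * (w - s0)) <= eta) ->
  segprim F p q v -> cabs (v - (H q - H p)) <= 2 * eta * cabs (q - p).
Proof.
move=> HE hF [L hL ->].
have dH w : cderiv (seg p q) H (al + be * (w - s0)) w.
  rewrite HE; have -> : al + be * (w - s0) = al * 1 + be / 2 * ((1 - 0) * (w - s0) + (w - s0) * (1 - 0)).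
    by field.
  apply: cderivD; first by apply: cderivZ; exact: cderiv_id.
  by apply: cderivZ; apply: (@cderivM _ _ (fun w => w - s0) (fun w => w - s0));
    apply: cderivB; (exact: cderiv_id || exact: cderiv_cst).
have D x : 0 <= x <= 1 -> cderiv (seg p q) (fun w => L w - H w)
    (F (pt p q x) - (al + be * (pt p q x - s0))) (pt p q x).
  by move=> x01; apply: cderivB; [apply: hL; exact: seg_pt|exact: dH].
have := @seg_mean_bound _ (fun w => L w - H w) (fun w => F w - (al + be * (w - s0))) p q eta.
have -> : L q - H q - (L p - H p) = L q - L p - (H q - H p) by ring.
apply.
- by move=> x x01; eexists; exact: D.
- by move=> x /andP[x0 x1]; apply: D; rewrite !ltW.
- by move=> x /andP[x0 x1]; rewrite opprD addrA; apply: hF; apply: seg_pt; rewrite !ltW.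
Qed.

Lemma half_pow_small e : 0 < e -> exists k, (2 ^- k : R) < e.
Proof.
move=> e0; exists (Num.bound e^-1).
rewrite invf_plt ?posrE ?exprn_gt0 //.
apply: (lt_trans (archi_boundP _)); first by rewrite invr_ge0 ltW.
by rewrite -natrX ltr_nat ltn_expl.
Qed.

(** The intervals with centre x k and radius 2^-k are nested, and the supremum of their left ends
    lies in all of them. *)
Lemma geometric_limit (x : nat -> R) :
  (forall k, `|x k.+1 - x k| <= 2 ^- k / 2) ->
  exists X, forall k, `|x k - X| <= 2 ^- k.
Proof.
move=> hx; pose a k := x k - 2 ^- k; pose b k := x k + 2 ^- k.
have E k : (2 ^- k.+1 : R) = 2 ^- k / 2 by rewrite exprS invfM mulrC.
have P k : 0 < (2 ^- k : R) by rewrite invr_gt0 exprn_gt0.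
have aS k : a k <= a k.+1 by rewrite /a E; have := hx k; rewrite ler_norml => /andP[]; lra.
have bS k : b k.+1 <= b k by rewrite /b E; have := hx k; rewrite ler_norml => /andP[]; lra.
have aM i j : (i <= j)%N -> a i <= a j.
  by move/subnKC => <-; elim: (j - i)%N => [|m IH]; rewrite ?addn0 // addnS (le_trans IH).
have bM i j : (i <= j)%N -> b j <= b i.
  by move/subnKC => <-; elim: (j - i)%N => [|m IH]; rewrite ?addn0 // addnS (le_trans _ IH).
have ab i j : a i <= b j.
  apply: (le_trans (aM _ _ (leq_maxl i j))); apply: (le_trans _ (bM _ _ (leq_maxr i j))).
  by rewrite /a /b; have := P (maxn i j); lra.
have S : has_sup (range a).
  by split; [exists (a 0%N), 0%N|exists (b 0%N) => _ [i _ <-]].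
exists (sup (range a)) => k; rewrite ler_norml.
have h1 : a k <= sup (range a) by apply: sup_upper_bound => //; exists k.
have h2 : sup (range a) <= b k by apply: ge_sup => [|_ [i _ <-]] //; case: S.
by move: h1 h2; rewrite /a /b; lra.
Qed.

Lemma half_pow_ge0 x : (forall k, - (2 * 2 ^- k) <= x) -> 0 <= x.
Proof.
move=> hx; rewrite leNgt; apply/negP => x0.
have [|k hk] := @half_pow_small (- x / 2); first by lra.
have := hx k; move: hk; clear hx; lra.
Qed.

Lemma norm_shift_le x X d P : `|x - X| <= P -> `|d| <= P -> `|x + d - X| <= 2 * P.
Proof.
move=> h1 h2; rewrite addrAC (le_trans (ler_normD _ _)) //.
by rewrite mulr_natl mulr2n lerD.
Qed.

(** Closedness of the simplex in quantitative form: as P runs through 2^-k, [half_pow_ge0] removes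
    the error and places the limit point in the triangle. *)
Lemma near_simplex x y X Y P : 0 <= x -> 0 <= y -> x + y <= 1 ->
  `|x - X| <= P -> `|y - Y| <= P ->
  [/\ - (2 * P) <= X, - (2 * P) <= Y & - (2 * P) <= 1 - (X + Y)].
Proof.
move=> x0 y0 xy; rewrite !ler_norml => /andP[h1 h2] /andP[h3 h4].
by split; lra.
Qed.

Lemma convex_dist x1 x2 X P t : 0 <= t <= 1 ->
  `|x1 - X| <= P -> `|x2 - X| <= P -> `|x1 - X + t * (x2 - x1)| <= P.
Proof.
move=> /andP[t0 t1] h1 h2.
have -> : x1 - X + t * (x2 - x1) = (1 - t) * (x1 - X) + t * (x2 - X) by ring.
apply: (le_trans (ler_normD _ _)); rewrite !normrM (ger0_norm t0) ger0_norm ?subr_ge0 //.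
have -> : P = (1 - t) * P + t * P by ring.
by rewrite lerD // ler_wpM2l // subr_ge0.
Qed.

(** * Goursat's theorem on a triangle, by bisection *)

Section Goursat.
Variables (F : R[i] -> R[i]) (o al be : R[i]).

Definition tri x y : R[i] := o + x%:C * al + y%:C * be.
Definition triangle : set R[i] :=
  [set w | exists x y, [/\ 0 <= x, 0 <= y, x + y <= 1 & w = tri x y]].

Hypothesis hF : forall w, triangle w -> exists l, cderiv triangle F l w.

(** The default value 0 is never met between points of the triangle, by [JP], and [segprim_uniq]
    makes the choice irrelevant. *)
Let J p q : R[i] := xget 0 [set v | segprim F p q v].

Let inside (x y : R) := [/\ 0 <= x, 0 <= y & x + y <= 1].

Let tri_seg (x y x' y' : R) : inside x y -> inside x' y' ->
  seg (tri x y) (tri x' y') `<=` triangle.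
Proof.
move=> [x0 y0 xy] [x'0 y'0 xy'] _ [t /andP[t0 t1] ->].
exists (x + t * (x' - x)), (y + t * (y' - y)); split; [nra|nra|nra|].
by rewrite /pt /tri !(rmorphD, rmorphM, rmorphB, rmorphN) /=; ring.
Qed.

Let JP (x y x' y' : R) : inside x y -> inside x' y' ->
  segprim F (tri x y) (tri x' y') (J (tri x y) (tri x' y')).
Proof.
move=> i i'; apply: xgetPex; apply: segprim_exists => w /(tri_seg i i') wt.
have [l hl] := hF wt; exists l; apply: cderiv_sub hl; exact: tri_seg.
Qed.

Let JC (x y x' y' : R) : inside x y -> inside x' y' ->
  J (tri x y) (tri x' y') = - J (tri x' y') (tri x y).
Proof.
move=> i i'; apply: segprim_uniq (JP i i') _; apply: segprim_sym; exact: JP.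
Qed.

Let Jmid (x y x' y' : R) : inside x y -> inside x' y' ->
  J (tri x y) (tri x' y') =
  J (tri x y) (tri ((x + x') / 2) ((y + y') / 2)) +
  J (tri ((x + x') / 2) ((y + y') / 2)) (tri x' y').
Proof.
move=> i i'.
have im : inside ((x + x') / 2) ((y + y') / 2).
  by case: i i' => x0 y0 xy [x'0 y'0 xy']; split; lra.
have h : 0 <= (2^-1 : R) <= 1 by lra.
have [v1 [v2 [h1 h2 ->]]] := segprim_split h (JP i i').
have E : pt (tri x y) (tri x' y') 2^-1 = tri ((x + x') / 2) ((y + y') / 2).
  by rewrite /pt /tri !(rmorphD, rmorphM, fmorphV) /=; field.
rewrite E in h1 h2.
by rewrite (segprim_uniq h1 (JP i im)) (segprim_uniq h2 (JP im i')).
Qed.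

(* The triangle with corner (x, y) and legs of signed length sg; among the four halves of
   a triangle, the middle one has the opposite sign. *)
Let bdy (x y sg : R) : R[i] := J (tri x y) (tri (x + sg) y) +
  J (tri (x + sg) y) (tri x (y + sg)) + J (tri x (y + sg)) (tri x y).
Let inT (x y sg : R) := [/\ inside x y, inside (x + sg) y & inside x (y + sg)].

Let inT_mid (x y sg : R) : inT x y sg ->
  [/\ inside (x + sg / 2) y, inside x (y + sg / 2) & inside (x + sg / 2) (y + sg / 2)].
Proof.
move=> [[? ? ?] [? ? ?] [? ? ?]].
have [E1 E2] : x + sg / 2 = (x + (x + sg)) / 2 /\ y + sg / 2 = (y + (y + sg)) / 2.
  by split; field.
by rewrite E1 E2; split; split; lra.
Qed.

(** Each side splits at its midpoint; each of the three inner edges is traversed twice, in opposite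
    directions, and cancels by [JC]. *)
Let bdy_split (x y sg : R) : inT x y sg ->
  bdy x y sg = bdy x y (sg / 2) + bdy (x + sg / 2) y (sg / 2) +
    bdy x (y + sg / 2) (sg / 2) + bdy (x + sg / 2) (y + sg / 2) (- (sg / 2)).
Proof.
move=> iT; have [i1 i2 i3] := inT_mid iT; case: iT => iA iB iC.
rewrite /bdy (Jmid iA iB) (Jmid iB iC) (Jmid iC iA).
have -> : (x + (x + sg)) / 2 = x + sg / 2 by field.
have -> : (y + y) / 2 = y by field.
have -> : (x + sg + x) / 2 = x + sg / 2 by field.
have -> : (y + (y + sg)) / 2 = y + sg / 2 by field.
have -> : (x + x) / 2 = x by field.
have -> : (y + sg + y) / 2 = y + sg / 2 by field.
have -> : x + sg / 2 + sg / 2 = x + sg by field.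
have -> : y + sg / 2 + sg / 2 = y + sg by field.
rewrite !addrK.
rewrite (JC i3 i2) (JC i2 i1) (JC i1 i3); ring.
Qed.

Let bdy_step (t : R * R * R) : exists t' : R * R * R, inT t.1.1 t.1.2 t.2 ->
  [/\ inT t'.1.1 t'.1.2 t'.2, `|t'.2| = `|t.2| / 2,
      `|t'.1.1 - t.1.1| <= `|t.2| / 2, `|t'.1.2 - t.1.2| <= `|t.2| / 2
    & cabs (bdy t.1.1 t.1.2 t.2) <= 4 * cabs (bdy t'.1.1 t'.1.2 t'.2)].
Proof.
case: t => [[x y] sg] /=.
have [iT|nT] := pselect (inT x y sg); last by exists (0, 0, 0).
have H0 : 0 <= `|sg| / 2 by rewrite divr_ge0.
have H1 : `|sg / 2| = `|sg| / 2 by rewrite normrM normfV normr_nat.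
have C (a : R) : (`|a - a| <= `|sg| / 2) by rewrite subrr normr0.
have C' (a : R) : (`|a + sg / 2 - a| <= `|sg| / 2) by rewrite addrC addKr H1.
have [i1 i2 i3] := inT_mid iT; have [iA iB iC] := iT.
pose m := 4^-1 * cabs (bdy x y sg).
have E : cabs (bdy x y sg) = 4 * m by rewrite /m mulVKf.
have [h|h1] := leP m (cabs (bdy x y (sg / 2))).
  by exists (x, y, sg / 2) => _ /=; split => //; rewrite E ler_wpM2l.
have [h|h2] := leP m (cabs (bdy (x + sg / 2) y (sg / 2))).
  exists (x + sg / 2, y, sg / 2) => _ /=; split => //; last by rewrite E ler_wpM2l.
  by split=> //; rewrite -addrA -splitr.
have [h|h3] := leP m (cabs (bdy x (y + sg / 2) (sg / 2))).
  exists (x, y + sg / 2, sg / 2) => _ /=; split => //; last by rewrite E ler_wpM2l.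
  by split=> //; rewrite -(addrA y) -splitr.
have [h|h4] := leP m (cabs (bdy (x + sg / 2) (y + sg / 2) (- (sg / 2)))).
  exists (x + sg / 2, y + sg / 2, - (sg / 2)) => _ /=; split; rewrite ?normrN //.
    by split; rewrite ?addrK.
  by rewrite E ler_wpM2l.
suff : cabs (bdy x y sg) < 4 * m by rewrite -E ltxx.
rewrite (bdy_split iT).
apply: (le_lt_trans (cabsD _ _)).
have -> : 4 * m = (m + m + m) + m by ring.
rewrite ltr_leD // ?ltW //.
apply: (le_lt_trans (cabsD _ _)); rewrite ltr_leD // ?ltW //.
apply: (le_lt_trans (cabsD _ _)); rewrite ltr_leD // ?ltW //.
Qed.

Lemma goursat : bdy 0 0 1 = 0.
Proof.
have [g hg] := choice bdy_step.
pose t k := iter k g (0, 0, 1).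
have it k : inT (t k).1.1 (t k).1.2 (t k).2 /\ `|(t k).2| = 2 ^- k.
  elim: k => [|k [IH1 IH2]] /=.
    by rewrite normr1 expr0 invr1; split=> //; split; split; lra.
  have [h1 h2 _ _ _] := hg _ IH1; split=> //.
  by rewrite h2 IH2 exprS invfM mulrC.
have ft k : cabs (bdy 0 0 1) <= 4 ^+ k * cabs (bdy (t k).1.1 (t k).1.2 (t k).2).
  elim: k => [|k IH]; first by rewrite expr0 mul1r.
  apply: (le_trans IH); have [_ _ _ _ h] := hg _ (it k).1.
  by rewrite exprSr -mulrA ler_wpM2l // exprn_ge0.
have [X hX] : exists X, forall k, `|(t k).1.1 - X| <= 2 ^- k.
  apply: geometric_limit => k; have [_ _ h _ _] := hg _ (it k).1.
  by rewrite (le_trans h) // (it k).2.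
have [Y hY] : exists Y, forall k, `|(t k).1.2 - Y| <= 2 ^- k.
  apply: geometric_limit => k; have [_ _ _ h _] := hg _ (it k).1.
  by rewrite (le_trans h) // (it k).2.
have sT : triangle (tri X Y).
  have B k : [/\ - (2 * 2 ^- k) <= X, - (2 * 2 ^- k) <= Y & - (2 * 2 ^- k) <= 1 - (X + Y)].
    have [[[h1 h2 h3] _ _] _] := it k; exact: near_simplex h1 h2 h3 (hX k) (hY k).
  have X0 : 0 <= X by apply: half_pow_ge0 => k; case: (B k).
  have Y0 : 0 <= Y by apply: half_pow_ge0 => k; case: (B k).
  have XY : X + Y <= 1 by rewrite -subr_ge0; apply: half_pow_ge0 => k; case: (B k).
  by exists X, Y; split.
have [l hl] := hF sT.
pose D := cabs al + cabs be.
have D0 : 0 <= D by rewrite addr_ge0 ?cabs_ge0.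
(* With P = 2^-k, one side of the k-th triangle deviates from the integral of the linear
   approximation by at most 2 (2 e P D) (P D). Three sides give 12 e P^2 D^2, and 4^k P^2 = 1 makes
   the bound independent of k. *)
have main e : 0 < e -> cabs (bdy 0 0 1) <= 12 * e * D ^+ 2.
  move=> e0; have [d d0 H] := hl e e0.
  have [k hk] := @half_pow_small (d / (2 * (D + 1))) ltac:(rewrite divr_gt0 // mulr_gt0 //; lra).
  apply: (le_trans (ft k)).
  have [iT sk] := it k; have hXk := hX k; have hYk := hY k.
  set P := 2 ^- k in sk hXk hYk hk.
  have P0 : 0 < P by rewrite invr_gt0 exprn_gt0.
  have P4 : 4 ^+ k * P ^+ 2 = 1.
    have -> : (4 : R) = 2 ^+ 2 by rewrite -natrX.
    by rewrite -exprM mulnC exprM /P exprVn divff // !expf_neq0.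
  have {}hk : 2 * P * D < d.
    move: hk; rewrite ltr_pdivlMr; last by lra.
    move=> hk; apply: le_lt_trans hk; rewrite [2 * P]mulrC -mulrA.
    by rewrite (ler_wpM2l (ltW P0)) // ler_wpM2l // lerDl.
  case: (t k) iT sk hXk hYk => [[x y] sg] /= [iA iB iC] sk hXk hYk.
  have near_ (x1 y1 x2 y2 t' : R) : 0 <= t' <= 1 ->
     `|x1 - X| <= 2 * P -> `|x2 - X| <= 2 * P -> `|y1 - Y| <= 2 * P -> `|y2 - Y| <= 2 * P ->
     cabs (pt (tri x1 y1) (tri x2 y2) t' - tri X Y) <= 2 * P * D.
    move=> t01 hx1 hx2 hy1 hy2.
    have -> : pt (tri x1 y1) (tri x2 y2) t' - tri X Y =
      (x1 - X + t' * (x2 - x1))%:C * al + (y1 - Y + t' * (y2 - y1))%:C * be.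
      by rewrite /pt /tri !(rmorphD, rmorphM, rmorphB, rmorphN) /=; ring.
    apply: (le_trans (cabsD _ _)); rewrite !cabsM !cabsR /D [leRHS]mulrDr.
    by rewrite lerD // ler_wpM2r ?cabs_ge0 // convex_dist.
  pose h w := F (tri X Y) * w + l / 2 * (w - tri X Y) ^+ 2.
  have edge (x1 y1 x2 y2 : R) : inside x1 y1 -> inside x2 y2 ->
     `|x1 - X| <= 2 * P -> `|x2 - X| <= 2 * P -> `|y1 - Y| <= 2 * P -> `|y2 - Y| <= 2 * P ->
     `|x2 - x1| <= P -> `|y2 - y1| <= P ->
     cabs (J (tri x1 y1) (tri x2 y2) - (h (tri x2 y2) - h (tri x1 y1))) <= 4 * e * P ^+ 2 * D ^+ 2.
    move=> i1 i2 hx1 hx2 hy1 hy2 hx hy.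
    have := @segprim_bound F (tri x1 y1) (tri x2 y2) _ (tri X Y) (F (tri X Y)) l (e * (2 * P * D)) h erefl _ (JP i1 i2).
    move=> hb; apply: (le_trans (hb _)).
      move=> _ [t' t'01 ->]; have nr := near_ _ _ _ _ _ t'01 hx1 hx2 hy1 hy2.
      apply: (le_trans (H _ _ _)).
      - by apply: (tri_seg i1 i2); apply: seg_pt.
      - exact: le_lt_trans nr hk.
      - by rewrite ler_wpM2l // ltW.
    have -> : 4 * e * P ^+ 2 * D ^+ 2 = 2 * (e * (2 * P * D)) * (P * D) by ring.
    apply: ler_wpM2l; first by rewrite !mulr_ge0 // ltW.
    have -> : tri x2 y2 - tri x1 y1 = (x2 - x1)%:C * al + (y2 - y1)%:C * be.
      by rewrite /tri !(rmorphD, rmorphB) /=; ring.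
    apply: (le_trans (cabsD _ _)); rewrite !cabsM !cabsR /D [leRHS]mulrDr.
    by rewrite lerD // ler_wpM2r ?cabs_ge0.
  have sg1 : `|sg| <= P by rewrite sk.
  have w (a b : R) : `|a - b| <= P -> `|a - b| <= 2 * P.
    by move=> h1; rewrite -(addr0 a) norm_shift_le // normr0 ltW.
  have m0 (a : R) : `|a - a| <= P by rewrite subrr normr0 ltW.
  have mD (a : R) : `|a + sg - a| <= P by rewrite [a + sg]addrC addrK.
  have mN (a : R) : `|a - (a + sg)| <= P by rewrite distrC.
  have dD (a b : R) : `|a - b| <= P -> `|a + sg - b| <= 2 * P.
    by move=> h1; apply: norm_shift_le.
  have wX := w _ _ hXk; have wY := w _ _ hYk; have dX := dD _ _ hXk; have dY := dD _ _ hYk.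
  have e1 := edge _ _ _ _ iA iB wX dX wY wY (mD x) (m0 y).
  have e2 := edge _ _ _ _ iB iC dX wX wY dY (mN x) (mD y).
  have e3 := edge _ _ _ _ iC iA wX wX dY wY (m0 x) (mN y).
  (* The terms in [h] telescope around the closed boundary. *)
  have -> : bdy x y sg = (J (tri x y) (tri (x + sg) y) - (h (tri (x + sg) y) - h (tri x y)))
    + (J (tri (x + sg) y) (tri x (y + sg)) - (h (tri x (y + sg)) - h (tri (x + sg) y)))
    + (J (tri x (y + sg)) (tri x y) - (h (tri x y) - h (tri x (y + sg)))).
    by rewrite /bdy; ring.
  have -> : 12 * e * D ^+ 2 = 4 ^+ k * ((4 * e * P ^+ 2 * D ^+ 2) + (4 * e * P ^+ 2 * D ^+ 2)
      + (4 * e * P ^+ 2 * D ^+ 2)).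
    have K (Q : R) : Q * P ^+ 2 = 1 -> 12 * e * D ^+ 2 = Q * ((4 * e * P ^+ 2 * D ^+ 2) +
      (4 * e * P ^+ 2 * D ^+ 2) + (4 * e * P ^+ 2 * D ^+ 2)).
      move=> hQ; transitivity ((Q * P ^+ 2) * (12 * e * D ^+ 2)); first by rewrite hQ mul1r.
      by clearbody P; ring.
    exact: K.
  apply: ler_wpM2l; first by rewrite exprn_ge0.
  apply: (le_trans (cabsD _ _)); apply: lerD => //.
  by apply: (le_trans (cabsD _ _)); apply: lerD.
apply/eqP; rewrite -cabs_eq0 eq_le cabs_ge0 andbT; apply/ler_addgt0Pr => e e0.
rewrite add0r; have D2 : 0 < 12 * (D ^+ 2 + 1) by rewrite mulr_gt0 // ltr_wpDl // sqr_ge0.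
apply: (le_trans (main _ (divr_gt0 e0 D2))).
have -> : 12 * (e / (12 * (D ^+ 2 + 1))) * D ^+ 2 = e * (12 * D ^+ 2) / (12 * (D ^+ 2 + 1)) by ring.
by rewrite ler_pdivrMr // (ler_wpM2l (ltW e0)) // ler_wpM2l // lerDl.
Qed.

(** Cauchy's theorem in the form in which a time step uses it: [L1] and [L2] serve the two complex
    flows, [L3] the exact solution on the real side. *)
Lemma triangle_primitives : exists L1 L2 L3 : R[i] -> R[i],
  [/\ forall w, seg o (o + al) w -> cderiv (seg o (o + al)) L1 (F w) w,
      forall w, seg (o + al) (o + be) w -> cderiv (seg (o + al) (o + be)) L2 (F w) w,
      forall w, seg o (o + be) w -> cderiv (seg o (o + be)) L3 (F w) w
    & L1 (o + al) - L1 o + (L2 (o + be) - L2 (o + al)) = L3 (o + be) - L3 o].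
Proof.
have t0 : tri 0 0 = o by rewrite /tri !mul0r !addr0.
have t1 : tri (0 + 1) 0 = o + al by rewrite /tri add0r mul0r addr0 mul1r.
have t2 : tri 0 (0 + 1) = o + be by rewrite /tri add0r mul0r addr0 mul1r.
have i0 : inside 0 0 by split; lra.
have i1 : inside (0 + 1) 0 by split; lra.
have i2 : inside 0 (0 + 1) by split; lra.
have := goursat; rewrite /bdy.
rewrite (JC i2 i0); have := JP i0 i1; have := JP i1 i2; have := JP i0 i2.
rewrite t0 t1 t2 => -[L3 h3 ->] [L2 h2 ->] [L1 h1 ->] /eqP; rewrite subr_eq0 => /eqP E.
by exists L1, L2, L3.
Qed.
End Goursat.

(** The hypothesis allows arbitrary tags, so the tags can be taken from the mean value theorem on
    each subinterval; the real part of the Riemann sum then telescopes exactly. A second choice of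
    tags settles the imaginary part. *)
Lemma riemann_tags F L p q I :
  (forall w, seg p q w -> cderiv (seg p q) L (F w) w) ->
  (forall e, 0 < e -> exists2 dl : R, 0 < dl &
     forall (N : nat) (s xi : nat -> R), s 0%N = 0 -> s N = 1 ->
      (forall k, (k < N)%N -> s k <= xi k <= s k.+1 /\ s k.+1 - s k < dl) ->
      cabs (\sum_(k < N) ((q - p) * (s k.+1 - s k)%:C * F (pt p q (xi k))) - I) <= e) ->
  I = L q - L p.
Proof.
move=> hL hI.
have main e : 0 < e -> `|complex.Re (L q - L p - I)| <= e /\ `|complex.Im (L q - L p - I)| <= e.
  move=> e0; have [dl dl0 H] := hI e e0.
  pose N := (Num.bound dl^-1).+1; pose s (k : nat) : R := k%:R / N%:R.
  have N0 : 0 < (N%:R : R) by rewrite ltr0n.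
  have Nd : (N%:R)^-1 < dl.
    rewrite invf_plt ?posrE //; apply: (lt_trans (archi_boundP _)).
      by rewrite invr_ge0 ltW.
    by rewrite ltr_nat.
  have sS k : s k.+1 - s k = N%:R^-1 by rewrite /s -natr1; field; rewrite pnatr_eq0.
  have s0 : s 0%N = 0 by rewrite /s mul0r.
  have sN : s N = 1 by rewrite /s divff // gt_eqF.
  have s01 k : (k <= N)%N -> 0 <= s k <= 1.
    by move=> kN; rewrite divr_ge0 //= ler_pdivrMr // mul1r ler_nat.
  have ptpt k xi : pt (pt p q (s k)) (pt p q (s k.+1)) xi = pt p q (s k + xi / N%:R).
    by rewrite {1}/pt ptB sS /pt !(rmorphD, rmorphM, rmorphB) /=; ring.
  have dk k : (k < N)%N -> forall x, 0 <= x <= 1 ->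
      cderiv (seg (pt p q (s k)) (pt p q (s k.+1))) L (F (pt (pt p q (s k)) (pt p q (s k.+1)) x))
       (pt (pt p q (s k)) (pt p q (s k.+1)) x).
    move=> kN x x01.
    have S := @seg_sub p q _ _ (s01 _ (ltnW kN)) (s01 _ kN).
    by apply: (cderiv_sub S); apply: hL; apply: S; apply: seg_pt.
  have tele : L q - L p = \sum_(k < N) (L (pt p q (s k.+1)) - L (pt p q (s k))).
    rewrite -(big_mkord xpredT (fun k => L (pt p q (s k.+1)) - L (pt p q (s k)))).
    by rewrite telescope_sumr // sN s0 pt0 pt1.
  have Re_sum (f : 'I_N -> R[i]) : complex.Re (\sum_k f k) = \sum_k complex.Re (f k).
    by elim/big_rec2 : _ => // i a b _ <-; rewrite ReD.
  have Im_sum (f : 'I_N -> R[i]) : complex.Im (\sum_k f k) = \sum_k complex.Im (f k).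
    by elim/big_rec2 : _ => // i a b _ <-; rewrite ImD.
  have tag x k : 0 < x < 1 -> s k <= s k + x / N%:R <= s k.+1 /\ s k.+1 - s k < dl.
    move=> /andP[x0 x1]; rewrite sS; split => //.
    apply/andP; split; first by rewrite lerDl divr_ge0 ?ltW.
    have -> : s k.+1 = s k + N%:R^-1 by rewrite -(sS k) addrC subrK.
    by rewrite lerD2l ler_pdivrMr // mulVf ?gt_eqF // ltW.
  split.
    have P k : exists x, (k < N)%N -> 0 < x < 1 /\
       complex.Re (L (pt p q (s k.+1)) - L (pt p q (s k))) =
       complex.Re ((q - p) * (s k.+1 - s k)%:C * F (pt p q (s k + x / N%:R))).
      have [kN|] := boolP (k < N)%N; last by exists 0.
      have [x x01|x /andP[x0 x1]|x x01 E] := @segMVT _ L F (pt p q (s k)) (pt p q (s k.+1)).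
      - by eexists; exact: dk.
      - by apply: dk => //; rewrite !ltW.
      by exists x => _; split=> //; rewrite E ptpt ptB (mulrC (q - p)).
    have [x hx] := choice P.
    have := H N s (fun k => s k + x k / N%:R) s0 sN.
    have -> : complex.Re (L q - L p - I) = complex.Re (\sum_(k < N)
        (q - p) * (s k.+1 - s k)%:C * F (pt p q (s k + x k / N%:R)) - I).
      rewrite tele !(ReD _ (- I)) !Re_sum; congr (_ + _); apply: eq_bigr => k _.
      by have [_ ->] := hx k (ltn_ord k).
    move=> h; apply: (le_trans (cabs_Re _)); apply: h => k kN.
    by apply: tag; have [] := hx k kN.
  have P k : exists x, (k < N)%N -> 0 < x < 1 /\
     complex.Im (L (pt p q (s k.+1)) - L (pt p q (s k))) =
     complex.Im ((q - p) * (s k.+1 - s k)%:C * F (pt p q (s k + x / N%:R))).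
    have [kN|] := boolP (k < N)%N; last by exists 0.
    have [x x01|x /andP[x0 x1]|x x01 E] := @segMVT_Im _ L F (pt p q (s k)) (pt p q (s k.+1)).
    - by eexists; exact: dk.
    - by apply: dk => //; rewrite !ltW.
    by exists x => _; split=> //; rewrite E ptpt ptB (mulrC (q - p)).
  have [x hx] := choice P.
  have := H N s (fun k => s k + x k / N%:R) s0 sN.
  have -> : complex.Im (L q - L p - I) = complex.Im (\sum_(k < N)
      (q - p) * (s k.+1 - s k)%:C * F (pt p q (s k + x k / N%:R)) - I).
    rewrite tele !(ImD _ (- I)) !Im_sum; congr (_ + _); apply: eq_bigr => k _.
    by have [_ ->] := hx k (ltn_ord k).
  move=> h; apply: (le_trans (cabs_Im _)); apply: h => k kN.
  by apply: tag; have [] := hx k kN.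
apply/esym/eqP; rewrite -subr_eq0 -cabs_eq0 eq_le cabs_ge0 andbT; apply/ler_addgt0Pr => e e0.
have [h1 h2] := main _ (divr_gt0 e0 (ltr0Sn _ 1)).
by rewrite add0r (le_trans (cabs_le _)) // [e]splitr lerD.
Qed.
End Primitives.

(** * The complex exponential *)

Section ComplexExponential.
Context {R : realType}.
Implicit Types (x y e : R) (z w p q s l k : R[i]) (F : R[i] -> R[i]) (A : set R[i]).

Definition cexp z : R[i] :=
  (expR (complex.Re z))%:C * (cos (complex.Im z) +i* sin (complex.Im z)).

Lemma cexp0 : cexp 0 = 1.
Proof. by rewrite /cexp /= expR0 cos0 sin0 mul1r. Qed.

Lemma cexpD z w : cexp (z + w) = cexp z * cexp w.
Proof.
apply/eqP; rewrite eq_complex; apply/andP; split; apply/eqP;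
  rewrite /cexp !ReImE /= expRD ?cosD ?sinD; ring.
Qed.

Lemma cexpR x : cexp x%:C = (expR x)%:C.
Proof. by rewrite /cexp /= cos0 sin0 mulr1. Qed.

Lemma cabs_cexp z : cabs (cexp z) = expR (complex.Re z).
Proof.
rewrite cabsM cabsR ger0_norm ?expR_ge0 // /cabs /= cos2Dsin2.
by rewrite sqrtr1 mulr1.
Qed.

Lemma cexp_neq0 z : cexp z != 0.
Proof. by rewrite -cabs_gt0 cabs_cexp expR_gt0. Qed.

Lemma cexpN z : cexp (- z) = (cexp z)^-1.
Proof.
by apply: (mulfI (cexp_neq0 z)); rewrite -cexpD subrr cexp0 divff // cexp_neq0.
Qed.

Lemma cderiv_cexp0 A : cderiv A cexp 1 0.
Proof.
move=> e e0; have e4 : 0 < e / 4 by rewrite divr_gt0.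
have [d1 d10 H1] := is_derive_epsP (is_derive_expR (0 : R)) e4.
have [d2 d20 H2] := is_derive_epsP (is_derive_cos (0 : R)) e4.
have [d3 d30 H3] := is_derive_epsP (is_derive_sin (0 : R)) e4.
have d40 : 0 < e / 4 / (e / 2 + 1) by rewrite divr_gt0 // addr_gt0 // divr_gt0.
exists (Num.min (Num.min d1 d2) (Num.min d3 (e / 4 / (e / 2 + 1)))).
  by rewrite !lt_min d10 d20 d30 d40.
move=> w _; rewrite !subr0 mul1r cexp0 !lt_min => /andP[/andP[w1 w2] /andP[w3 w5]].
set x := complex.Re w; set y := complex.Im w.
have hx : `|x| <= cabs w := cabs_Re w; have hy : `|y| <= cabs w := cabs_Im w.
have := H1 x (le_lt_trans hx w1); have := H2 y (le_lt_trans hy w2); have := H3 y (le_lt_trans hy w3).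
rewrite !add0r expR0 cos0 sin0 oppr0 mul0r !subr0 !mul1r addr0 => K3 K2 K1.
pose E := expR x - 1 - x.
pose T := cos y +i* sin y : R[i].
have T1 : cabs T = 1 by rewrite /cabs /= cos2Dsin2 sqrtr1.
have K4 : cabs (T - 1 - 'i%C * y%:C) <= e / 2 * cabs w.
  have -> : T - 1 - 'i%C * y%:C = (cos y - 1) +i* (sin y - y).
    by apply/eqP; rewrite eq_complex !ReImE /=; apply/andP; split; apply/eqP; ring.
  apply: (le_trans (cabs_le _)) => /=.
  have -> : e / 2 * cabs w = e / 4 * cabs w + e / 4 * cabs w by field.
  rewrite lerD //; [apply: (le_trans K2)|apply: (le_trans K3)]; by rewrite (ler_wpM2l (ltW e4)).
(* The errors of the real exponential, of the product of the two factors, and of the rotation are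
   separated; they receive e / 4, e / 4 and e / 2. *)
have -> : cexp w - 1 - w = E%:C * T + x%:C * (T - 1) + (T - 1 - 'i%C * y%:C).
  apply/eqP; rewrite eq_complex /cexp /E !ReImE /=; apply/andP; split; apply/eqP;
    rewrite -/x -/y; ring.
have K5 : cabs (T - 1) <= (e / 2 + 1) * cabs w.
  have -> : T - 1 = (T - 1 - 'i%C * y%:C) + 'i%C * y%:C by ring.
  apply: (le_trans (cabsD _ _)); rewrite mulrDl mul1r lerD // cabsM cabsR.
  by rewrite /cabs /= expr0n expr1n add0r sqrtr1 mul1r.
have -> : e * cabs w = e / 4 * cabs w + e / 4 * cabs w + e / 2 * cabs w by field.
apply: (le_trans (cabsD _ _)); apply: lerD => //; apply: (le_trans (cabsD _ _)); apply: lerD.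
  by rewrite cabsM T1 mulr1 cabsR (le_trans K1) // (ler_wpM2l (ltW e4)).
rewrite cabsM cabsR mulrC; apply: (@le_trans _ _ ((e / 2 + 1) * cabs w * cabs w)).
  by rewrite ler_pM ?cabs_ge0.
rewrite ler_wpM2r ?cabs_ge0 // mulrC -ler_pdivlMr ?ltW //.
by rewrite addr_gt0 // divr_gt0.
Qed.

(** The addition theorem transports the derivative at 0 to every point. *)
Lemma cderiv_cexpZ A k s : cderiv A (fun w => cexp (k * w)) (k * cexp (k * s)) s.
Proof.
move=> e e0.
pose K := (cabs k + 1) * cabs (cexp (k * s)).
have k1 : 0 < cabs k + 1 by rewrite ltr_wpDl ?cabs_ge0.
have K0 : 0 < K by rewrite mulr_gt0 ?cabs_gt0 ?cexp_neq0.
have [d d0 H] := @cderiv_cexp0 setT _ (divr_gt0 e0 K0).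
exists (d / (cabs k + 1)); first exact: divr_gt0.
move=> w _ wd.
have -> : cexp (k * w) - cexp (k * s) - k * cexp (k * s) * (w - s) =
  cexp (k * s) * (cexp (k * (w - s)) - cexp 0 - 1 * (k * (w - s) - 0)).
  have {1}-> : k * w = k * s + k * (w - s) by ring.
  by rewrite cexpD cexp0; ring.
have kw : cabs (k * (w - s)) <= (cabs k + 1) * cabs (w - s).
  by rewrite cabsM ler_wpM2r ?cabs_ge0 // lerDl.
rewrite cabsM.
have := H (k * (w - s)) I; rewrite subr0 => /(_ _) H'.
apply: (@le_trans _ _ (cabs (cexp (k * s)) * (e / K * ((cabs k + 1) * cabs (w - s))))).
  rewrite ler_wpM2l ?cabs_ge0 //; apply: (le_trans (H' _)).
    by apply: (le_lt_trans kw); rewrite mulrC -ltr_pdivlMr.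
  by rewrite ler_wpM2l // divr_ge0 ?ltW.
rewrite /K le_eqVlt; apply/orP; left; apply/eqP; field.
by rewrite cabs_eq0 cexp_neq0 gt_eqF.
Qed.

Lemma cderivXn A n s : cderiv A (fun w => w ^+ n) (n%:R * s ^+ n.-1) s.
Proof.
elim: n => [|n IH]; first by rewrite mul0r; apply: cderiv_cst.
have -> : (fun w => w ^+ n.+1) = (fun w => w * w ^+ n) by apply/funext => w; rewrite exprS.
have := cderivM (@cderiv_id _ A s) IH; congr (cderiv _ _ _ _).
rewrite mul1r /= -natr1; case: n {IH} => [|n] /=; first by rewrite mul0r; ring.
by rewrite exprS; ring.
Qed.

(** e^(k w) minus its Taylor polynomial of degree m - 1 at 0. Indexed this way, each remainder has k
    times the preceding one as its derivative. *)
Fixpoint cexp_rem k (m : nat) w : R[i] :=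
  if m is m'.+1 then cexp_rem k m' w - (k * w) ^+ m' / m'`!%:R else cexp (k * w).

Lemma cderiv_cexp_rem A k m s : cderiv A (cexp_rem k m.+1) (k * cexp_rem k m s) s.
Proof.
elim: m s => [|m IH] s /=.
  have -> : (fun w => cexp (k * w) - (k * w) ^+ 0 / 0`!%:R) = (fun w => cexp (k * w) - 1).
    by apply/funext => w; rewrite expr0 fact0 divr1.
  by rewrite -[k * _]subr0; apply: cderivB; [exact: cderiv_cexpZ|exact: cderiv_cst].
have h := cderivZ (k ^+ m.+1 / m.+1`!%:R) (@cderivXn A m.+1 s).
have := cderivB (IH s) h; congr (cderiv _ _ _ _).
  by apply/funext => w /=; rewrite [(k * w) ^+ m.+1]exprMn; ring.
rewrite /= factS natrM exprMn exprS mulrBr.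
have f0 : (m`!%:R : R[i]) != 0 by rewrite pnatr_eq0 -lt0n fact_gt0.
have m0 : (m.+1%:R : R[i]) != 0 by rewrite pnatr_eq0.
congr (_ - _); move: (m.+1%:R) (m`!%:R) f0 m0 => a b b0 a0.
by field; rewrite a0 b0.
Qed.

Lemma cexp_rem0 k m : cexp_rem k m.+1 0 = 0.
Proof.
elim: m => [|m IH]; first by rewrite /= mulr0 cexp0 expr0 fact0 divr1 subrr.
by rewrite -[LHS]/(cexp_rem k m.+1 0 - _) IH mulr0 expr0n mul0r subr0.
Qed.

(** Induction on m: the remainder vanishes at 0 and its derivative is bounded by the preceding step.
    Each step contributes the factor 2 of [seg_mean_bound]; the sign conditions give |e^(k x)| <= 1
    to start with. *)
Lemma cexp_taylor k m x : 0 <= complex.Re k -> x <= 0 ->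
  cabs (cexp_rem k m x%:C) <= (2 * cabs k * `|x|) ^+ m.
Proof.
move=> k0; elim: m x => [|m IH] x x0.
  have E : complex.Re (k * x%:C) = complex.Re k * x by case: (k) => a b /=; rewrite mulr0 subr0.
  by rewrite expr0 -[cexp_rem k 0 _]/(cexp (k * x%:C)) cabs_cexp E -expR0 ler_expR mulr_ge0_le0.
have D t : cderiv (seg 0 x%:C) (cexp_rem k m.+1) (k * cexp_rem k m t) t by apply: cderiv_cexp_rem.
have := @seg_mean_bound _ (cexp_rem k m.+1) (fun w => k * cexp_rem k m w) 0 x%:C
  (cabs k * (2 * cabs k * `|x|) ^+ m).
rewrite cexp_rem0 !subr0 cabsR => H.
apply: (le_trans (H _ _ _)).
- by move=> t _; eexists; apply: D.
- by move=> t _; apply: D.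
- move=> t /andP[t0 t1]; rewrite cabsM ler_wpM2l ?cabs_ge0 //.
  have -> : pt 0 x%:C t = (t * x)%:C by rewrite /pt subr0 add0r rmorphM.
  apply: (le_trans (IH _ _)); first by rewrite mulr_ge0_le0 // ltW.
  rewrite lerXn2r ?nnegrE ?mulr_ge0 ?cabs_ge0 //.
  by rewrite ler_wpM2l ?mulr_ge0 ?cabs_ge0 // normrM (gtr0_norm t0) ler_piMl // ltW.
by rewrite exprS le_eqVlt; apply/orP; left; apply/eqP; ring.
Qed.
End ComplexExponential.

(** * The local error *)

Section QuadratureDefect.
Context {R : realType}.
Implicit Types (x : R).

(** Nodes 1, [2 * step_abar] and 0 with weights [step_a], 1/2 and [step_abar], for the integral of
    e^(s x) over 0 <= s <= 1. At x = 0 the quotient takes the value 0 instead of the limit 1; the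
    estimates concern x < 0. *)
Definition quad_defect x : R[i] :=
  step_a R * (expR x)%:C + 2^-1 * cexp (2 * step_abar R * x%:C) + step_abar R
  - ((expR x - 1) / x)%:C.

Lemma step_aE : step_a R = 4^-1 +i* - (4^-1 / Num.sqrt 3).
Proof.
rewrite /step_a -(_ : (4^-1)%:C = 4%:R^-1); last by rewrite fmorphV rmorph_nat.
by apply/eqP; rewrite eq_complex !ReImE /=; apply/andP; split; apply/eqP; ring.
Qed.

Lemma step_abarE : step_abar R = 4^-1 +i* (4^-1 / Num.sqrt 3).
Proof.
rewrite /step_abar -(_ : (4^-1)%:C = 4%:R^-1); last by rewrite fmorphV rmorph_nat.
by apply/eqP; rewrite eq_complex !ReImE /=; apply/andP; split; apply/eqP; ring.
Qed.

Lemma inv_sqrt3_sqr : (Num.sqrt 3)^-1 ^+ 2 = 3^-1 :> R.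
Proof. by rewrite exprVn sqr_sqrtr. Qed.

Lemma cabs_step_abar : cabs (step_abar R) <= 2^-1.
Proof.
rewrite -(@ler_pXn2r _ 2) ?nnegrE ?cabs_ge0 ?invr_ge0 // cabs_sqr step_abarE /=.
rewrite exprMn inv_sqrt3_sqr; lra.
Qed.

Lemma cabs_step_a : cabs (step_a R) <= 2^-1.
Proof.
rewrite -(@ler_pXn2r _ 2) ?nnegrE ?cabs_ge0 ?invr_ge0 // cabs_sqr step_aE /=.
rewrite sqrrN exprMn inv_sqrt3_sqr; lra.
Qed.

(** Two moment conditions in one: the weights sum to 1, and the weighted mean of the nodes is 1/2.
    It also says that the two complex substeps add up to tau. *)
Lemma step_sum : step_a R + step_abar R = 2^-1.
Proof.
rewrite step_aE step_abarE -(_ : (2^-1)%:C = 2^-1); last by rewrite fmorphV rmorph_nat.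
by apply/eqP; rewrite eq_complex !ReImE /=; apply/andP; split; apply/eqP; field.
Qed.

(** The second moment condition: the integral of s^2 over [0, 1] is 1/3, and the middle node
    contributes (2 abar)^2 / 2. *)
Lemma step_order3 : step_a R + 2 * step_abar R ^+ 2 = 3^-1.
Proof.
rewrite step_aE step_abarE -(_ : (3^-1)%:C = 3^-1); last by rewrite fmorphV rmorph_nat.
rewrite expr2 mulr_natl mulr2n; apply/eqP; rewrite eq_complex !ReImE /=; apply/andP; split; apply/eqP; last first.
  by field; rewrite sqrtr_eq0 -ltNge.
have -> : 4^-1 / Num.sqrt 3 * (4^-1 / Num.sqrt 3) = 4^-1 ^+ 2 * ((Num.sqrt 3)^-1 ^+ 2) :> R by ring.
by rewrite inv_sqrt3_sqr; field.
Qed.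

(** The moments of order 0, 1 and 2 are matched, so the subtracted Taylor polynomials cancel. The
    last remainder needs one order more because it is divided by x. *)
Lemma quad_defect_taylor x : x != 0 ->
  quad_defect x = step_a R * cexp_rem 1 3 x%:C + 2^-1 * cexp_rem (2 * step_abar R) 3 x%:C
                  - cexp_rem 1 4 x%:C * (x^-1)%:C.
Proof.
move=> x0; rewrite /quad_defect /= !mul1r cexpR.
have xC : x%:C != 0 :> R[i] by rewrite eq_complex /= negb_and x0.
have -> : ((expR x - 1) / x)%:C = ((expR x)%:C - 1) / x%:C :> R[i].
  by rewrite rmorphM rmorphB fmorphV rmorph1.
have -> : (x^-1)%:C = (x%:C)^-1 :> R[i] by rewrite fmorphV.
move: (x%:C) xC (cexp _) (expR x)%:C => X X0 E2 E1.
have ha : step_a R = 2^-1 - step_abar R by rewrite -step_sum addrK.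
have := step_order3; rewrite ha => h3.
rewrite !expr1 fact0 -[1`!]/1%N -[2`!]/2%N -[3`!]/6%N.
apply/eqP; rewrite -subr_eq0; apply/eqP.
transitivity (X ^+ 2 / 2 * ((2^-1 - step_abar R + 2 * step_abar R ^+ 2) - 3^-1)).
  by field.
by rewrite h3 subrr mulr0.
Qed.

(** From e^(-x) >= 1 - x. The lower bound is at least 1/2 for x <= -1 and at least -x / 2 for -1 <=
    x < 0, which are the two regimes of the next estimate. *)
Lemma one_sub_expR_ge x : x < 0 -> - x / (1 - x) <= 1 - expR x.
Proof.
move=> x0; have p : 0 < 1 - x by lra.
have h : expR x <= (1 - x)^-1.
  rewrite -[x in expR x]opprK expRN lef_pV2 ?posrE ?expR_gt0 //.
  exact: expR_ge1Dx.
have -> : - x / (1 - x) = 1 - (1 - x)^-1 by field; lra.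
by rewrite lerD2l lerN2.
Qed.

Lemma cabs_half : cabs (2^-1 : R[i]) = 2^-1.
Proof. by rewrite cabsV -[2]/(2%:R) -(rmorph_nat (real_complex R)) cabsR normr_nat. Qed.

Lemma quad_defect_bound x : x < 0 -> cabs (quad_defect x) <= 56 * x ^+ 2 * (1 - expR x).
Proof.
move=> x0; have h := one_sub_expR_ge x0.
have a1 := cabs_step_a; have a2 := cabs_step_abar.
have E0 := expR_gt0 x.
(* Away from 0 cancellation is irrelevant: the four terms are at most 1/2, 1/2, 1/2 and 1, while the
   right-hand side is at least 56 / 2. *)
have [x1|x1] := leP x (-1).
  have h2 : 2^-1 <= 1 - expR x.
    apply: (le_trans _ h); rewrite ler_pdivlMr; lra.
  apply: (@le_trans _ _ (2^-1 + 2^-1 + 2^-1 + 1)); last by nra.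
  apply: (le_trans (cabsB _ _)); apply: lerD; last first.
    rewrite cabsR normrM normfV (ltr0_norm x0) ler_pdivrMr ?oppr_gt0 //.
    rewrite ltr0_norm; lra.
  apply: (le_trans (cabsD _ _)); apply: lerD => //.
  apply: (le_trans (cabsD _ _)); apply: lerD; rewrite cabsM.
    rewrite cabsR ger0_norm ?ltW //; have := cabs_ge0 (step_a R); nra.
  rewrite cabs_cexp cabs_half.
  rewrite ler_piMr ?invr_ge0 // -[leRHS]expR0 ler_expR step_abarE -(rmorph_nat (real_complex R)).
  by rewrite /= !(mul0r, mulr0, subr0, addr0); lra.
have h2 : - x / 2 <= 1 - expR x.
  apply: (le_trans _ h); rewrite ler_wpM2l ?lef_pV2 ?posrE; lra.
(* Origin of 56: the Taylor remainders contribute 8, 4 and 16 times |x|^3, in all 28 |x|^3 = 56 x^2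
   (|x| / 2), and |x| / 2 <= 1 - e^x in this range. *)
apply: (@le_trans _ _ (28 * (- x) ^+ 3)); last first.
  have -> : 28 * (- x) ^+ 3 = 56 * x ^+ 2 * (- x / 2) by field.
  by rewrite ler_wpM2l // mulr_ge0 ?sqr_ge0.
rewrite quad_defect_taylor ?lt_eqF //.
have b1 : cabs (2 * step_abar R) <= 1.
  rewrite cabsM -[2]/(2%:R) -(rmorph_nat (real_complex R)) cabsR normr_nat; lra.
have R2 : 0 <= complex.Re (2 * step_abar R).
  by rewrite step_abarE -(rmorph_nat (real_complex R)) /= mul0r subr0.
have cabs1 : cabs (1 : R[i]) = 1 by rewrite -[1]/(1%:C) cabsR normr1.
have T1 := @cexp_taylor R 1 3 x ler01 (ltW x0).
have T3 := @cexp_taylor R 1 4 x ler01 (ltW x0).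
have T2 := @cexp_taylor R _ 3 x R2 (ltW x0).
have T2' : cabs (cexp_rem (2 * step_abar R) 3 x%:C) <= (2 * (- x)) ^+ 3.
  have nx : 0 <= - x by rewrite oppr_ge0 ltW.
  apply: (le_trans T2); rewrite (ltr0_norm x0) lerXn2r ?nnegrE ?mulr_ge0 ?cabs_ge0 //.
  by rewrite -mulrA ler_wpM2l // ler_piMl.
rewrite cabs1 mulr1 (ltr0_norm x0) in T1 T3.
have -> : 28 * (- x) ^+ 3 = 8 * (- x) ^+ 3 + 4 * (- x) ^+ 3 + 16 * (- x) ^+ 3 by ring.
apply: (le_trans (cabsB _ _)); apply: lerD.
  apply: (le_trans (cabsD _ _)); apply: lerD; rewrite cabsM.
    rewrite -[leRHS]mul1r ler_pM ?cabs_ge0 //; first by lra.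
    by apply: (le_trans T1); rewrite exprMn -natrX.
  rewrite cabs_half.
  have -> : 4 * (- x) ^+ 3 = 2^-1 * (2 * - x) ^+ 3 by field.
  by rewrite ler_wpM2l ?invr_ge0.
rewrite cabsM cabsR normfV (ltr0_norm x0) ler_pdivrMr ?oppr_gt0 // -mulrA -exprSr.
by apply: (le_trans T3); rewrite exprMn -natrX.
Qed.

Lemma error_recursion (tau lam : R) (g : R[i]) (E : nat -> R[i]) (N : nat) :
  0 < tau -> lam < 0 -> E 0%N = 0 ->
  (forall n, (n < N)%N -> E n.+1 =
     (expR (tau * lam))%:C * E n + tau%:C * quad_defect (tau * lam) * g) ->
  forall n, (n <= N)%N -> cabs (E n) <= 56 * tau ^+ 3 * (lam ^+ 2 * cabs g).
Proof.
move=> t0 l0 E0 ES; have x0 : tau * lam < 0 by rewrite pmulr_rlt0.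
elim=> [|n IH] nN.
  have t0' := ltW t0; rewrite E0 cabs0; 
  apply: mulr_ge0; first by rewrite mulr_ge0 ?exprn_ge0.
  by apply: mulr_ge0; [exact: sqr_ge0|exact: cabs_ge0].
rewrite ES //; apply: (le_trans (cabsD _ _)); rewrite !cabsM !cabsR.
rewrite (ger0_norm (expR_ge0 _)) (gtr0_norm t0).
(* The bound C is written as e^x C + (1 - e^x) C with x = tau lam; the second part is exactly what
   [quad_defect_bound] allows for the local error. *)
have -> : 56 * tau ^+ 3 * (lam ^+ 2 * cabs g) =
   expR (tau * lam) * (56 * tau ^+ 3 * (lam ^+ 2 * cabs g)) +
   tau * (56 * (tau * lam) ^+ 2 * (1 - expR (tau * lam))) * cabs g by ring.
apply: lerD; first by rewrite ler_wpM2l ?expR_ge0 // IH // ltnW.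
by rewrite ler_wpM2r ?cabs_ge0 // ler_wpM2l ?(ltW t0) // quad_defect_bound.
Qed.
End QuadratureDefect.

(** * Measure theory in R^n *)

Section Boxes.
Context {R : realType} {n : nat}.
Local Notation rV := 'rV[R]_n.
Implicit Types (a b : 'I_n -> R) (x y : rV).

Definition obox a b : set rV := [set x | forall i, a i < x ord0 i < b i].
Definition cbox a b : set rV := [set x | forall i, a i <= x ord0 i <= b i].

Lemma obox_cbox a b : obox a b `<=` cbox a b.
Proof. by move=> x h i; have /andP[/ltW -> /ltW ->] := h i. Qed.

Lemma oboxI a b a' b' : obox a b `&` obox a' b' =
  obox (fun i => Num.max (a i) (a' i)) (fun i => Num.min (b i) (b' i)).
Proof.
apply/seteqP; split => x /=.
  by move=> [h h'] i; rewrite gt_max lt_min; have /andP[-> ->] := h i; have /andP[-> ->] := h' i.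
move=> h; split=> i; have := h i; rewrite gt_max lt_min => /andP[/andP[h1 h2] /andP[h3 h4]].
  by rewrite h1 h3.
by rewrite h2 h4.
Qed.

Lemma measurable_obox a b : measurable (obox a b).
Proof.
have -> : obox a b = \bigcap_(i in [set: 'I_n])
   ((fun x : rV => x ord0 i : measurableTypeR R) @^-1` [set` `]a i, b i[]).
  apply/seteqP; split => x /=; first by move=> h i _ /=; rewrite in_itv /=; apply: h.
  by move=> h i; have := h i Logic.I; rewrite /= in_itv /=.
apply: fin_bigcap_measurable => // i _.
rewrite -[X in measurable X]setTI; exact: measurable_coord.
Qed.

Definition oboxes : set (set rV) := [set A | exists a b, A = obox a b].

Lemma oboxes_setI_closed : setI_closed oboxes.
Proof.
by move=> _ _ [a [b ->]] [a' [b' ->]]; eexists; eexists; apply: oboxI.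
Qed.

(** Boxes form a generating class stable under intersection, which is what the Dynkin argument for
    vanishing integrals requires. *)
Lemma measurable_oboxesE : @measurable _ rV = <<s oboxes >>.
Proof.
apply/seteqP; split; last first.
  apply: smallest_sub; first exact: sigma_algebra_measurable.
  by move=> _ [a [b ->]]; exact: measurable_obox.
apply: smallest_sub.
  split.
  - exact: sigma_algebra0.
  - by move=> A; apply: sigma_algebraCD.
  - by move=> F; apply: sigma_algebra_bigcup.
have mc (i : 'I_n) : measurable_fun setT
    (fun x : g_sigma_algebraType oboxes => (x : rV) ord0 i : measurableTypeR R).
  apply: (measurability _ (measurable_realfun.RGenOpens.measurableE R)).
  move=> _ [_ [a [b ->]] <-]; rewrite setTI.
  (* A slab in the i-th direction is the countable union of boxes whose other sides are (-N, N). *)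
  have -> : (fun x : g_sigma_algebraType oboxes => (x : rV) ord0 i) @^-1` `]a, b[%classic =
     \bigcup_N obox (fun j => if j == i then a else - N%:R) (fun j => if j == i then b else N%:R).
    apply/seteqP; split => x /=.
      rewrite in_itv /= => hx.
      have [N hN] : exists N : nat, forall j, `|(x : rV) ord0 j| < N%:R.
        exists (\sum_j Num.bound `|(x : rV) ord0 j|)%N => j.
        apply: (lt_le_trans (archi_boundP (normr_ge0 _))).
        by rewrite ler_nat (bigD1 j) //= leq_addr.
      exists N => // j /=; case: eqP => [->//|_].
      by have := hN j; rewrite ltr_norml.
    by move=> [N _ h]; have := h i; rewrite eqxx in_itv.
  apply: bigcupT_measurable => N.
  by apply: sub_sigma_algebra; eexists; eexists.
move=> A; elim/big_ind : _ => //; first by move=> B C hB hC [/hB|/hC].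
move=> i _ [B mB <-]; have := mc i measurableT B mB; rewrite !setTI; exact.
Qed.

Lemma box_countable : countable [set: {ffun 'I_n -> rat} * nat].
Proof. exact: countableP. Qed.

(** Rational centre [q.1] and half-width 1 / (q.2 + 1): a countable family. The closed box [qcbox q]
    with the same data will contain the support of the bump functions. *)
Definition qobox (q : {ffun 'I_n -> rat} * nat) : set rV :=
  obox (fun i => ratr (q.1 i) - q.2.+1%:R^-1) (fun i => ratr (q.1 i) + q.2.+1%:R^-1).
Definition qcbox (q : {ffun 'I_n -> rat} * nat) : set rV :=
  cbox (fun i => ratr (q.1 i) - q.2.+1%:R^-1) (fun i => ratr (q.1 i) + q.2.+1%:R^-1).

Lemma open_qobox (Om : set rV) x : open Om -> Om x -> exists q, qobox q x /\ qcbox q `<=` Om.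
Proof.
move=> oOm Omx; have /nbhs_ballP[e /= e0 he] := open_nbhs_nbhs (conj oOm Omx).
(* Half-width r < e / 2; a rational centre within r of x then puts x in the open box and the closed
   box in the ball of radius e. *)
pose k := Num.bound (2 / e); pose r : R := k.+1%:R^-1.
have r0 : 0 < r by rewrite invr_gt0 ltr0n.
have re : 2 * r < e.
  rewrite ltr_pdivrMr ?ltr0n // mulrC -ltr_pdivrMr //.
  apply: (lt_trans (archi_boundP _)); first by rewrite divr_ge0 // ltW.
  by rewrite ltr_nat.
have hq i : exists q : rat, `|ratr q - x ord0 i| < r.
  have [q] : exists q, ratr q \in `](x ord0 i - r), (x ord0 i + r)[.
    by apply: rat_in_itvoo; lra.
  by rewrite in_itv /= => /andP[h1 h2]; exists q; rewrite ltr_norml; apply/andP; split; lra.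
have [c hc] := choice hq.
exists ([ffun i => c i], k); split => [i|y hy] /=; rewrite -/r.
  by rewrite ffunE; have := hc i; rewrite ltr_norml => /andP[h1 h2]; apply/andP; split; lra.
apply: he; split => // i0 i; rewrite (ord1 i0) -ball_normE /=.
have := hy i; rewrite /= ffunE -/r; have := hc i; rewrite ltr_norml => /andP[h1 h2] /andP[h3 h4].
by rewrite ltr_norml; apply/andP; split; lra.
Qed.

Lemma open_bigcup_qobox (Om : set rV) : open Om ->
  Om = \bigcup_q (if `[< qcbox q `<=` Om >] then qobox q else set0).
Proof.
move=> oOm; apply/seteqP; split => x.
  move=> Omx; have [q [qx qs]] := open_qobox oOm Omx; exists q => //.
  by case: asboolP.
by move=> [q _]; case: asboolP => // h /obox_cbox /h.
Qed.

Lemma open_measurable_rV (Om : set rV) : open Om -> measurable Om.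
Proof.
move=> oOm; rewrite (open_bigcup_qobox oOm).
apply: (countable_bigcupT_measurable box_countable) => q.
by case: ifP => _; [exact: measurable_obox|exact: measurable0].
Qed.

Lemma continuous_measurable_rV (D : set rV) (f : rV -> R) : open D ->
  {in D, continuous f} -> measurable_fun D (f : rV -> measurableTypeR R).
Proof.
move=> oD cf; apply: (measurability _ (measurable_realfun.RGenOpens.measurableE R)).
move=> _ [_ [a [b ->]] <-]; apply: open_measurable_rV.
rewrite openE => x [Dx fx]; apply: filterI; first exact: open_nbhs_nbhs.
by apply: (cf x (mem_set Dx)); apply: open_nbhs_nbhs; split => //; exact: itv_open.
Qed.

Lemma coord_le_norm x i : `|x ord0 i| <= `|x|.
Proof.
rewrite [leRHS]/Num.Def.normr /= mx_normrE.
exact: (le_bigmax _ (fun ij : 'I_1 * 'I_n => `|x ij.1 ij.2|) (ord0, i)).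
Qed.

Lemma bounded_sub_obox (Om : set rV) : bounded_set Om ->
  exists M : R, Om `<=` obox (fun=> - M) (fun=> M).
Proof.
move=> [M [_ hM]]; exists (M + 2) => x Omx i /=.
have := le_trans (coord_le_norm x i) (hM (M + 1) (ltr_pwDr ltr01 (lexx M)) x Omx).
by rewrite ler_norml => /andP[h1 h2]; apply/andP; split; lra.
Qed.
End Boxes.

Lemma leb_obox_lty (R : realType) n (a b : 'I_n -> R) : (leb R n (obox a b) < +oo)%E.
Proof.
elim: n a b => [|n IH] a b /=.
  by rewrite diracE; case: (_ \in _); rewrite ltry.
have -> : leb_succ (leb R n) (obox a b) = product_measure1 (leb R n) (@lebesgue_measure R)
   (obox (fun i => a (lift ord0 i)) (fun i => b (lift ord0 i)) `*` [set` `]a ord0, b ord0[]).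
  rewrite /leb_succ /pushforward; congr (product_measure1 _ _ _).
  apply/seteqP; split => -[x t] /=.
    move=> h; split => [i|].
      by have := h (lift ord0 i); rewrite mxE liftK.
    by rewrite in_itv /=; have := h ord0; rewrite mxE unlift_none.
  rewrite in_itv /= => -[h1 h2] i; rewrite mxE.
  by case: unliftP => [j ->|->] /=.
rewrite product_measure1E; [|exact: measurable_obox|exact: measurable_itv].
apply: lte_mul_pinfty => //; first by rewrite ge0_fin_numE.
have E : (lebesgue_measure ([set` `]a ord0, b ord0[] : set R) < +oo)%E.
  by rewrite lebesgue_measure_itv /= lte_fin; case: ifP => _; rewrite ?ltry.
exact: E.
Qed.

Lemma leb_bounded_lty (R : realType) n (Om : set 'rV[R]_n) : open Om -> bounded_set Om ->
  (leb R n Om < +oo)%E.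
Proof.
move=> oOm /bounded_sub_obox[M hM]; apply: le_lt_trans (leb_obox_lty (fun=> - M) (fun=> M)).
apply: le_measure => //; rewrite inE; first exact: open_measurable_rV.
exact: measurable_obox.
Qed.

(** * Test functions *)

Section FlatExponential.
Context {R : realType}.
Implicit Types (p : {poly R}) (t x y e : R).

(** Applied at y = 1 / t, this is the flatness at 0 of p(1/t) e^(-1/t). For monomials it is y^m / m!
    <= e^y. *)
Lemma poly_expR_bound p k : exists2 C : R, 0 < C &
  forall y, 0 <= y -> `|p.[y]| * y ^+ k * expR (- y) <= C.
Proof.
have mono m : exists2 C : R, 0 < C & forall y, 0 <= y -> y ^+ m * expR (- y) <= C.
  exists (m`!%:R) => [|y y0]; first by rewrite ltr0n fact_gt0.
  rewrite expRN ler_pdivrMr ?expR_gt0 //; case: m => [|m].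
    by rewrite expr0 fact0 mul1r -expR0 ler_expR.
  have := expR_ge1Dxn m y0.
  rewrite -[leLHS]addrC -lerBrDr => h.
  rewrite mulrC -ler_pdivrMr ?ltr0n ?fact_gt0 //.
  by apply: (le_trans h); rewrite gerBl.
elim/poly_ind: p k => [|p c IH] k.
  exists 1 => // y y0; by rewrite horner0 normr0 !mul0r.
have [C C0 hC] := IH k.+1; have [C' C'0 hC'] := mono k.
exists (C + (`|c| + 1) * C') => [|y y0]; first by rewrite addr_gt0 // mulr_gt0 // ltr_wpDl.
rewrite hornerMXaddC.
apply: (@le_trans _ _ (`|p.[y]| * y ^+ k.+1 * expR (- y) + `|c| * (y ^+ k * expR (- y)))).
  rewrite exprS !mulrA -!mulrDl.
  rewrite ler_wpM2r ?expR_ge0 // ler_wpM2r ?exprn_ge0 //.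
  by apply: (le_trans (ler_normD _ _)); rewrite normrM (ger0_norm y0).
rewrite lerD ?hC //; apply: ler_pM => //; last exact: hC'.
  by rewrite mulr_ge0 ?exprn_ge0 ?expR_ge0.
by rewrite lerDl.
Qed.

(** The polynomial factor makes the family closed under differentiation: p becomes X^2 (p - p').
    Smoothness of the classical function e^(-1/t), the case p = 1, then needs only first
    derivatives. *)
Definition flatexp p t : R := if 0 < t then p.[t^-1] * expR (- t^-1) else 0.

Lemma is_derive_flatexp p t :
  is_derive t 1 (flatexp p) (flatexp ('X^2 * (p - p^`())) t).
Proof.
have [t0|t0|->] := ltgtP t 0.
- rewrite {2}/flatexp ltNge (ltW t0) /=.
  apply: (@near_eq_is_derive _ _ _ (cst 0)).
    near=> s; rewrite /flatexp ltNge /cst; have -> // : s <= 0.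
    by apply: ltW; near: s; exact: lt_nbhsl.
- rewrite {2}/flatexp t0.
  pose g (s : R) := p.[s^-1] * expR (- s^-1).
  apply: (@near_eq_is_derive _ _ _ g).
    near=> s; rewrite /flatexp /g; have -> // : 0 < s.
    by near: s; apply: lt_nbhsr.
  have tn : t != 0 by rewrite gt_eqF.
  have dV : is_derive t 1 (fun s : R => s^-1) (- (t ^- 2)).
    have := @is_deriveV R id t 1 1 tn (is_derive_id _ _).
    by rewrite /= scaler1.
  have d1 : is_derive t 1 (horner p \o (fun s : R => s^-1)) (p^`().[t^-1] * - (t ^- 2)).
    exact: is_derive1_comp.
  have d2 : is_derive t 1 (@expR R \o (fun s : R => - s^-1)) (expR (- t^-1) * t ^- 2).
    apply: is_derive1_comp.
    have := is_deriveN dV; rewrite opprK; exact.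
  apply: (is_derive_eq (is_deriveM d1 d2)) => /=.
  rewrite /GRing.scale /= hornerM hornerXn hornerD hornerN exprVn.
  by move: (t ^- 2) => u; ring.
rewrite {2}/flatexp ltxx.
apply: is_derive_eps => e e0.
(* The exponent 2 gives |[flatexp p h]| <= C h^2 for h > 0, hence derivative 0 at the gluing
   point. *)
have [C C0 hC] := poly_expR_bound p 2.
exists (e / C) => [|h hh]; first exact: divr_gt0.
rewrite add0r {2}/flatexp ltxx mul0r !subr0 /flatexp.
case: ifP => h0; last by rewrite normr0 mulr_ge0 // ltW.
have := hC h^-1; rewrite invr_ge0 ltW // => /(_ isT) hC'.
rewrite normrM (ger0_norm (expR_ge0 _)).
have -> : `|p.[h^-1]| * expR (- h^-1) = (`|p.[h^-1]| * h^-1 ^+ 2 * expR (- h^-1)) * h ^+ 2.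
  by field; rewrite gt_eqF.
apply: (@le_trans _ _ (C * h ^+ 2)); first by rewrite ler_wpM2r ?sqr_ge0.
rewrite (gtr0_norm h0) expr2 mulrA ler_wpM2r ?(ltW h0) // mulrC -ler_pdivlMr //.
by rewrite ltW // -(gtr0_norm h0).
Unshelve. all: by end_near. Qed.

Lemma continuous_flatexp p : continuous (flatexp p).
Proof.
move=> t; apply/differentiable_continuous/derivable1_diffP.
by have [] := is_derive_flatexp p t.
Qed.
End FlatExponential.

Section SmoothFunctions.
Context {R : realType} {n : nat}.
Local Notation rV := 'rV[R]_n.

(* A class of functions which is visibly stable under partial derivatives and contains
   bump functions. *)
Inductive smooth_gen : (rV -> R) -> Prop :=
| smooth_atom (p : {poly R}) (c a : R) (i : 'I_n) :
    smooth_gen (fun x => flatexp p (c * x ord0 i + a))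
| smooth_cst (c : R) : smooth_gen (fun=> c)
| smooth_add f g : smooth_gen f -> smooth_gen g -> smooth_gen (fun x => f x + g x)
| smooth_mul f g : smooth_gen f -> smooth_gen g -> smooth_gen (fun x => f x * g x).

Lemma smooth_gen_continuous f : smooth_gen f -> continuous f.
Proof.
elim=> {f} [p c a i|c|f g _ cf _ cg|f g _ cf _ cg] x.
- apply: (@continuous_comp _ _ _ (fun x : rV => c * x ord0 i + a) (flatexp p)).
    apply: continuousD; last exact: cst_continuous.
    apply: (@continuousM _ _ (cst c)); first exact: cst_continuous.
    exact: coord_continuous.
  exact: continuous_flatexp.
- exact: cst_continuous.
- exact: (continuousD (cf x) (cg x)).
- exact: (continuousM (cf x) (cg x)).
Qed.

Lemma is_derive_line (h : R -> R) (l : rV -> R) (x v : rV) (s d : R) :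
  (forall t : R, l (t *: v + x) = s * t + l x) -> is_derive (l x) 1 h d ->
  is_derive x v (h \o l) (s * d).
Proof.
move=> hl hd.
have k : is_derive (0 : R) (1 : R) (h \o (fun t => s * t + l x)) (s * d).
  rewrite mulrC; apply: is_derive1_comp; first by rewrite mulr0 add0r.
  have := is_deriveD (is_deriveM (is_derive_cst s (0 : R) (1 : R)) (is_derive_id (0 : R) (1 : R)))
     (is_derive_cst (l x) (0 : R) (1 : R)).
  by move=> H; apply: (is_derive_eq H); rewrite /GRing.scale /= mulr1 mulr0 !addr0.
have E : (fun t : R => t^-1 *: ((h \o l) (t *: v + x) - (h \o l) x)) =
  (fun t : R => t^-1 *: ((h \o (fun t => s * t + l x)) (t *: 1 + 0) - (h \o (fun t => s * t + l x)) 0)).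
  apply/funext => t /=; rewrite hl mulr0 add0r addr0 /GRing.scale /= mulr1 //.
by case: k => k1 k2; split; [rewrite /derivable E|rewrite /derive E].
Qed.

Lemma smooth_gen_derive f (j : 'I_n) : smooth_gen f ->
  exists2 g, smooth_gen g & forall x, is_derive x (evec R j) f (g x).
Proof.
elim=> {f} [p c a i|c|f g sf [f' sf' df] sg [g' sg' dg]|f g sf [f' sf' df] sg [g' sg' dg]].
- exists (fun x => (c * (j == i)%:R) * flatexp ('X^2 * (p - p^`())) (c * x ord0 i + a)).
    by apply: smooth_mul; [exact: smooth_cst|exact: smooth_atom].
  move=> x; apply: (@is_derive_line (flatexp p) (fun x => c * x ord0 i + a)).
    by move=> t; rewrite !mxE eqxx /= eq_sym; case: eqP => _ /=; ring.
  exact: is_derive_flatexp.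
- by exists (fun=> 0); [exact: smooth_cst|move=> x; exact: is_derive_cst].
- exists (fun x => f' x + g' x); first exact: smooth_add.
  by move=> x; apply: is_deriveD.
- exists (fun x => f x * g' x + g x * f' x); first by apply: smooth_add; apply: smooth_mul.
  by move=> x; apply: is_deriveM.
Qed.

Lemma smooth_gen_pds f s : smooth_gen f -> smooth_gen (pds s f).
Proof.
move=> sf; elim: s => [|i s IH] //=.
have [g sg dg] := smooth_gen_derive i IH.
suff -> : (fun x => 'D_(evec R i) (pds s f) x) = g by [].
by apply/funext => x; have [_ ->] := dg x.
Qed.

Lemma smooth_gen_Cinfty f : smooth_gen f -> Cinfty f.
Proof.
move=> sf k s _; have sp := smooth_gen_pds s sf; split; first exact: smooth_gen_continuous.
by move=> _ i x; have [g _ dg] := smooth_gen_derive i sp; have [] := dg x.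
Qed.

Lemma smooth_gen_prod (I : Type) (r : seq I) (F : I -> rV -> R) :
  (forall i, smooth_gen (F i)) -> smooth_gen (fun x => \prod_(i <- r) F i x).
Proof.
move=> sF; elim: r => [|i r IH].
  by under eq_fun do rewrite big_nil; exact: smooth_cst.
by under eq_fun do rewrite big_cons; exact: smooth_mul.
Qed.
End SmoothFunctions.

(** * The fundamental lemma of the calculus of variations *)

Section VanishingIntegrals.
Context {R : realType} {n : nat}.
Local Notation rV := 'rV[R]_n.
Implicit Types (a b : 'I_n -> R) (x : rV) (Om : set rV).

Let theta (t : R) : R := flatexp 1 t.

Lemma theta_ge0 t : 0 <= theta t.
Proof. by rewrite /theta /flatexp; case: ifP => // _; rewrite hornerC mul1r expR_ge0. Qed.

Lemma theta_le1 t : theta t <= 1.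
Proof.
rewrite /theta /flatexp; case: ifP => // t0; rewrite hornerC mul1r -expR0 ler_expR.
by rewrite oppr_le0 invr_ge0 ltW.
Qed.

Lemma theta_le0 t : t <= 0 -> theta t = 0.
Proof. by move=> t0; rewrite /theta /flatexp ltNge t0. Qed.

Lemma theta_cvg t : 0 < t -> theta (k.+1%:R * t) @[k --> \oo] --> (1 : R).
Proof.
move=> t0.
have -> : (fun k => theta (k.+1%:R * t)) = (fun k => expR (- (harmonic k * t^-1))).
  apply/funext => k; rewrite /theta /flatexp mulr_gt0 // hornerC mul1r.
  by rewrite invfM.
rewrite -[X in _ --> X]expR0.
apply: (cvg_comp (fun k => - (harmonic k * t^-1)) (@expR R)); last exact: continuous_expR.
have h : (fun k => - (@harmonic R k * t^-1)) @ \oo --> - (0 * t^-1).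
  by apply: cvgN; apply: cvgM; [exact: cvg_harmonic|exact: cvg_cst].
by rewrite mul0r oppr0 in h.
Qed.

(** For t > 0 the factor [theta] at (k + 1) t is e^(-1/((k+1) t)), which tends to 1; for t <= 0 it
    is 0. The steepness grows with k while the support stays in the same closed box. *)
Definition box_bump a b (k : nat) x : R :=
  \prod_i (theta (k.+1%:R * (x ord0 i - a i)) * theta (k.+1%:R * (b i - x ord0 i))).

Lemma box_bump_smooth a b k : smooth_gen (box_bump a b k).
Proof.
apply: smooth_gen_prod => i; apply: smooth_mul.
  have -> : (fun x : rV => theta (k.+1%:R * (x ord0 i - a i))) =
    (fun x : rV => flatexp 1 (k.+1%:R * x ord0 i + - (k.+1%:R * a i))).
    by apply/funext => x; rewrite mulrBr.
  exact: smooth_atom.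
have -> : (fun x : rV => theta (k.+1%:R * (b i - x ord0 i))) =
  (fun x : rV => flatexp 1 (- k.+1%:R * x ord0 i + (k.+1%:R * b i))).
  by apply/funext => x; rewrite mulrBr addrC mulNr.
exact: smooth_atom.
Qed.

Lemma box_bump_out a b k x : ~ obox a b x -> box_bump a b k x = 0.
Proof.
move=> nx; have [i hi] : exists i, ~ (a i < x ord0 i < b i) by apply/existsNP.
rewrite /box_bump (bigD1 i) //=.
have [h|h] := leP (x ord0 i) (a i).
  by rewrite theta_le0 ?mul0r // mulr_ge0_le0 // subr_le0.
rewrite [X in _ * X * _]theta_le0 ?mulr0 ?mul0r // mulr_ge0_le0 // subr_le0 leNgt.
by apply/negP => h'; apply: hi; rewrite h.
Qed.

Lemma box_bump_ge0 a b k x : 0 <= box_bump a b k x.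
Proof. by apply: prodr_ge0 => i _; rewrite mulr_ge0 ?theta_ge0. Qed.

Lemma box_bump_le1 a b k x : box_bump a b k x <= 1.
Proof.
apply: prodr_ile1 => i _; rewrite mulr_ge0 ?theta_ge0 //=.
by rewrite -[leRHS]mulr1 ler_pM ?theta_ge0 ?theta_le1.
Qed.

Lemma box_bump_cvg a b x : box_bump a b k x @[k --> \oo] --> (\1_(obox a b) x : R).
Proof.
rewrite indicE; case: (boolP (x \in obox a b)) => [|/negP]; rewrite inE => hx; last first.
  have -> : (fun k => box_bump a b k x) = (fun=> 0) by apply/funext => k; rewrite box_bump_out.
  exact: cvg_cst.
rewrite /box_bump.
have E : (1%:R : R) = \prod_(i : 'I_n) (1 * 1) by rewrite big1 // => i _; rewrite mulr1.
rewrite [X in _ --> X]E.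
elim: (index_enum _) => [|i r IH].
  by under eq_fun do rewrite big_nil; rewrite big_nil; exact: cvg_cst.
under eq_fun do rewrite big_cons; rewrite big_cons.
have /andP[h1 h2] := hx i.
by apply: cvgM => //; apply: cvgM; apply: theta_cvg; rewrite subr_gt0.
Qed.

Lemma box_bump_test a b k Om : cbox a b `<=` Om -> test_function Om (box_bump a b k).
Proof.
move=> sOm; split; first exact: smooth_gen_Cinfty (box_bump_smooth a b k).
exists (cbox a b); split => //.
  have -> : cbox a b = [set x : rV | forall i, [set` `[a i, b i]] (x ord0 i)].
    by apply/seteqP; split => x /= h i; have := h i; rewrite /= in_itv /=.
  by apply: (@rV_compact R n (fun i => [set` `[a i, b i]])) => i; exact: segment_compact.
by move=> x nx; apply: box_bump_out => /obox_cbox.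
Qed.

Section Integrable.
Variables (Om : set rV) (g : rV -> R).
Hypotheses (oOm : open Om) (ig : (leb R n).-integrable Om (EFin \o g)).
Hypothesis g_test : forall phi, test_function Om phi ->
  (\int[leb R n]_(x in Om) (g x * phi x)%:E = 0)%E.

Let mOm : measurable Om. Proof. exact: open_measurable_rV. Qed.
Let mg : measurable_fun Om g.
Proof. by apply/measurable_EFinP; exact: (measurable_int _ ig). Qed.

Lemma integral_obox_eq0 a b : cbox a b `<=` Om ->
  (\int[leb R n]_(x in obox a b) (g x)%:E = 0)%E.
Proof.
move=> sOm.
have sO : obox a b `<=` Om by apply: subset_trans sOm; exact: obox_cbox.
have H := @dominated_cvg _ _ _ (leb R n) Om mOm (fun k x => (g x * box_bump a b k x)%:E)
   (fun x => (g x * \1_(obox a b) x)%:E) (fun x => `|g x|%:E).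
have {}H : (\int[leb R n]_(x in Om) (g x * box_bump a b k x)%:E)%E @[k --> \oo] -->
   (\int[leb R n]_(x in Om) (g x * \1_(obox a b) x)%:E)%E.
  apply: H => //.
  - move=> k; apply/measurable_EFinP; apply: measurable_funM => //.
    apply: continuous_measurable_rV => // x _.
    exact: (smooth_gen_continuous (box_bump_smooth a b k)).
  - move=> x _; apply: cvg_EFin; first by near=> k.
    by apply: cvgM; [exact: cvg_cst|exact: box_bump_cvg].
  - exact: (integrable_abse ig).
  - move=> k x _; rewrite /= lee_fin normrM ler_piMr // ger0_norm ?box_bump_ge0 //.
    exact: box_bump_le1.
have E k : (\int[leb R n]_(x in Om) (g x * box_bump a b k x)%:E = 0)%E.
  by apply: g_test; exact: box_bump_test.
have Z : (\int[leb R n]_(x in Om) (g x * \1_(obox a b) x)%:E = 0)%E.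
  move: H; under eq_fun do rewrite E.
  by move=> /cvg_lim <- //; rewrite lim_cst.
rewrite -(setIidr sO) integral_mkcondr -[RHS]Z; apply: eq_integral => x _.
by rewrite patchE indicE; case: ifP => _; rewrite ?mulr1 ?mulr0.
Unshelve. all: by end_near. Qed.

(** Dynkin's argument takes place inside one box, because the class of admissible A has to contain
    the whole space and the integral over the box itself is known to vanish. *)
Lemma integral_qobox_eq0 q A : qcbox q `<=` Om -> measurable A ->
  (\int[leb R n]_(x in A `&` qobox q) (g x)%:E = 0)%E.
Proof.
move=> sOm mA.
have sO : qobox q `<=` Om by apply: subset_trans sOm; exact: obox_cbox.
have mQ : measurable (qobox q : set rV) by exact: measurable_obox.
have iS B : measurable B -> B `<=` Om -> (leb R n).-integrable B (EFin \o g).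
  by move=> mB BO; apply: integrableS ig.
have Q0 : (\int[leb R n]_(x in qobox q) (g x)%:E = 0)%E by exact: integral_obox_eq0.
move: mA; rewrite [X in X A -> _]measurable_oboxesE.
apply: (@dynkin_induction _ _ oboxes
  (fun A => \int[leb R n]_(x in A `&` qobox q) (g x)%:E = 0)%E measurable_oboxesE oboxes_setI_closed).
- by rewrite setTI.
- move=> _ [a [b ->]]; rewrite /qobox oboxI; apply: integral_obox_eq0.
  apply: subset_trans sOm => x hx i; have /andP[] := hx i.
  by rewrite ge_max le_min => /andP[_ ->] /andP[_ ->].
- move=> S mS hS.
  have D : qobox q = (S `&` qobox q) `|` (~` S `&` qobox q).
    by rewrite -setIUl setUv setTI.
  have mSC : measurable (~` S) by exact: measurableC.
  have := Q0; rewrite {1}D integral_setU //; first last.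
  - apply/disj_setPS => x [[h _] [h' _]]; exact: h'.
  - by rewrite -D; apply: measurable_int (iS _ mQ sO).
  - exact: measurableI.
  - exact: measurableI.
  by rewrite hS add0e.
- move=> F mF tF hF; rewrite setI_bigcupl integral_bigcup.
  + by rewrite eseries0 // => i _ _; rewrite hF.
  + by apply/trivIsetP => i j _ _ ij; rewrite setIACA setIid (trivIsetP.1 tF) // set0I.
  + by move=> k; apply: measurableI.
  + apply: iS; first by apply: bigcupT_measurable => k; apply: measurableI.
    by move=> x [k _ [_ /sO]].
Qed.

(* Bump functions increase to the indicators of boxes, so g integrates to 0 over every
   box whose closure is in Om; these generate the Borel sets. *)
Lemma vanishing_test_integrals : ae_eq (leb R n) Om g (cst 0).
Proof.
pose F (q : {ffun 'I_n -> rat} * nat) : set rV :=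
  if `[< qcbox q `<=` Om >] then qobox q else set0.
have aeF q : (leb R n).-negligible [set x | F q x /\ g x <> 0].
  rewrite /F; case: asboolP => [sO|_]; last first.
    by apply: (negligibleS _ (negligible_set0 _)) => x [].
  have mQ : measurable (qobox q : set rV) by exact: measurable_obox.
  have sO' : qobox q `<=` Om by apply: subset_trans sO; exact: obox_cbox.
  have := @integral_ae_eq _ _ _ (leb R n) (qobox q) mQ (cst 0%E) (EFin \o g).
  case.
  - exact: integrableS ig.
  - exact: measurable_cst.
  - move=> E EQ mE; rewrite integral0 -(setIidl EQ); exact: integral_qobox_eq0.
  move=> N [mN N0 sN]; exists N; split => // x [xQ gx]; apply: sN => /= h.
  by have := h xQ => -[].
(* The exceptional sets of the countably many boxes are enumerated by natural numbers through
   [unpickle]. *)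
have neg : (leb R n).-negligible (\bigcup_k (if unpickle k is Some q then
    [set x | F q x /\ g x <> 0] else set0)).
  by apply: negligible_bigcup => k; case: (unpickle k) => [q|]; [exact: aeF|exact: negligible_set0].
apply: negligibleS neg => x /= /not_implyP[Omx gx].
have := Omx; rewrite {1}(open_bigcup_qobox oOm) => -[q _ hq].
by exists (pickle q) => //; rewrite pickleK.
Qed.
End Integrable.
End VanishingIntegrals.

(** * Complex L^2 spaces *)

Section ComplexIntegral.
Context {R : realType} {n : nat}.
Local Notation rV := 'rV[R]_n.
Local Notation fn := (rV -> R[i]).
Variable D : set rV.
Hypothesis mD : measurable D.
Implicit Types (f g h : fn) (c : R[i]).
Local Notation mu := (leb R n).
Local Notation Re := (@complex.Re R).
Local Notation Im := (@complex.Im R).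

Definition cmeas f := measurable_fun D (fun x => Re (f x) : measurableTypeR R) /\
  measurable_fun D (fun x => Im (f x) : measurableTypeR R).

Definition cintegrable f := mu.-integrable D (EFin \o (fun x => Re (f x))) /\
  mu.-integrable D (EFin \o (fun x => Im (f x))).

Lemma cmeasD f g : cmeas f -> cmeas g -> cmeas (fun x => f x + g x).
Proof.
move=> [f1 f2] [g1 g2]; split.
  by under eq_fun do rewrite ReD; exact: measurable_funD.
by under eq_fun do rewrite ImD; exact: measurable_funD.
Qed.

Lemma cmeasM f g : cmeas f -> cmeas g -> cmeas (fun x => f x * g x).
Proof.
move=> [f1 f2] [g1 g2]; split.
  by under eq_fun do rewrite ReM; apply: measurable_funB; exact: measurable_funM.
by under eq_fun do rewrite ImM; apply: measurable_funD; exact: measurable_funM.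
Qed.

Lemma cmeas_cst c : cmeas (fun=> c).
Proof. by split; exact: measurable_cst. Qed.

Lemma cmeas_conj f : cmeas f -> cmeas (fun x => conjc (f x)).
Proof.
move=> [f1 f2]; split.
  by have -> : (fun x => Re (conjc (f x))) = (fun x => Re (f x)) by apply/funext => x; case: (f x).
have -> : (fun x => Im (conjc (f x))) = (fun x => - Im (f x)) by apply/funext => x; case: (f x).
exact: measurableT_comp.
Qed.

Lemma cmeasN f : cmeas f -> cmeas (fun x => - f x).
Proof.
move=> mf; under eq_fun do rewrite -mulN1r.
by apply: cmeasM => //; exact: cmeas_cst.
Qed.

Lemma cmeasB f g : cmeas f -> cmeas g -> cmeas (fun x => f x - g x).
Proof. by move=> mf mg; apply: cmeasD => //; exact: cmeasN. Qed.

Lemma cmeas_real (p : rV -> R) : measurable_fun D (p : rV -> measurableTypeR R) ->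
  cmeas (fun x => (p x)%:C).
Proof. by move=> mp; split => //=; exact: measurable_cst. Qed.

Lemma measurable_cabs_sqr f : cmeas f ->
  measurable_fun D (fun x => cabs (f x) ^+ 2 : measurableTypeR R).
Proof.
move=> [f1 f2]; under eq_fun do rewrite cabs_sqr.
by apply: measurable_funD; exact: measurable_funX.
Qed.

Lemma cintD f g : cintegrable f -> cintegrable g ->
  cint D (fun x => f x + g x) = cint D f + cint D g.
Proof.
move=> [f1 f2] [g1 g2]; rewrite /cint; apply/eqP; rewrite eq_complex /=.
under [X in Rintegral _ _ X]eq_fun do rewrite ReD.
under [X in _ && (Rintegral _ _ X == _)]eq_fun do rewrite ImD.
by rewrite !RintegralD // !eqxx.
Qed.

Let RintegralZ (r : R) (p : rV -> R) : mu.-integrable D (EFin \o p) ->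
  Rintegral mu D (fun x => r * p x) = r * Rintegral mu D p.
Proof. by move=> ip; rewrite RintegralZl. Qed.

Let integrableZ (r : R) (p : rV -> R) : mu.-integrable D (EFin \o p) ->
  mu.-integrable D (EFin \o (fun x => r * p x)).
Proof. by move=> ip; have := integrableZl mD r ip; apply: eq_integrable. Qed.

Lemma cintZ c f : cintegrable f -> cint D (fun x => c * f x) = c * cint D f.
Proof.
move=> [f1 f2]; rewrite /cint.
have -> : Rintegral mu D (fun x => Re (c * f x)) =
   Re c * Rintegral mu D (fun x => Re (f x)) - Im c * Rintegral mu D (fun x => Im (f x)).
  under eq_Rintegral do rewrite ReM.
  by rewrite RintegralB ?RintegralZ //; exact: integrableZ.
have -> : Rintegral mu D (fun x => Im (c * f x)) =
   Re c * Rintegral mu D (fun x => Im (f x)) + Im c * Rintegral mu D (fun x => Re (f x)).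
  under eq_Rintegral do rewrite ImM.
  by rewrite RintegralD ?RintegralZ //; exact: integrableZ.
by apply/eqP; rewrite eq_complex ReM ImM /= !eqxx.
Qed.

Lemma cint_conj f : cintegrable f -> cint D (fun x => conjc (f x)) = conjc (cint D f).
Proof.
move=> [f1 f2]; rewrite /cint /=.
have -> : (fun x => Re (conjc (f x))) = (fun x => Re (f x)) by apply/funext => x; case: (f x).
have -> : (fun x => Im (conjc (f x))) = (fun x => -1 * Im (f x)).
  by apply/funext => x; case: (f x) => a b; rewrite mulN1r.
by rewrite RintegralZ // mulN1r.
Qed.

Lemma aeq_refl f : aeq D f f.
Proof. exact: ae_eq_refl. Qed.

Lemma aeq_sym f g : aeq D f g -> aeq D g f.
Proof. exact: ae_eq_sym. Qed.

Lemma aeq2 (op : R[i] -> R[i] -> R[i]) f g f' g' : aeq D f f' -> aeq D g g' ->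
  aeq D (fun x => op (f x) (g x)) (fun x => op (f' x) (g' x)).
Proof. by apply: filterS2 => x h1 h2 Dx; rewrite h1 // h2. Qed.

Lemma cint_aeq f g : cmeas f -> cmeas g -> aeq D f g -> cint D f = cint D g.
Proof.
move=> [f1 f2] [g1 g2] fg; rewrite /cint /Rintegral; congr (fine _ +i* fine _).
  apply: ae_eq_integral => //; try exact/measurable_EFinP.
  by apply: filterS fg => x h Dx; rewrite h.
apply: ae_eq_integral => //; try exact/measurable_EFinP.
by apply: filterS fg => x h Dx; rewrite h.
Qed.

Definition sqint f : \bar R := (\int[mu]_(x in D) ((cabs (f x) ^+ 2)%:E))%E.

Lemma sqint_ge0 f : (0 <= sqint f)%E.
Proof. by apply: integral_ge0 => x _; rewrite lee_fin sqr_ge0. Qed.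

Lemma poweR_half_le (x : \bar R) (e : R) : (0 <= x)%E -> 0 <= e ->
  (poweR x 2^-1 <= e%:E)%E = (x <= (e ^+ 2)%:E)%E.
Proof.
move=> x0 e0; rewrite poweR12_sqrt //; case: x x0 => [r| |] //=.
rewrite !lee_fin => r0.
by rewrite -[in RHS](sqr_sqrtr r0) ler_pXn2r ?nnegrE ?sqrtr_ge0.
Qed.

Lemma L2norm_le f (e : R) : 0 <= e -> (L2norm D f <= e%:E)%E = (sqint f <= (e ^+ 2)%:E)%E.
Proof. by move=> e0; rewrite /L2norm -poweR_half_le ?sqint_ge0. Qed.

Lemma L2norm_ge0 f : (0 <= L2norm D f)%E.
Proof. exact: poweR_ge0. Qed.

Lemma L2P f : L2 D f <-> cmeas f /\ (sqint f < +oo)%E.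
Proof.
split=> [[f1 f2]|[[f1 f2] If]].
  by move=> /lty_poweRy h; split => //; apply: h; rewrite invr_neq0.
by split=> //; apply: poweR_lty.
Qed.

Lemma L2_cmeas f : L2 D f -> cmeas f.
Proof. by move/L2P => []. Qed.

(** The squared L^2 norm as a real number. [fine] sends an infinite integral to 0, so it is
    informative only together with membership in L^2. *)
Definition nrm2 f : R := fine (sqint f).

Lemma nrm2_ge0 f : 0 <= nrm2 f.
Proof. by rewrite fine_ge0 // sqint_ge0. Qed.

Lemma L2_sqint f : L2 D f -> sqint f = (nrm2 f)%:E.
Proof.
by move=> /L2P[_ h]; rewrite /nrm2 fineK // ge0_fin_numE // sqint_ge0.
Qed.

Lemma L2_norm_le f (e : R) : L2 D f -> 0 <= e ->
  (L2norm D f <= e%:E)%E = (nrm2 f <= e ^+ 2).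
Proof. by move=> Lf e0; rewrite L2norm_le // L2_sqint // lee_fin. Qed.

Lemma L2_normE f : L2 D f -> L2norm D f = (Num.sqrt (nrm2 f))%:E.
Proof.
move=> Lf; rewrite /L2norm -/(sqint f) L2_sqint // poweR_EFin powR12_sqrt //.
exact: nrm2_ge0.
Qed.

Lemma L2_integrable_sqr f : L2 D f -> mu.-integrable D (EFin \o (fun x => cabs (f x) ^+ 2)).
Proof.
move=> /L2P[mf If]; apply/integrableP; split.
  by apply/measurable_EFinP; exact: measurable_cabs_sqr.
rewrite (_ : (\int[mu]_(x in D) _)%E = sqint f) //.
by apply: eq_integral => x _ /=; rewrite ger0_norm ?sqr_ge0.
Qed.

Lemma L2_mul_integrable f g : L2 D f -> L2 D g -> cintegrable (fun x => f x * g x).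
Proof.
move=> Lf Lg; have [m1 m2] := cmeasM (L2_cmeas Lf) (L2_cmeas Lg).
have I := integrableD mD (L2_integrable_sqr Lf) (L2_integrable_sqr Lg).
have B x : cabs (f x * g x) <= cabs (f x) ^+ 2 + cabs (g x) ^+ 2.
  rewrite cabsM; have := sqr_ge0 (cabs (f x) - cabs (g x)).
  have := mulr_ge0 (cabs_ge0 (f x)) (cabs_ge0 (g x)).
  rewrite sqrrB; lra.
split; apply: (le_integrable mD _ _ I); try exact/measurable_EFinP; move=> x Dx /=.
  rewrite lee_fin [leRHS]ger0_norm ?addr_ge0 ?sqr_ge0 //.
  exact: le_trans (cabs_Re _) (B x).
rewrite lee_fin [leRHS]ger0_norm ?addr_ge0 ?sqr_ge0 //.
exact: le_trans (cabs_Im _) (B x).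
Qed.

Lemma L2_conj f : L2 D f -> L2 D (fun x => conjc (f x)).
Proof.
move=> /L2P[mf If]; apply/L2P; split; first exact: cmeas_conj.
rewrite (_ : sqint _ = sqint f) //; apply: eq_integral => x _.
by rewrite !cabs_sqr; case: (f x) => a b /=; rewrite sqrrN.
Qed.

Lemma L2_le f (h : rV -> R) : cmeas f -> mu.-integrable D (EFin \o h) ->
  (forall x, D x -> cabs (f x) ^+ 2 <= h x) -> L2 D f.
Proof.
move=> mf Ih fh; apply/L2P; split=> //.
apply: (@le_lt_trans _ _ (\int[mu]_(x in D) `|(EFin \o h) x|)%E); last first.
  by case/integrableP: Ih.
apply: ge0_le_integral => //.
- by move=> x _; rewrite lee_fin sqr_ge0.
- by apply/measurable_EFinP; exact: measurable_cabs_sqr.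
- by apply: measurableT_comp => //; case/integrableP: Ih.
- move=> x Dx /=; rewrite lee_fin (le_trans (fh x Dx)) //; exact: ler_norm.
Qed.

Lemma L2D f g : L2 D f -> L2 D g -> L2 D (fun x => f x + g x).
Proof.
move=> Lf Lg.
apply: (@L2_le _ (fun x => 2 * cabs (f x) ^+ 2 + 2 * cabs (g x) ^+ 2)).
- by apply: cmeasD; exact: L2_cmeas.
- have := integrableD mD (integrableZl mD 2 (L2_integrable_sqr Lf))
    (integrableZl mD 2 (L2_integrable_sqr Lg)); exact: eq_integrable.
move=> x _; have := cabsD (f x) (g x); have := cabs_ge0 (f x + g x).
have := sqr_ge0 (cabs (f x) - cabs (g x)).
move: (cabs (f x + g x)) (cabs (f x)) (cabs (g x)) => a b c h a0 ab.
have : a ^+ 2 <= (b + c) ^+ 2 by rewrite lerXn2r ?nnegrE //; apply: (le_trans a0).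
move: h; rewrite sqrrB sqrrD; lra.
Qed.

Lemma L2Z c f : L2 D f -> L2 D (fun x => c * f x).
Proof.
move=> Lf; apply: (@L2_le _ (fun x => cabs c ^+ 2 * cabs (f x) ^+ 2)).
- by apply: cmeasM; [exact: cmeas_cst|exact: L2_cmeas].
- have := integrableZl mD (cabs c ^+ 2) (L2_integrable_sqr Lf); exact: eq_integrable.
by move=> x _; rewrite cabsM exprMn.
Qed.

Lemma L2N f : L2 D f -> L2 D (fun x => - f x).
Proof. by move=> Lf; under eq_fun do rewrite -mulN1r; exact: L2Z. Qed.

Lemma L2B f g : L2 D f -> L2 D g -> L2 D (fun x => f x - g x).
Proof. by move=> Lf Lg; apply: L2D => //; exact: L2N. Qed.

Lemma L2_0 : L2 D (fun=> 0).
Proof.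
apply: (@L2_le _ (fun=> 0)); first exact: cmeas_cst.
  exact: integrable0.
by move=> x _; rewrite cabs0 expr0n.
Qed.

Lemma L2_sum (I : Type) (r : seq I) (F : I -> fn) : (forall i, L2 D (F i)) ->
  L2 D (fun x => \sum_(i <- r) F i x).
Proof.
move=> LF; elim: r => [|i r IH].
  by under eq_fun do rewrite big_nil; exact: L2_0.
by under eq_fun do rewrite big_cons; exact: L2D.
Qed.

Lemma nrm2_aeq f g : cmeas f -> cmeas g -> aeq D f g -> nrm2 f = nrm2 g.
Proof.
move=> mf mg fg; congr fine; apply: ae_eq_integral => //.
- by apply/measurable_EFinP; exact: measurable_cabs_sqr.
- by apply/measurable_EFinP; exact: measurable_cabs_sqr.
- by apply: filterS fg => x h Dx; rewrite h.
Qed.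

Lemma innerDl f g h : L2 D f -> L2 D g -> L2 D h ->
  inner D (fun x => f x + g x) h = inner D f h + inner D g h.
Proof.
move=> Lf Lg Lh; rewrite /inner -cintD; [|exact: L2_mul_integrable Lf (L2_conj Lh)
  |exact: L2_mul_integrable Lg (L2_conj Lh)].
by congr cint; apply/funext => x; rewrite mulrDl.
Qed.

Lemma innerZl c f h : L2 D f -> L2 D h ->
  inner D (fun x => c * f x) h = c * inner D f h.
Proof.
move=> Lf Lh; rewrite /inner -cintZ; last exact: L2_mul_integrable Lf (L2_conj Lh).
by congr cint; apply/funext => x; rewrite mulrA.
Qed.

Lemma innerNl f h : L2 D f -> L2 D h -> inner D (fun x => - f x) h = - inner D f h.
Proof.
by move=> Lf Lh; rewrite -mulN1r -innerZl //; congr inner; apply/funext => x; rewrite mulN1r.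
Qed.

Lemma innerBl f g h : L2 D f -> L2 D g -> L2 D h ->
  inner D (fun x => f x - g x) h = inner D f h - inner D g h.
Proof. by move=> Lf Lg Lh; rewrite innerDl ?innerNl //; exact: L2N. Qed.

Lemma inner0l h : L2 D h -> inner D (fun=> 0) h = 0.
Proof.
move=> Lh; rewrite -[RHS](mul0r (inner D (fun=> 0) h)) -innerZl //; last exact: L2_0.
by congr inner; apply/funext => x; rewrite mul0r.
Qed.

Lemma inner_suml (I : Type) (r : seq I) (F : I -> fn) h : (forall i, L2 D (F i)) -> L2 D h ->
  inner D (fun x => \sum_(i <- r) F i x) h = \sum_(i <- r) inner D (F i) h.
Proof.
move=> LF Lh; elim: r => [|i r IH].
  by under eq_fun do rewrite big_nil; rewrite big_nil inner0l.
under eq_fun do rewrite big_cons; rewrite big_cons innerDl ?IH //.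
exact: L2_sum.
Qed.

Lemma inner_conj f g : L2 D f -> L2 D g -> inner D g f = conjc (inner D f g).
Proof.
move=> Lf Lg; rewrite /inner -cint_conj; last exact: L2_mul_integrable Lf (L2_conj Lg).
congr cint; apply/funext => x; case: (f x) => a b; case: (g x) => c d.
by apply/eqP; rewrite eq_complex /=; apply/andP; split; apply/eqP; ring.
Qed.

Lemma inner_aeql f g h : L2 D f -> L2 D g -> L2 D h -> aeq D f g -> inner D f h = inner D g h.
Proof.
move=> Lf Lg Lh fg; apply: cint_aeq.
- by apply: cmeasM; [exact: L2_cmeas|exact/cmeas_conj/L2_cmeas].
- by apply: cmeasM; [exact: L2_cmeas|exact/cmeas_conj/L2_cmeas].
- exact: (aeq2 *%R fg (aeq_refl _)).
Qed.

Lemma nrm2E f : nrm2 f = Re (inner D f f).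
Proof.
rewrite /inner /cint /= /nrm2 /sqint /Rintegral; congr fine.
apply: eq_integral => x _; rewrite cabs_sqr; case: (f x) => a b /=.
by rewrite mulrN opprK !expr2.
Qed.

Lemma nrm2_parallelogram f g : L2 D f -> L2 D g ->
  nrm2 (fun x => f x + g x) + nrm2 (fun x => f x - g x) = 2 * nrm2 f + 2 * nrm2 g.
Proof.
move=> Lf Lg; have LD := L2D Lf Lg; have LB := L2B Lf Lg.
rewrite !nrm2E (innerDl Lf Lg LD) (innerBl Lf Lg LB) (inner_conj LD Lf) (inner_conj LD Lg)
  (inner_conj LB Lf) (inner_conj LB Lg).
rewrite (innerDl Lf Lg Lf) (innerDl Lf Lg Lg) (innerBl Lf Lg Lf) (innerBl Lf Lg Lg) !ReImE.
have ReJ (z : R[i]) : Re (conjc z) = Re z by case: z.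
by rewrite !ReJ !ReImE; ring.
Qed.

(** The parallelogram law replaces the triangle inequality and avoids square roots; the factors 2
    are harmless in all limits. *)
Lemma nrm2D f g : L2 D f -> L2 D g -> nrm2 (fun x => f x + g x) <= 2 * nrm2 f + 2 * nrm2 g.
Proof. by move=> Lf Lg; rewrite -nrm2_parallelogram // lerDl nrm2_ge0. Qed.

Lemma nrm2N f : nrm2 (fun x => - f x) = nrm2 f.
Proof. by congr fine; apply: eq_integral => x _; rewrite cabsN. Qed.

Lemma nrm2B f g : L2 D f -> L2 D g -> nrm2 (fun x => f x - g x) <= 2 * nrm2 f + 2 * nrm2 g.
Proof. by move=> Lf Lg; rewrite -(nrm2N g) nrm2D //; exact: L2N. Qed.

Lemma nrm2_0 : nrm2 (fun=> 0) = 0.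
Proof. by rewrite nrm2E inner0l //; exact: L2_0. Qed.

(* Expanding [nrm2 (f - s <f, g> g) >= 0] with [s = 1 / (1 + nrm2 g)]. *)
Lemma inner_bound f g : L2 D f -> L2 D g ->
  cabs (inner D f g) ^+ 2 <= (1 + nrm2 g) * nrm2 f.
Proof.
move=> Lf Lg; set z := inner D f g; set G := nrm2 g.
have G0 : 0 <= G by exact: nrm2_ge0.
pose s : R := (1 + G)^-1; have s0 : 0 < s by rewrite invr_gt0 ltr_pwDl.
pose c : R[i] := s%:C * z.
have E : nrm2 (fun x => f x - c * g x) = nrm2 f - 2 * (s * cabs z ^+ 2) + s ^+ 2 * cabs z ^+ 2 * G.
  have Lcg := L2Z c Lg; have LB := L2B Lf Lcg.
  rewrite [LHS]nrm2E (innerBl Lf Lcg LB) (innerZl _ Lg LB) (inner_conj LB Lf) (inner_conj LB Lg).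
  rewrite (innerBl Lf Lcg Lf) (innerBl Lf Lcg Lg) (innerZl _ Lg Lf) (innerZl _ Lg Lg).
  rewrite (inner_conj Lf Lg) -/z cabs_sqr /G !nrm2E.
  have := @inner_conj g g Lg Lg; rewrite /c; clearbody z; clear c Lcg LB.
  move: (inner D g g) (inner D f f) z => [p q] [p' q'] [a b] /= [hq].
  have -> : q = 0 by lra.
  ring.
have h : 0 <= nrm2 f - 2 * (s * cabs z ^+ 2) + s ^+ 2 * cabs z ^+ 2 * G.
  by rewrite -E nrm2_ge0.
have sG : s * G <= 1 by rewrite mulrC ler_pdivrMr ?mul1r ?ltr_pwDl // lerDr.
have : s * cabs z ^+ 2 <= nrm2 f.
  have : s ^+ 2 * cabs z ^+ 2 * G <= s * cabs z ^+ 2.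
    have -> : s ^+ 2 * cabs z ^+ 2 * G = (s * cabs z ^+ 2) * (s * G) by ring.
    by rewrite ler_piMr // mulr_ge0 ?sqr_ge0 // ltW.
  by move: h; lra.
by rewrite ler_pdivrMl // ltr_pwDl.
Qed.

End ComplexIntegral.

Lemma ler_sum_lin (R : realDomainType) (I : finType) (P : pred I) (a b : R) (F G H : I -> R) :
  (forall i, P i -> F i <= a * G i + b * H i) ->
  \sum_(i | P i) F i <= a * (\sum_(i | P i) G i) + b * (\sum_(i | P i) H i).
Proof. by move=> FGH; rewrite !mulr_sumr -big_split /=; apply: ler_sum. Qed.

(** * Sobolev spaces *)

Section WeakDerivatives.
Context {R : realType} {n : nat}.
Local Notation rV := 'rV[R]_n.
Local Notation fn := (rV -> R[i]).
Variable Om : set rV.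
Hypotheses (oOm : open Om) (bOm : bounded_set Om).
Implicit Types (f g h v w : fn) (al : 'I_n -> nat) (k : nat) (c : R[i]).
Local Notation mu := (leb R n).

Let mOm : measurable Om. Proof. exact: open_measurable_rV. Qed.

Lemma continuous_bounded_on (p : rV -> R) : continuous p ->
  exists K : R, forall x, Om x -> `|p x| <= K.
Proof.
move=> cp; have [M hM] := bounded_sub_obox bOm.
have cK : compact (cbox (fun=> - M) (fun=> M) : set rV).
  have -> : (cbox (fun=> - M) (fun=> M) : set rV) =
     [set x : rV | forall i, [set` `[- M, M]] (x ord0 i)].
    by apply/seteqP; split => x /= h i; have := h i; rewrite /= in_itv /=.
  by apply: (@rV_compact R n (fun i => [set` `[- M, M]])) => i; exact: segment_compact.
have : compact (p @` cbox (fun=> - M) (fun=> M)).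
  by apply: continuous_compact => //; exact: continuous_subspaceT.
move=> /compact_bounded[K [_ hK]]; exists (K + 1) => x Omx.
apply: (hK (K + 1)); first by rewrite ltrDl.
by exists x => //; apply/obox_cbox/hM.
Qed.

Lemma L2_bounded f (K : R) : cmeas Om f -> (forall x, Om x -> cabs (f x) <= K) -> L2 Om f.
Proof.
move=> mf fK; apply: (@L2_le _ _ _ mOm f (fun=> K ^+ 2)) => //.
  apply: measurable_bounded_integrable => //; first exact: leb_bounded_lty.
  by exists `|K ^+ 2|; split => // M hM x _ /=; exact: ltW.
move=> x Omx; rewrite lerXn2r ?nnegrE ?cabs_ge0 ?fK //.
by apply: le_trans (fK x Omx); exact: cabs_ge0.
Qed.

Lemma L2_mul_bounded f (p : rV -> R) (K : R) :
  measurable_fun Om (p : rV -> measurableTypeR R) -> (forall x, Om x -> `|p x| <= K) ->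
  L2 Om f -> L2 Om (fun x => (p x)%:C * f x).
Proof.
move=> mp pK Lf.
apply: (@L2_le _ _ _ mOm _ (fun x => K ^+ 2 * cabs (f x) ^+ 2)).
- by apply: cmeasM; [exact: cmeas_real|exact: L2_cmeas].
- have := integrableZl mOm (K ^+ 2) (L2_integrable_sqr Lf); exact: eq_integrable.
move=> x Omx; rewrite cabsM cabsR exprMn ler_wpM2r ?sqr_ge0 //.
rewrite lerXn2r ?nnegrE ?pK //.
by apply: le_trans (pK x Omx); exact: normr_ge0.
Qed.

Lemma nrm2_mul_bounded f (p : rV -> R) (K : R) :
  measurable_fun Om (p : rV -> measurableTypeR R) -> (forall x, Om x -> `|p x| <= K) ->
  L2 Om f -> nrm2 Om (fun x => (p x)%:C * f x) <= K ^+ 2 * nrm2 Om f.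
Proof.
move=> mp pK Lf; have Lpf := L2_mul_bounded mp pK Lf.
rewrite -lee_fin EFinM -!L2_sqint //.
have m2 : measurable_fun Om (EFin \o (fun x => cabs (f x) ^+ 2)).
  by apply/measurable_EFinP; apply: measurable_cabs_sqr; exact: L2_cmeas.
rewrite /sqint -ge0_integralZl //; last 2 first.
- by move=> x _; rewrite lee_fin sqr_ge0.
- by rewrite lee_fin sqr_ge0.
apply: ge0_le_integral => //.
- by move=> x _; rewrite lee_fin sqr_ge0.
- by apply/measurable_EFinP; apply: measurable_cabs_sqr; exact: L2_cmeas.
- by apply: measurable_funeM.
move=> x Omx; rewrite -EFinM lee_fin cabsM cabsR exprMn ler_wpM2r ?sqr_ge0 //.
rewrite lerXn2r ?nnegrE ?pK //.
by apply: le_trans (pK x Omx); exact: normr_ge0.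
Qed.

Lemma L2_test (phi : rV -> R) (s : seq 'I_n) : test_function Om phi ->
  L2 Om (fun x => (pds s phi x)%:C).
Proof.
move=> [Cphi _]; have [cs _] := Cphi (size s) s (leqnn _).
have [K hK] := continuous_bounded_on cs.
apply: (@L2_bounded _ K).
  by apply: cmeas_real; apply: continuous_measurable_rV => // x _; exact: cs.
by move=> x Omx; rewrite cabsR; apply: hK.
Qed.

Let test_inner f (p : rV -> R) : cint Om (fun x => f x * (p x)%:C) = inner Om f (fun x => (p x)%:C).
Proof. by congr cint; apply/funext => x; rewrite /= oppr0. Qed.

Lemma weak_derivativeE al f g : weak_derivative Om al f g <->
  forall phi, test_function Om phi -> inner Om f (fun x => (pds (mseq al) phi x)%:C) =
    (-1) ^+ mlen al * inner Om g (fun x => (phi x)%:C).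
Proof.
by split => H phi tphi; have := H phi tphi; rewrite !test_inner.
Qed.

Lemma inner_test_eq0 h : L2 Om h ->
  (forall phi, test_function Om phi -> inner Om h (fun x => (phi x)%:C) = 0) ->
  aeq Om h (fun=> 0).
Proof.
move=> Lh H.
(* A bounded set has finite measure, so 1 is in L^2 and h = h * 1 is integrable, as the fundamental
   lemma requires of its real and imaginary parts. *)
have L1 : L2 Om (fun=> 1).
  by apply: (@L2_bounded _ 1) => [|x _]; [exact: cmeas_cst|rewrite cabsR normr1].
have [i1 i2] := L2_mul_integrable mOm Lh L1.
have E (p : rV -> R[i]) (phi : rV -> R) : (fun x => p x * (phi x)%:C) =
  (fun x => (complex.Re (p x) * phi x) +i* (complex.Im (p x) * phi x)).
  apply/funext => x; apply/eqP; rewrite eq_complex ReM ImM /= !mulr0 subr0 add0r.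
  by rewrite !eqxx.
have R0 : ae_eq mu Om (fun x => complex.Re (h x)) (cst 0).
  apply: vanishing_test_integrals => //.
    by apply: eq_integrable i1 => // x _ /=; rewrite mulr1.
  move=> phi tphi; have := H phi tphi; rewrite -test_inner E /cint => -[] h0 _.
  have [I0 _] := L2_mul_integrable mOm Lh (L2_test [::] tphi).
  have I1 : mu.-integrable Om (EFin \o (fun x => complex.Re (h x) * phi x)).
    by apply: eq_integrable I0 => // x _ /=; rewrite ReM /= mulr0 subr0.
  by rewrite -[LHS]fineK ?(integrable_fin_num mOm I1) // -[fine _]/(Rintegral _ _ _) h0.
have I0 : ae_eq mu Om (fun x => complex.Im (h x)) (cst 0).
  apply: vanishing_test_integrals => //.
    by apply: eq_integrable i2 => // x _ /=; rewrite mulr1.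
  move=> phi tphi; have := H phi tphi; rewrite -test_inner E /cint => -[] _ h0.
  have [_ I0] := L2_mul_integrable mOm Lh (L2_test [::] tphi).
  have I1 : mu.-integrable Om (EFin \o (fun x => complex.Im (h x) * phi x)).
    by apply: eq_integrable I0 => // x _ /=; rewrite ImM /= mulr0 add0r.
  by rewrite -[LHS]fineK ?(integrable_fin_num mOm I1) // -[fine _]/(Rintegral _ _ _) h0.
apply: filterS2 R0 I0 => x h1 h2 Omx; apply/eqP; rewrite eq_complex.
by rewrite h1 // h2 // !eqxx.
Qed.

(** This makes the representatives chosen by [wD] comparable: linearity of weak derivatives up to
    null sets follows from it. *)
Lemma weak_derivative_uniq al f g g' : L2 Om g -> L2 Om g' ->
  weak_derivative Om al f g -> weak_derivative Om al f g' -> aeq Om g g'.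
Proof.
move=> Lg Lg' /weak_derivativeE H /weak_derivativeE H'.
have : aeq Om (fun x => g x - g' x) (fun=> 0).
  apply: inner_test_eq0; first exact: L2B.
  move=> phi tphi; rewrite innerBl //; last exact: (L2_test [::]).
  have := H phi tphi; rewrite H' // => /mulfI -> //; first by rewrite subrr.
  by rewrite signr_eq0.
by apply: filterS => x h Omx; apply/eqP; rewrite -subr_eq0; apply/eqP/h.
Qed.

Lemma weak_derivative_lin al c f g f' g' : L2 Om f -> L2 Om g -> L2 Om f' -> L2 Om g' ->
  weak_derivative Om al f g -> weak_derivative Om al f' g' ->
  weak_derivative Om al (fun x => c * f x + f' x) (fun x => c * g x + g' x).
Proof.
move=> Lf Lg Lf' Lg' /weak_derivativeE H /weak_derivativeE H'.
apply/weak_derivativeE => phi tphi.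
have L0 := L2_test [::] tphi; have L1 := L2_test (mseq al) tphi.
have Lcf := L2Z mOm c Lf; have Lcg := L2Z mOm c Lg.
rewrite (innerDl mOm Lcf Lf' L1) (innerDl mOm Lcg Lg' L0).
by rewrite (innerZl mOm c Lf L1) (innerZl mOm c Lg L0) H // H' //; ring.
Qed.

Lemma weak_derivative_aeql al f f' g : L2 Om f -> L2 Om f' -> aeq Om f f' ->
  weak_derivative Om al f g -> weak_derivative Om al f' g.
Proof.
move=> Lf Lf' ff' /weak_derivativeE H; apply/weak_derivativeE => phi tphi.
by rewrite -H // (inner_aeql mOm Lf Lf' (L2_test _ tphi) ff').
Qed.

Lemma weak_derivative0 f : weak_derivative Om (fun=> 0%N) f f.
Proof.
move=> phi _; have -> : mseq (fun=> 0%N) = [::] :> seq 'I_n.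
  by rewrite /mseq; elim: (enum 'I_n).
by rewrite /mlen big1 // expr0 mul1r.
Qed.

Lemma SobolevP k f al : Sobolev Om k f -> (mlen al <= k)%N ->
  L2 Om (wD Om al f) /\ weak_derivative Om al f (wD Om al f).
Proof.
move=> [_ /(_ al)] H /H[g Lg wg].
by apply: (@xgetPex _ (fun=> 0) [set g | L2 Om g /\ weak_derivative Om al f g]); exists g.
Qed.

Lemma Sobolev_L2 k f : Sobolev Om k f -> L2 Om f.
Proof. by case. Qed.

Lemma Sobolev_le k k' f : (k <= k')%N -> Sobolev Om k' f -> Sobolev Om k f.
Proof. by move=> kk' [Lf H]; split => // al hal; apply: H; apply: leq_trans kk'. Qed.

Lemma Sobolev_lin k c f f' : Sobolev Om k f -> Sobolev Om k f' ->
  Sobolev Om k (fun x => c * f x + f' x).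
Proof.
move=> Sf Sf'; have Lf := Sobolev_L2 Sf; have Lf' := Sobolev_L2 Sf'.
split; first by apply: L2D => //; exact: L2Z.
move=> al hal; have [Lg wg] := SobolevP Sf hal; have [Lg' wg'] := SobolevP Sf' hal.
exists (fun x => c * wD Om al f x + wD Om al f' x); last exact: weak_derivative_lin.
by apply: L2D => //; exact: L2Z.
Qed.

Lemma wD_lin k al c f f' : Sobolev Om k f -> Sobolev Om k f' -> (mlen al <= k)%N ->
  aeq Om (wD Om al (fun x => c * f x + f' x)) (fun x => c * wD Om al f x + wD Om al f' x).
Proof.
move=> Sf Sf' hal; have [L1 w1] := SobolevP (Sobolev_lin c Sf Sf') hal.
have [Lg wg] := SobolevP Sf hal; have [Lg' wg'] := SobolevP Sf' hal.
apply: (weak_derivative_uniq L1 _ w1); first by apply: L2D => //; exact: L2Z.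
by apply: weak_derivative_lin => //; [exact: Sobolev_L2 Sf|exact: Sobolev_L2 Sf'].
Qed.

Lemma wD0 k f : Sobolev Om k f -> aeq Om (wD Om (fun=> 0%N) f) f.
Proof.
move=> Sf; have [|L1 w1] := @SobolevP k f (fun=> 0%N) Sf; first by rewrite /mlen big1.
by apply: (weak_derivative_uniq L1 _ w1); [exact: Sobolev_L2 Sf|exact: weak_derivative0].
Qed.

(** A genuine equality, not only almost everywhere: both sides choose from the same set of
    candidates. *)
Lemma wD_aeq al f f' : L2 Om f -> L2 Om f' -> aeq Om f f' -> wD Om al f = wD Om al f'.
Proof.
move=> Lf Lf' ff'; rewrite /wD; congr xget; apply/seteqP; split => g [Lg wg]; split => //.
  exact: weak_derivative_aeql wg.
by apply: weak_derivative_aeql wg => //; exact: aeq_sym.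
Qed.

Lemma Sobolev_aeq k f f' : L2 Om f' -> aeq Om f f' -> Sobolev Om k f -> Sobolev Om k f'.
Proof.
move=> Lf' ff' [Lf H]; split => // al hal; have [g Lg wg] := H al hal.
by exists g => //; exact: weak_derivative_aeql wg.
Qed.

Definition Hn2 k f : R :=
  \sum_(al : {ffun 'I_n -> 'I_k.+1} | (mlen (fun i => al i : nat) <= k)%N)
     nrm2 Om (wD Om (fun i => al i : nat) f).

Lemma Hnorm_le k f (e : R) : Sobolev Om k f -> 0 <= e ->
  (Hnorm Om k f <= e%:E)%E = (Hn2 k f <= e ^+ 2).
Proof.
move=> Sf e0; rewrite /Hnorm; case: asboolP => // _.
rewrite poweR_half_le //; last first.
  by apply: sume_ge0 => al _; rewrite expe_ge0 // L2norm_ge0.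
rewrite (eq_bigr (fun al : {ffun 'I_n -> 'I_k.+1} => (nrm2 Om (wD Om (fun i => al i : nat) f))%:E)).
  by rewrite sumEFin lee_fin.
move=> al hal; have [Lg _] := SobolevP Sf hal.
by rewrite (L2_normE Lg) -EFin_expe sqr_sqrtr // nrm2_ge0.
Qed.

(** The value +oo outside the Sobolev space turns a bound on the norm into membership; approximating
    sequences obtain their regularity in this way. *)
Lemma Hnorm_fin k f (e : R) : (Hnorm Om k f <= e%:E)%E -> Sobolev Om k f.
Proof. by rewrite /Hnorm; case: asboolP. Qed.

Lemma Hnorm_ge0 k f : (0 <= Hnorm Om k f)%E.
Proof. by rewrite /Hnorm; case: ifP => // _; exact: poweR_ge0. Qed.

Lemma Hn2_wD k al f : (mlen al <= k)%N -> nrm2 Om (wD Om al f) <= Hn2 k f.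
Proof.
move=> hal.
have lt i : (al i < k.+1)%N.
  by rewrite ltnS (leq_trans _ hal) // /mlen (bigD1 i) //= leq_addr.
pose a := [ffun i => Ordinal (lt i)].
have E : (fun i => a i : nat) = al by apply/funext => i; rewrite ffunE.
rewrite /Hn2 (bigD1 a) /=; last by rewrite E.
by rewrite E lerDl sumr_ge0 // => b _; exact: nrm2_ge0.
Qed.

Lemma Hn2_nrm2 k f : Sobolev Om k f -> nrm2 Om f <= Hn2 k f.
Proof.
move=> Sf; have h0 : (@mlen n (fun=> 0%N) <= k)%N by rewrite /mlen big1.
apply: le_trans (Hn2_wD f h0); have [L0 _] := SobolevP Sf h0.
rewrite (nrm2_aeq mOm (L2_cmeas L0) (L2_cmeas (Sobolev_L2 Sf))) //.
exact: wD0 Sf.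
Qed.

Lemma SobolevB k f g : Sobolev Om k f -> Sobolev Om k g -> Sobolev Om k (fun x => f x - g x).
Proof.
move=> Sf Sg; have := Sobolev_lin (-1) Sg Sf; congr Sobolev.
by apply/funext => x; rewrite mulN1r addrC.
Qed.

Lemma wD_B k al f g : Sobolev Om k f -> Sobolev Om k g -> (mlen al <= k)%N ->
  aeq Om (wD Om al (fun x => f x - g x)) (fun x => wD Om al f x - wD Om al g x).
Proof.
move=> Sf Sg hal; have := wD_lin (-1) Sg Sf hal.
have -> : (fun x => -1 * g x + f x) = (fun x => f x - g x) by apply/funext => x; rewrite mulN1r addrC.
by under [X in aeq _ _ X -> _]eq_fun do rewrite mulN1r addrC.
Qed.

Lemma Hn2B k f g : Sobolev Om k f -> Sobolev Om k g ->
  Hn2 k (fun x => f x - g x) <= 2 * Hn2 k f + 2 * Hn2 k g.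
Proof.
move=> Sf Sg.
apply: ler_sum_lin => al hal.
have [L0 _] := SobolevP (SobolevB Sf Sg) hal.
have [L1 _] := SobolevP Sf hal; have [L2' _] := SobolevP Sg hal.
rewrite (nrm2_aeq mOm (L2_cmeas L0) _ (wD_B Sf Sg hal)); first exact: nrm2B.
by apply: cmeasB; exact: L2_cmeas.
Qed.

Lemma Hn2_aeq k f g : L2 Om f -> L2 Om g -> aeq Om f g -> Hn2 k f = Hn2 k g.
Proof.
by move=> Lf Lg fg; apply: eq_bigr => al _; rewrite (wD_aeq _ Lf Lg fg).
Qed.
End WeakDerivatives.

(** * Boundedness of the coefficients of D *)

Section BoundedCoefficients.
Context {R : realType} {n : nat}.
Local Notation rV := 'rV[R]_n.
Variable Om : set rV.
Hypotheses (oOm : open Om) (bOm : bounded_set Om).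
Implicit Types g : rV -> R.

Definition bounded_coef g := measurable_fun Om (g : rV -> measurableTypeR R) /\
  exists K : R, forall x, Om x -> `|g x| <= K.

Lemma compact_closure_bounded : compact (closure Om).
Proof.
apply: bounded_closed_compact; last exact: closed_closure.
have [M hM] := bounded_sub_obox bOm.
have cK : compact (cbox (fun=> - M) (fun=> M) : set rV).
  have -> : (cbox (fun=> - M) (fun=> M) : set rV) =
     [set x : rV | forall i, [set` `[- M, M]] (x ord0 i)].
    by apply/seteqP; split => x /= h i; have := h i; rewrite /= in_itv /=.
  by apply: (@rV_compact R n (fun i => [set` `[- M, M]])) => i; exact: segment_compact.
apply: (sub_boundedr _ (compact_bounded cK)).
rewrite /globally => P /= hP x cx; apply: hP; move: x cx.
have /closure_id -> : closed (cbox (fun=> - M) (fun=> M) : set rV).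
  apply: compact_closed => //; exact: norm_hausdorff.
by apply: closure_subset; apply: subset_trans hM _; exact: obox_cbox.
Qed.

Lemma C1_closure_bounded g : C1_closure Om g -> bounded_coef g.
Proof.
move=> [g0 [_ [cg0 _ gg0 _]]]; split.
  apply: (@eq_measurable_fun _ _ _ _ _ (g0 : rV -> measurableTypeR R)).
    by move=> x /set_mem /gg0.
  apply: continuous_measurable_rV => //; rewrite -continuous_open_subspace //.
  by apply: continuous_subspaceW cg0; exact: subset_closure.
have : compact (g0 @` closure Om) by apply: continuous_compact => //; exact: compact_closure_bounded.
move=> /compact_bounded[K [_ hK]]; exists (K + 1) => x Omx.
rewrite gg0 //; apply: (hK (K + 1)); first by rewrite ltrDl.
by exists x => //; exact: subset_closure.
Qed.

Lemma enorm_le (x : rV) : enorm x <= n%:R * `|x|.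
Proof.
rewrite -(@ler_pXn2r _ 2) ?nnegrE ?sqrtr_ge0 ?mulr_ge0 // sqr_sqrtr; last first.
  by apply: sumr_ge0 => i _; rewrite sqr_ge0.
case: n x => [|m] x; first by rewrite big_ord0 sqr_ge0.
apply: (@le_trans _ _ (\sum_(i < m.+1) `|x| ^+ 2)).
  apply: ler_sum => i _; rewrite -real_normK ?num_real //.
  by rewrite lerXn2r ?nnegrE // coord_le_norm.
rewrite sumr_const card_ord -[leLHS]mulr_natl exprMn ler_wpM2r ?sqr_ge0 //.
by rewrite expr2 ler_peMl // ler1n.
Qed.

Lemma unif_continuous_near g : unif_continuous_on Om g -> forall e : R, 0 < e ->
  exists2 dl : R, 0 < dl & forall x y, Om x -> Om y -> `|x - y| < dl -> `|g x - g y| < e.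
Proof.
move=> ug e e0; have [dl dl0 H] := ug e e0.
exists (dl / n.+1%:R) => [|x y Ox Oy xy]; first by rewrite divr_gt0.
apply: H => //; apply: (le_lt_trans (enorm_le _)).
apply: (@le_lt_trans _ _ (n.+1%:R * `|x - y|)); first by rewrite ler_wpM2r ?ler_nat.
by rewrite mulrC -ltr_pdivlMr.
Qed.

(** g lives on Om only, so compactness is applied to its closure and each closure point is replaced
    by a nearby point of Om. *)
Lemma unif_continuous_bounded g : unif_continuous_on Om g -> bounded_coef g.
Proof.
move=> ug; split.
  apply: continuous_measurable_rV => // x /set_mem Omx V /nbhs_ballP[e /= e0 he].
  have [dl dl0 H] := unif_continuous_near ug e0.
  have o1 : nbhs x Om by exact: open_nbhs_nbhs.
  have o2 : nbhs x (ball x dl) by exact: nbhsx_ballx.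
  apply: filterS2 o1 o2 => y Oy; rewrite -ball_normE /= => yx; apply: he.
  by rewrite -ball_normE /=; exact: H.
have [dl dl0 H] := unif_continuous_near ug (ltr01 : (0 : R) < 1).
have /compact_near_coveringP nc := compact_closure_bounded.
have dl2 : 0 < dl / 2 by rewrite divr_gt0.
have : \forall M \near +oo, closure Om `<=` (fun x => Om x -> `|g x| <= M).
  (* Locally the bound is |g y| + 1 for some y in Om within dl / 2 of x: two points within dl / 2 of
     x are closer than dl. Near-covering makes the bound uniform as M tends to infinity. *)
  apply: (nc R +oo (fun M x => Om x -> `|g x| <= M)) => x _.
  have [[y [Oy xy]]|nx] := pselect (exists y, Om y /\ ball x (dl / 2) y).
    exists (ball x (dl / 2), [set M | `|g y| + 1 <= M]) => /=.
      by split; [exact: nbhsx_ballx|exact: nbhs_pinfty_ge].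
    move=> [x' M] [/= xx' hM] Ox'; apply: le_trans hM.
    have : `|g x' - g y| < 1.
      apply: H => //; rewrite -ball_normE /= in xy; rewrite -ball_normE /= in xx'.
      have -> : x' - y = (x - y) - (x - x') by rewrite opprB [RHS]addrC addrA subrK.
      by rewrite (le_lt_trans (ler_normB _ _)) // [dl]splitr ltrD.
    move=> /ltW h; have -> : g x' = (g x' - g y) + g y by rewrite subrK.
    by rewrite (le_trans (ler_normD _ _)) // addrC lerD2l.
  exists (ball x (dl / 2), setT) => /=; first by split; [exact: nbhsx_ballx|exact: filterT].
  by move=> [x' M] [/= xx' _] Ox'; case: nx; exists x'.
move=> [M [_ hM]]; exists (M + 1) => x Omx.
by apply: (hM (M + 1)); rewrite ?ltrDl //; exact: subset_closure.
Qed.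
End BoundedCoefficients.

(** * The elliptic operator as a bounded map from H^2 to L^2 *)

Section EllipticOperator.
Context {R : realType} {d : nat}.
Local Notation rV := 'rV[R]_d.+1.
Local Notation fn := (rV -> R[i]).
Variable Om : set rV.
Hypotheses (oOm : open Om) (bOm : bounded_set Om).
Implicit Types (f g h v w : fn) (c : R[i]).
Let mOm : measurable Om. Proof. exact: open_measurable_rV. Qed.

(** Boundedness from H^2 to L^2 in squared form. For D it allows the coefficients of D z(s) to be
    differentiated when z is holomorphic with values in H^2. *)
Definition H2_bounded (Phi : fn -> fn) := exists2 K : R, 0 <= K & forall v,
  Sobolev Om 2 v -> L2 Om (Phi v) /\ nrm2 Om (Phi v) <= K * Hn2 Om 2 v.

Lemma H2_bounded_wD al : (mlen al <= 2)%N -> H2_bounded (wD Om al).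
Proof.
move=> hal; exists 1 => // v Sv; have [Lg _] := SobolevP Sv hal.
by split => //; rewrite mul1r Hn2_wD.
Qed.

Lemma H2_boundedD Phi Psi : H2_bounded Phi -> H2_bounded Psi ->
  H2_bounded (fun v x => Phi v x + Psi v x).
Proof.
move=> [K K0 hK] [M M0 hM]; exists (2 * K + 2 * M) => [|v Sv].
  by rewrite addr_ge0 ?mulr_ge0.
have [L1 h1] := hK v Sv; have [L2' h2] := hM v Sv; split; first exact: L2D.
apply: (le_trans (nrm2D mOm L1 L2')).
have -> : (2 * K + 2 * M) * Hn2 Om 2 v = 2 * (K * Hn2 Om 2 v) + 2 * (M * Hn2 Om 2 v) by ring.
by rewrite lerD // ler_wpM2l.
Qed.

Lemma H2_bounded_sum (I : Type) (r : seq I) (Phi : I -> fn -> fn) :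
  (forall i, H2_bounded (Phi i)) -> H2_bounded (fun v x => \sum_(i <- r) Phi i v x).
Proof.
move=> hPhi; elim: r => [|i r IH].
  exists 0 => // v Sv; under eq_fun do rewrite big_nil.
  by split; [exact: L2_0|rewrite nrm2_0 // mul0r].
have [K K0 hK] := H2_boundedD (hPhi i) IH; exists K => // v Sv.
by under eq_fun do rewrite big_cons; exact: hK.
Qed.

Lemma H2_bounded_coef (p : rV -> R) Phi : bounded_coef Om p -> H2_bounded Phi ->
  H2_bounded (fun v x => (p x)%:C * Phi v x).
Proof.
move=> [mp [K hK]] [M M0 hM]; exists (K ^+ 2 * M) => [|v Sv].
  by rewrite mulr_ge0 ?sqr_ge0.
have [L1 h1] := hM v Sv; split; first exact: L2_mul_bounded hK L1.
apply: (le_trans (nrm2_mul_bounded oOm mp hK L1)).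
by rewrite -mulrA ler_wpM2l ?sqr_ge0.
Qed.

Lemma H2_bounded_id : H2_bounded id.
Proof.
exists 1 => // v Sv; split; first exact: Sobolev_L2 Sv.
by rewrite mul1r; exact: Hn2_nrm2.
Qed.

Lemma mlen_wD1 (i : 'I_d.+1) : mlen (fun k => (k == i)%N) = 1%N.
Proof.
rewrite /mlen (bigD1 i) //= eqxx big1 // => j ji.
by rewrite (negbTE ji).
Qed.

Lemma mlen_wD2 (i j : 'I_d.+1) : mlen (fun k => ((k == i) + (k == j))%N) = 2%N.
Proof. by rewrite /mlen big_split /= -/(mlen _) -[X in (_ + X)%N]/(mlen _) !mlen_wD1. Qed.

Variable co : coefficients R d.+1.
Hypothesis ell : elliptic_coefficients Om co.

Lemma H2_bounded_Dop : H2_bounded (Dop Om co).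
Proof.
case: ell => _ _ ha hb hc.
apply: H2_boundedD; first apply: H2_boundedD.
- apply: (@H2_bounded_sum _ _ (fun i v x => \sum_j (ca co i j x)%:C * wD2 Om i j v x)) => i.
  apply: (@H2_bounded_sum _ _ (fun j v x => (ca co i j x)%:C * wD2 Om i j v x)) => j.
  apply: H2_bounded_coef; first exact: C1_closure_bounded.
  by apply: H2_bounded_wD; rewrite mlen_wD2.
- apply: (@H2_bounded_sum _ _ (fun i v x => (cb co i x)%:C * wD1 Om i v x)) => i.
  apply: H2_bounded_coef; first exact: unif_continuous_bounded.
  by apply: H2_bounded_wD; rewrite mlen_wD1.
- by apply: H2_bounded_coef; [exact: unif_continuous_bounded|exact: H2_bounded_id].
Qed.

Lemma L2_Dop v : Sobolev Om 2 v -> L2 Om (Dop Om co v).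
Proof. by have [K _ hK] := H2_bounded_Dop => /hK[]. Qed.

Lemma Dop_lin c v w : Sobolev Om 2 v -> Sobolev Om 2 w ->
  aeq Om (Dop Om co (fun x => c * v x + w x)) (fun x => c * Dop Om co v x + Dop Om co w x).
Proof.
move=> Sv Sw.
have h2 i j := @wD_lin _ _ _ oOm bOm 2 (fun k => ((k == i) + (k == j))%N) c v w Sv Sw
  (eq_leq (mlen_wD2 i j)).
have h1 i := @wD_lin _ _ _ oOm bOm 2 (fun k => (k == i)%N) c v w Sv Sw
  (leq_trans (eq_leq (mlen_wD1 i)) (leqnSn 1)).
(* The exceptional null sets for the finitely many derivatives are merged, so that the sums defining
   D can be rewritten at one point x. *)
have h1' : \forall x \ae leb R d.+1, forall i, Om x ->
  wD1 Om i (fun x => c * v x + w x) x = c * wD1 Om i v x + wD1 Om i w x.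
  by apply: filter_forall => i; exact: h1.
have h2' : \forall x \ae leb R d.+1, forall i j, Om x ->
  wD2 Om i j (fun x => c * v x + w x) x = c * wD2 Om i j v x + wD2 Om i j w x.
  by apply: filter_forall => i; apply: filter_forall => j; exact: h2.
apply: filterS2 h1' h2' => x e1 e2 Omx; rewrite /Dop.
under eq_bigr => i _ do under eq_bigr => j _ do rewrite e2 // mulrDr mulrCA.
under [X in _ + X + _ = _]eq_bigr => i _ do rewrite e1 // mulrDr mulrCA.
under eq_bigr => i _ do rewrite big_split /= -mulr_sumr.
rewrite !big_split /= -!mulr_sumr; ring.
Qed.

Lemma Dop_B v w : Sobolev Om 2 v -> Sobolev Om 2 w ->
  aeq Om (Dop Om co (fun x => v x - w x)) (fun x => Dop Om co v x - Dop Om co w x).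
Proof.
move=> Sv Sw; have := Dop_lin (-1) Sw Sv.
have -> : (fun x => -1 * w x + v x) = (fun x => v x - w x) by apply/funext => x; rewrite mulN1r addrC.
by under [X in aeq _ _ X -> _]eq_fun do rewrite mulN1r addrC.
Qed.
End EllipticOperator.

Lemma ecvg0P (R : realType) (T : Type) (F : set_system T) (FF : Filter F) (u : T -> \bar R) :
  (forall x, (0 <= u x)%E) ->
  (u @ F --> 0%E) <-> forall e : R, 0 < e -> \forall x \near F, (u x <= e%:E)%E.
Proof.
move=> u0; split.
  move=> /fine_cvgP[fu cu] e e0.
  have /cvgrPdist_le/(_ e e0) h := cu.
  apply: filterS2 fu h => x fx; rewrite sub0r normrN /= => h.
  by rewrite -(fineK fx) lee_fin (le_trans (ler_norm _)).
move=> H; have fin e : 0 < e -> \forall x \near F, u x \is a fin_num /\ `|fine (u x)| <= e.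
  move=> e0; apply: filterS (H e e0) => x h.
  have fx : u x \is a fin_num by rewrite ge0_fin_numE // (le_lt_trans h) ?ltry.
  by split => //; rewrite ger0_norm ?fine_ge0 // -lee_fin fineK.
apply/fine_cvgP; split; first by apply: filterS (fin 1 ltr01) => x [].
apply/cvgrPdist_le => e e0; apply: filterS (fin e e0) => x [_].
by rewrite sub0r normrN.
Qed.

(** * Functions of class C^k *)

Section ContinuouslyDifferentiable.
Context {R : realType} {n : nat}.
Implicit Types (f g : 'rV[R]_n -> R) (s : seq 'I_n) (k : nat).

Lemma pdsB k f g s : Ck k f -> Ck k g -> (size s <= k)%N ->
  pds s (fun x => f x - g x) = (fun x => pds s f x - pds s g x).
Proof.
move=> Cf Cg; elim: s => [//|i s IH] sk /=.
have sk' := ltnW sk; rewrite IH //; apply/funext => x.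
have [_ df] := Cf s sk'; have [_ dg] := Cg s sk'.
have -> : (fun x => pds s f x - pds s g x) = pds s f - pds s g by [].
by rewrite deriveB //; [exact: df|exact: dg].
Qed.

Lemma CkB k f g : Ck k f -> Ck k g -> Ck k (fun x => f x - g x).
Proof.
move=> Cf Cg s sk; rewrite (pdsB Cf Cg sk).
have [cf df] := Cf s sk; have [cg dg] := Cg s sk; split.
  by move=> x; apply: continuousB; [exact: cf|exact: cg].
by move=> sk' i x; apply: derivableB; [exact: df|exact: dg].
Qed.

Lemma Ck_continuous k f : Ck k f -> continuous f.
Proof. by move=> Cf; have [] := Cf [::] (leq0n k). Qed.

Lemma continuous_rV m (psi : 'rV[R]_n -> 'rV[R]_m) :
  (forall i, continuous (fun y => psi y ord0 i)) -> continuous psi.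
Proof.
move=> cpsi x V /nbhs_ballP[e /= e0 he].
have FF := nbhs_filter (x : 'rV[R]_n).
have h : \forall y \near x, forall i, `|psi x ord0 i - psi y ord0 i| < e.
  apply: (@filter_forall _ _ _ _ FF) => i.
  have : nbhs (psi x ord0 i) (ball (psi x ord0 i) e) by exact: nbhsx_ballx.
  by move=> /(cpsi i x); apply: (@filterS _ _ FF) => y; rewrite /= -ball_normE.
apply: (@filterS _ _ FF _ _ _ h) => y hy; apply: he; split => // i j.
by rewrite (ord1 i) -ball_normE /=; exact: hy.
Qed.
End ContinuouslyDifferentiable.

Lemma half_sqr_bound (R : realFieldType) (a b e : R) :
  a <= (e / 2) ^+ 2 -> b <= (e / 2) ^+ 2 -> 2 * a + 2 * b <= e ^+ 2.
Proof.
move=> h1 h2; have -> : e ^+ 2 = 2 * (e / 2) ^+ 2 + 2 * (e / 2) ^+ 2 by field.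
by rewrite lerD // ler_wpM2l.
Qed.

(** * Boundary conditions *)

Section Traces.
Context {R : realType} {d : nat}.
Local Notation rV := 'rV[R]_d.+1.
Local Notation fn := (rV -> R[i]).
Variable Om : set rV.
Hypotheses (oOm : open Om) (bOm : bounded_set Om).
Implicit Types (g h v w phi : fn).
Let mOm : measurable Om. Proof. exact: open_measurable_rV. Qed.

Definition csmooth phi := Cinfty (fun x => complex.Re (phi x)) /\
  Cinfty (fun x => complex.Im (phi x)).

Lemma csmoothB phi psi : csmooth phi -> csmooth psi -> csmooth (fun x => phi x - psi x).
Proof.
move=> [r1 i1] [r2 i2]; split => k.
  by under eq_fun do rewrite ReD ReN; apply: CkB; [exact: r1|exact: r2].
by under eq_fun do rewrite ImD ImN; apply: CkB; [exact: i1|exact: i2].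
Qed.

Lemma chart_cmeas V (psi : 'rV[R]_d -> rV) phi : boundary_chart Om V psi -> csmooth phi ->
  cmeas V (fun y => phi (psi y)).
Proof.
move=> [[oV _] Cpsi _ _ _] [r i].
have cpsi : continuous psi by apply: continuous_rV => j; exact: Ck_continuous (Cpsi j).
have c1 : continuous (fun y : 'rV[R]_d => complex.Re (phi (psi y))).
  by move=> y; exact: (continuous_comp (cpsi y) (Ck_continuous (r 0%N) (x := psi y))).
have c2 : continuous (fun y : 'rV[R]_d => complex.Im (phi (psi y))).
  by move=> y; exact: (continuous_comp (cpsi y) (Ck_continuous (i 0%N) (x := psi y))).
by split; apply: continuous_measurable_rV => // y _.
Qed.

Lemma L2_of_norm n (D : set 'rV[R]_n) (f : 'rV[R]_n -> R[i]) (e : R) :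
  cmeas D f -> 0 <= e -> (L2norm D f <= e%:E)%E -> L2 D f.
Proof.
move=> mf e0; rewrite L2norm_le // => h; apply/L2P; split=> //.
by rewrite (le_lt_trans h) ?ltry.
Qed.

Lemma traceB v w g h : trace Om v g -> trace Om w h ->
  trace Om (fun x => v x - w x) (fun x => g x - h x).
Proof.
move=> [Sv [phi [sphi cphi] bphi]] [Sw [psi [spsi cpsi] bpsi]].
split; first exact: SobolevB.
exists (fun k x => phi k x - psi k x).
  split=> [k|]; first exact: csmoothB.
  move/ecvg0P in cphi; move/ecvg0P in cpsi.
  apply/ecvg0P => [k|e e0]; first exact: Hnorm_ge0.
  have e2 : 0 < e / 2 by rewrite divr_gt0.
  apply: filterS2 (cphi (fun k => Hnorm_ge0 _ _ _) _ e2) (cpsi (fun k => Hnorm_ge0 _ _ _) _ e2) => k h1 h2.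
  have S1 := Hnorm_fin h1; have S2 := Hnorm_fin h2.
  have -> : (fun x => phi k x - psi k x - (v x - w x)) =
    (fun x => (phi k x - v x) - (psi k x - w x)) by apply/funext => x; ring.
  rewrite (Hnorm_le (SobolevB oOm bOm S1 S2) (ltW e0)).
  rewrite (Hnorm_le S1 (ltW e2)) in h1; rewrite (Hnorm_le S2 (ltW e2)) in h2.
  apply: (le_trans (Hn2B oOm bOm S1 S2)).
  exact: half_sqr_bound h1 h2.
move=> V ps ch; have [L1 c1] := bphi V ps ch; have [L2' c2] := bpsi V ps ch.
have oV : open V by case: ch => [[]].
have mV : measurable V by exact: open_measurable_rV.
split; first exact: (L2B mV L1 L2').
move/ecvg0P in c1; move/ecvg0P in c2.
apply/ecvg0P => [k|e e0]; first exact: L2norm_ge0.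
have e2 : 0 < e / 2 by rewrite divr_gt0.
apply: filterS2 (c1 (fun k => L2norm_ge0 _ _) _ e2) (c2 (fun k => L2norm_ge0 _ _) _ e2) => k h1 h2.
have M1 := cmeasB (chart_cmeas ch (sphi k)) (L2_cmeas L1).
have M2 := cmeasB (chart_cmeas ch (spsi k)) (L2_cmeas L2').
have K1 := L2_of_norm M1 (ltW e2) h1; have K2 := L2_of_norm M2 (ltW e2) h2.
have -> : (fun y => phi k (ps y) - psi k (ps y) - (g (ps y) - h (ps y))) =
  (fun y => (phi k (ps y) - g (ps y)) - (psi k (ps y) - h (ps y))) by apply/funext => y; ring.
rewrite (L2_norm_le (L2B mV K1 K2) (ltW e0)).
rewrite (L2_norm_le K1 (ltW e2)) in h1; rewrite (L2_norm_le K2 (ltW e2)) in h2.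
apply: (le_trans (nrm2B mV K1 K2)).
exact: half_sqr_bound h1 h2.
Qed.

Lemma trace_aeq v w g : L2 Om w -> aeq Om v w -> trace Om v g -> trace Om w g.
Proof.
move=> Lw vw [Sv [phi [sphi cphi] bphi]]; split; first exact: Sobolev_aeq Sv.
exists phi; last exact: bphi.
split; first exact: sphi.
move/ecvg0P in cphi; apply/ecvg0P => [k|e e0]; first exact: Hnorm_ge0.
apply: filterS (cphi (fun k => Hnorm_ge0 _ _ _) _ e0) => k h1.
have S1 := Hnorm_fin h1; have L1 := Sobolev_L2 S1.
have Lv := Sobolev_L2 Sv.
have E : aeq Om (fun x => phi k x - v x) (fun x => phi k x - w x).
  exact: (aeq2 (fun a b => a - b) (aeq_refl _ (phi k)) vw).
have L2w : L2 Om (fun x => phi k x - w x).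
  have -> : (fun x => phi k x - w x) = (fun x => (phi k x - v x) + (v x - w x)).
    by apply/funext => x; ring.
  by apply: (L2D mOm) => //; apply: (L2B mOm).
have S2 := Sobolev_aeq oOm bOm L2w E S1.
rewrite (Hnorm_le S2 (ltW e0)); rewrite (Hnorm_le S1 (ltW e0)) in h1.
by rewrite -(Hn2_aeq oOm bOm 1 L1 L2w E).
Qed.

Lemma bd_aeq_chart g h : bd_aeq Om g h -> forall V psi, boundary_chart Om V psi ->
  \forall y \ae leb R d, V y -> g (psi y) = h (psi y).
Proof. by move=> gh V psi ch; exact: gh. Qed.

(** Inhomogeneous boundary values reach A only through differences: for the exact solution and the
    lift this gives u(t) - z(t) in the domain of A. *)
Lemma Bop_sub (B : boundary_operator R d.+1) u v b : Sobolev Om 2 u -> Sobolev Om 2 v ->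
  Bop Om B u b -> Bop Om B v b -> domA Om B (fun x => u x - v x).
Proof.
move=> Su Sv; split; first exact: SobolevB.
case: B H H0 => [gam|bet gam] /=.
  move=> [g tg hg] [h th hh]; exists (fun x => g x - h x); first exact: traceB.
  move=> V psi ch; have := bd_aeq_chart hg ch; have := bd_aeq_chart hh ch.
  apply: filterS2 => y e1 e2 Vy; rewrite /= mulrBr -e1 // -e2 //.
  by rewrite subrr.
move=> [g0 [g1 [t0 t1 hg]]] [h0 [h1 [s0 s1 hh]]].
exists (fun x => g0 x - h0 x), (fun i x => g1 i x - h1 i x); split.
- exact: traceB.
- move=> i; have hal : (mlen (fun k : 'I_d.+1 => (k == i)%N) <= 2)%N by rewrite mlen_wD1.
  have [LL _] := SobolevP (SobolevB oOm bOm Su Sv) hal.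
  (* The chosen derivative of the difference agrees only almost everywhere with the difference of
     the chosen derivatives. *)
  apply: trace_aeq LL _ (traceB (t1 i) (s1 i)).
  by apply: aeq_sym; exact: (wD_B oOm bOm Su Sv hal).
- move=> V psi ch; have := bd_aeq_chart hg ch; have := bd_aeq_chart hh ch.
  apply: filterS2 => y e1 e2 Vy.
  apply/esym; transitivity (b (psi y) - b (psi y)); last by rewrite subrr.
  rewrite {1}e2 // e1 // [in RHS]opprD addrACA -sumrB /= mulrBr; congr (_ + _).
  by apply: eq_bigr => i _; rewrite mulrBr.
Qed.
End Traces.

(** * Bounded functionals *)

Section Functionals.
Context {R : realType} {n : nat}.
Local Notation fn := ('rV[R]_n -> R[i]).
Variable D : set 'rV[R]_n.
Hypothesis mD : measurable D.
Implicit Types (v w g : fn) (Phi Psi : fn -> R[i]).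

Definition bounded_functional Phi :=
  (forall c v w, L2 D v -> L2 D w -> Phi (fun x => c * v x + w x) = c * Phi v + Phi w) /\
  exists2 K : R, 0 <= K & forall v, L2 D v -> cabs (Phi v) ^+ 2 <= K * nrm2 D v.

Lemma bounded_functional_inner g : L2 D g -> bounded_functional (fun v => inner D v g).
Proof.
move=> Lg; split=> [c v w Lv Lw|].
  by rewrite (innerDl mD (L2Z mD c Lv) Lw Lg) (innerZl mD c Lv Lg).
exists (1 + nrm2 D g) => [|v Lv]; last exact: inner_bound.
by rewrite addr_ge0 // nrm2_ge0.
Qed.


Lemma bounded_functional0 Phi v : bounded_functional Phi -> L2 D v -> nrm2 D v = 0 -> Phi v = 0.
Proof.
move=> [_ [K K0 hK]] Lv v0; have := hK v Lv; rewrite v0 mulr0 => h.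
apply/eqP; rewrite -cabs_eq0 -sqrf_eq0 eq_le h; exact: sqr_ge0.
Qed.

Lemma bounded_functional_aeq Phi v w : bounded_functional Phi -> L2 D v -> L2 D w ->
  aeq D v w -> Phi v = Phi w.
Proof.
move=> bPhi Lv Lw vw.
have L : L2 D (fun x => -1 * w x + v x) by exact: (L2D mD (L2Z mD (-1) Lw) Lv).
have := bounded_functional0 bPhi L; rewrite bPhi.1 // mulN1r => h.
apply/eqP; rewrite -subr_eq0 addrC h //.
rewrite (_ : nrm2 D _ = nrm2 D (fun=> 0)); first exact: nrm2_0.
apply: (nrm2_aeq mD (L2_cmeas L) (cmeas_cst D 0)).
by apply: filterS vw => x h' Dx; rewrite h' // mulN1r addNr.
Qed.

Lemma bounded_functionalZB c Phi Psi : bounded_functional Phi -> bounded_functional Psi ->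
  bounded_functional (fun v => Phi v - c * Psi v).
Proof.
move=> [lin1 [K K0 hK]] [lin2 [M M0 hM]]; split=> [k v w Lv Lw|].
  by rewrite lin1 // lin2 //; ring.
exists (2 * K + 2 * (cabs c ^+ 2 * M)) => [|v Lv].
  apply: addr_ge0; first by rewrite mulr_ge0.
  by rewrite mulr_ge0 //; apply: mulr_ge0 => //; exact: sqr_ge0.
have h1 := hK v Lv; have h2 := hM v Lv.
have h3 : cabs (c * Psi v) ^+ 2 <= cabs c ^+ 2 * M * nrm2 D v.
  by rewrite cabsM exprMn -mulrA ler_wpM2l ?sqr_ge0.
have h4 : cabs (Phi v - c * Psi v) ^+ 2 <= 2 * cabs (Phi v) ^+ 2 + 2 * cabs (c * Psi v) ^+ 2.
  have := cabsB (Phi v) (c * Psi v); have := cabs_ge0 (Phi v - c * Psi v).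
  move: (cabs (Phi v - _)) (cabs (Phi v)) (cabs (c * _)) => a p q a0 apq.
  apply: (@le_trans _ _ ((p + q) ^+ 2)).
    by rewrite lerXn2r ?nnegrE // (le_trans a0).
  by have := sqr_ge0 (p - q); rewrite sqrrB sqrrD; lra.
apply: (le_trans h4); rewrite [leRHS]mulrDl -[_ * K * _]mulrA -[2 * _ * _]mulrA.
exact: (lerD (ler_wpM2l (ler0n _ 2) h1) (ler_wpM2l (ler0n _ 2) h3)).
Qed.
End Functionals.

(** * Expansions in an orthonormal basis *)

Section Eigenbasis.
Context {R : realType} {n : nat}.
Local Notation fn := ('rV[R]_n -> R[i]).
Variable D : set 'rV[R]_n.
Hypothesis mD : measurable D.
Variable e : nat -> fn.
Hypothesis Le : forall j, L2 D (e j).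
Hypothesis ortho : forall j k, inner D (e j) (e k) = (j == k)%:R.
Hypothesis complete : forall v, L2 D v ->
  L2norm D (fun x => v x - \sum_(j < N) inner D v (e j) * e j x)%R @[N --> \oo] --> 0%E.
Implicit Types (v w h : fn).

Definition proj (N : nat) v : fn := fun x => \sum_(j < N) inner D v (e j) * e j x.

Lemma L2_proj N v : L2 D (proj N v).
Proof. by apply: (L2_sum mD) => j; exact: (L2Z mD). Qed.

Lemma near_proj v (eps : R) : L2 D v -> 0 < eps ->
  \forall N \near \oo, nrm2 D (fun x => v x - proj N v x) <= eps.
Proof.
move=> Lv e0; have /ecvg0P H := complete Lv.
have s0 : 0 < Num.sqrt eps by rewrite sqrtr_gt0.
apply: filterS (H (fun N => L2norm_ge0 _ _) _ s0) => N.
by rewrite (L2_norm_le (L2B mD Lv (L2_proj N v)) (ltW s0)) sqr_sqrtr // (ltW e0).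
Qed.

Lemma bounded_functional_proj Phi N v : bounded_functional D Phi ->
  (forall j, Phi (e j) = 0) -> Phi (proj N v) = 0.
Proof.
move=> bPhi Pe; rewrite /proj; elim: N => [|N IH].
  apply: (bounded_functional0 bPhi).
    by under eq_fun do rewrite big_ord0; exact: L2_0.
  by under eq_fun do rewrite big_ord0; exact: nrm2_0.
have -> : (fun x => \sum_(j < N.+1) inner D v (e j) * e j x) =
  (fun x => inner D v (e N) * e N x + \sum_(j < N) inner D v (e j) * e j x).
  by apply/funext => x; rewrite big_ord_recr /= addrC.
by rewrite bPhi.1 // ?Pe ?IH ?mulr0 ?addr0 //; exact: L2_proj.
Qed.

(** Finite projections converge in L^2 and the functional vanishes on them. This extends the
    diagonal form of the semigroup from basis vectors to all of L^2. *)
Lemma bounded_functional_ext Phi v : bounded_functional D Phi ->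
  (forall j, Phi (e j) = 0) -> L2 D v -> Phi v = 0.
Proof.
move=> bPhi Pe Lv; have [lin [K K0 hK]] := bPhi.
have E N : Phi v = Phi (fun x => v x - proj N v x).
  have -> : (fun x => v x - proj N v x) = (fun x => -1 * proj N v x + v x).
    by apply/funext => x; ring.
  rewrite lin //; last exact: L2_proj.
  by rewrite bounded_functional_proj // mulr0 add0r.
apply/eqP; rewrite -cabs_eq0 -sqrf_eq0 eq_le sqr_ge0 andbT.
apply/ler_addgt0Pr => eps e0; rewrite add0r.
have K1 : 0 < K + 1 by rewrite ltr_wpDl.
have [N _ /(_ N (leqnn N)) /= hN] := near_proj Lv (divr_gt0 e0 K1).
rewrite (E N); apply: (le_trans (hK _ (L2B mD Lv (L2_proj N v)))).
apply: (@le_trans _ _ (K * (eps / (K + 1)))); first by rewrite ler_wpM2l.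
by rewrite mulrCA ler_piMr ?(ltW e0) // ler_pdivrMr // mul1r lerDl.
Qed.

Lemma nrm2_proj N v : nrm2 D (proj N v) = \sum_(j < N) cabs (inner D v (e j)) ^+ 2.
Proof.
rewrite nrm2E {1}/proj (inner_suml mD); last 2 first.
- by move=> j; exact: (L2Z mD).
- exact: (L2_proj N v).
have coef (j : 'I_N) : inner D (e j) (proj N v) = conjc (inner D v (e j)).
  rewrite (inner_conj mD (L2_proj N v) (Le j)) /proj (inner_suml mD) //; last first.
    by move=> k; exact: (L2Z mD).
  rewrite (bigD1 j) //= (innerZl mD _ (Le _) (Le _)) ortho eqxx mulr1 big1 ?addr0 //.
  move=> k kj; rewrite (innerZl mD _ (Le _) (Le _)) ortho.
  by rewrite (_ : (k == j :> nat) = false) ?mulr0 //; apply/negbTE.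
have Re_sum (F : 'I_N -> R[i]) : @complex.Re R (\sum_j F j) = \sum_j complex.Re (F j).
  by elim/big_rec2 : _ => // i a b _ <-; rewrite ReD.
rewrite Re_sum; apply: eq_bigr => j _.
rewrite (innerZl mD _ (Le _) (L2_proj N v)) coef cabs_sqr.
by case: (inner D v (e j)) => a b /=; rewrite mulrN opprK !expr2.
Qed.

(* The factor 4 is lost because only the parallelogram inequality is used. *)
Lemma nrm2_coef_le v h (C : R) : L2 D v -> L2 D h -> 0 <= C ->
  (forall j, cabs (inner D v (e j)) <= C * cabs (inner D h (e j))) ->
  nrm2 D v <= 4 * C ^+ 2 * nrm2 D h.
Proof.
move=> Lv Lh C0 vh; apply/ler_addgt0Pr => eps e0.
(* The truncation errors enter as 2 (eps / M) + 4 C^2 (eps / M), which is eps for this M. *)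
pose M := 2 + 4 * C ^+ 2; have M0 : 0 < M by rewrite ltr_wpDr // mulr_ge0 ?sqr_ge0.
have e1 : 0 < eps / M by rewrite divr_gt0.
have [N _ /(_ N (leqnn N)) /= [hv hh]] : \forall N \near \oo,
    nrm2 D (fun x => v x - proj N v x) <= eps / M /\ nrm2 D (fun x => h x - proj N h x) <= eps / M.
  by apply: filterS2 (near_proj Lv e1) (near_proj Lh e1) => N.
have E (w : fn) : (fun x => (w x - proj N w x) + proj N w x) = w.
  by apply/funext => x; rewrite subrK.
have E' (w : fn) : (fun x => w x - (w x - proj N w x)) = proj N w.
  by apply/funext => x; rewrite opprB addrC subrK.
have h1 := nrm2D mD (L2B mD Lv (L2_proj N v)) (L2_proj N v); rewrite E in h1.
have h2 := nrm2B mD Lh (L2B mD Lh (L2_proj N h)); rewrite E' in h2.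
have h3 : nrm2 D (proj N v) <= C ^+ 2 * nrm2 D (proj N h).
  rewrite !nrm2_proj mulr_sumr; apply: ler_sum => j _.
  by rewrite -exprMn lerXn2r ?nnegrE ?mulr_ge0 ?cabs_ge0.
have h4 : C ^+ 2 * nrm2 D (proj N h) <= C ^+ 2 * (2 * nrm2 D h + 2 * (eps / M)).
  by rewrite ler_wpM2l ?sqr_ge0 // (le_trans h2) // lerD2l ler_wpM2l.
apply: (le_trans h1).
have -> : 4 * C ^+ 2 * nrm2 D h + eps = 2 * (eps / M) + 2 * (C ^+ 2 * (2 * nrm2 D h + 2 * (eps / M))).
  have eM : eps = M * (eps / M) by rewrite mulrCA divff ?mulr1 // gt_eqF.
  by rewrite {1}eM {1}/M; ring.
exact: (lerD (ler_wpM2l (ler0n _ 2) hv) (ler_wpM2l (ler0n _ 2) (le_trans h3 h4))).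
Qed.
End Eigenbasis.

(** * Functionals on normed function spaces and vector-valued calculus *)

Section SpaceFunctionals.
Context {R : realType} {n : nat}.
Local Notation fn := ('rV[R]_n -> R[i]).
Implicit Types (X : nspace R n) (Phi : fn -> R[i]) (v w : fn).

(** One interface for functionals on L^2 and on H^2. Norms are extended reals, so the bound is
    stated for every real e above the norm. *)
Record space_functional X Phi : Prop := SpaceFunctional {
  sf_mem : forall c v w, nmem X v -> nmem X w -> nmem X (fun x => c * v x + w x);
  sf_lin : forall c v w, nmem X v -> nmem X w ->
    Phi (fun x => c * v x + w x) = c * Phi v + Phi w;
  sf_bound : exists2 K : R, 0 < K & forall v (e : R), nmem X v -> 0 <= e ->
    (nnorm X v <= e%:E)%E -> cabs (Phi v) <= K * e }.

Section Fixed.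
Variables (X : nspace R n) (Phi : fn -> R[i]).
Hypothesis sf : space_functional X Phi.

Lemma sfB v w : nmem X v -> nmem X w ->
  nmem X (fun x => v x - w x) /\ Phi (fun x => v x - w x) = Phi v - Phi w.
Proof.
move=> Xv Xw; have := sf_mem sf (-1) Xw Xv; have := sf_lin sf (-1) Xw Xv.
rewrite (_ : (fun x => -1 * w x + v x) = (fun x => v x - w x)) ?mulN1r 1?addrC //.
by apply/funext => x; rewrite mulN1r addrC.
Qed.

Lemma sfZ c v : nmem X v -> nmem X (fun x => c * v x) /\ Phi (fun x => c * v x) = c * Phi v.
Proof.
move=> Xv; have [X0 P0] := sfB Xv Xv.
have := sf_mem sf c Xv X0; have := sf_lin sf c Xv X0; rewrite P0 subrr addr0.
by under eq_fun do rewrite subrr addr0.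
Qed.

Lemma sf_sum N (c : 'I_N -> R[i]) (F : 'I_N -> fn) I : (forall k, nmem X (F k)) -> nmem X I ->
  nmem X (fun x => \sum_k c k * F k x - I x) /\
  Phi (fun x => \sum_k c k * F k x - I x) = \sum_k c k * Phi (F k) - Phi I.
Proof.
move=> XF XI; have [] : nmem X (fun x => \sum_k c k * F k x) /\
  Phi (fun x => \sum_k c k * F k x) = \sum_k c k * Phi (F k).
  elim: N c F XF => [|N IH] c F XF.
    have [X0 P0] := sfB XI XI; move: X0 P0; rewrite subrr big_ord0.
    under eq_fun do rewrite subrr.
    by under [in X in _ -> _ -> X]eq_fun do rewrite big_ord0.
  have [X1 P1] := IH (fun k => c (widen_ord (leqnSn N) k)) (fun k => F (widen_ord (leqnSn N) k))
    (fun k => XF _).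
  have := sf_mem sf (c ord_max) (XF ord_max) X1.
  have := sf_lin sf (c ord_max) (XF ord_max) X1; rewrite P1.
  rewrite (_ : (fun x => c ord_max * F ord_max x + _) = (fun x => \sum_k c k * F k x)); last first.
    by apply/funext => x; rewrite big_ord_recr /= addrC.
  by rewrite big_ord_recr /= addrC.
by move=> X1 P1; have [X2 P2] := sfB X1 XI; rewrite P2 P1.
Qed.

Lemma sf_quotient v w g k : nmem X v -> nmem X w -> nmem X g ->
  nmem X (fun x => k * (v x - w x) - g x) /\
  Phi (fun x => k * (v x - w x) - g x) = k * (Phi v - Phi w) - Phi g.
Proof.
move=> Xv Xw Xg; have [X1 P1] := sfB Xv Xw; have [X2 P2] := sfZ k X1.
by have [X3 P3] := sfB X2 Xg; rewrite P3 P2 P1.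
Qed.

Lemma quotient_bound (a b l h : R[i]) (e : R) : h != 0 ->
  cabs (h^-1 * (a - b) - l) <= e -> cabs (a - b - l * h) <= e * cabs h.
Proof.
move=> h0 H; rewrite (_ : a - b - l * h = h * (h^-1 * (a - b) - l)); last by field.
by rewrite cabsM mulrC ler_wpM2r ?cabs_ge0.
Qed.

Lemma holomorphic_cderiv U (y y' : R[i] -> fn) z : holomorphic X U y y' -> U z ->
  cderiv U (fun s => Phi (y s)) (Phi (y' z)) z.
Proof.
move=> [Xv hv] Uz e e0; have [K K0 hK] := sf_bound sf.
have e1 : 0 < e / K by rewrite divr_gt0.
have [dl dl0 H] := hv z Uz _ e1; exists dl => // w Uw wz.
have [->|wz0] := eqVneq w z; first by rewrite !subrr mulr0 subr0 cabs0 mulr0.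
have h0 : w - z != 0 by rewrite subr_eq0.
apply: quotient_bound => //.
have [X1 <-] := sf_quotient (w - z)^-1 (Xv w Uw).1 (Xv z Uz).1 (Xv z Uz).2.
apply: (le_trans (hK _ (e / K) X1 (ltW e1) _)).
  by apply: H => //; rewrite wz cabs_gt0 h0.
by rewrite mulrC divfK ?gt_eqF.
Qed.

(** A path in real time is read as a function of a complex variable through its real part and
    differentiated relative to [0, T]; the exact solution and the complex flows then share one
    calculus. *)
Lemma path_cderiv T (y y' : R -> fn) t : path_derivative X T y y' -> 0 <= t <= T ->
  cderiv [set w | exists2 s : R, 0 <= s <= T & w = s%:C]
    (fun s => Phi (y (complex.Re s))) (Phi (y' t)) t%:C.
Proof.
move=> [Xv hv] tT e e0; have [K K0 hK] := sf_bound sf.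
have e1 : 0 < e / K by rewrite divr_gt0.
have [dl dl0 H] := hv t tT _ e1; exists dl => // _ [s sT ->] /= .
rewrite -rmorphB cabsR => st.
have [->|st0] := eqVneq s t; first by rewrite !subrr mulr0 subr0 cabs0 normr0 mulr0.
have h0 : s - t != 0 by rewrite subr_eq0.
rewrite -cabsR; apply: quotient_bound; first by rewrite fmorph_eq0.
have [X1 E1] := sf_quotient ((s - t)^-1)%:C (Xv s sT).1 (Xv t tT).1 (Xv t tT).2.
rewrite -fmorphV -E1.
apply: (le_trans (hK _ (e / K) X1 (ltW e1) _)).
  by apply: H => //; rewrite st normr_gt0 h0.
by rewrite mulrC divfK ?gt_eqF.
Qed.

Lemma segment_integral_functional (p q : R[i]) (F : R[i] -> fn) I (L : R[i] -> R[i]) :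
  (forall s, seg p q s -> nmem X (F s)) ->
  segment_integral X p q F I ->
  (forall s, seg p q s -> cderiv (seg p q) L (Phi (F s)) s) -> Phi I = L q - L p.
Proof.
move=> XF [XI hI] hL; apply: (@riemann_tags _ (fun s => Phi (F s)) L p q) => // e e0.
have [K K0 hK] := sf_bound sf.
have e1 : 0 < e / K by rewrite divr_gt0.
have [dl dl0 H] := hI _ e1; exists dl => // N s xi s0 sN tags.
(* F is known to take values in X only on the segment, so the tags have to be located in [0, 1]: the
   partition increases from 0, and counting down from N bounds it by 1. *)
have tag k : (k < N)%N -> 0 <= xi k <= 1.
  move=> kN; have mono m : (m <= N)%N -> 0 <= s m.
    elim: m => [|m IH mN]; first by rewrite s0.
    have [/andP[h1 h2] _] := tags m mN.
    exact: (le_trans (IH (ltnW mN)) (le_trans h1 h2)).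
  have mono' m : (m <= N)%N -> s (N - m)%N <= 1.
    elim: m => [|m IH mN]; first by rewrite subn0 sN.
    have lt : (N - m.+1 < N)%N by rewrite ltn_subrL /= (leq_trans _ mN).
    have [/andP[h1 h2] _] := tags _ lt.
    apply: (le_trans (le_trans h1 h2)); rewrite -subSn //= subSS.
    exact: IH (ltnW mN).
  have [/andP[h1 h2] _] := tags k kN.
  rewrite (le_trans (mono k (ltnW kN)) h1) (le_trans h2) //.
  by have := mono' (N - k.+1)%N (leq_subr _ _); rewrite subKn.
have [X1 <-] := @sf_sum N (fun k => (q - p) * (s k.+1 - s k)%:C)
  (fun k => F (pt p q (xi k))) I (fun k => XF _ (seg_pt _ _ (tag k (ltn_ord k)))) XI.
apply: (le_trans (hK _ (e / K) X1 (ltW e1) _)); first exact: H.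
by rewrite mulrC divfK ?gt_eqF.
Qed.
End Fixed.

Lemma le_sqrt_mul (a m e K : R) : 0 <= a -> 0 <= e -> 0 <= K ->
  a ^+ 2 <= K * m -> m <= e ^+ 2 -> a <= Num.sqrt (K + 1) * e.
Proof.
move=> a0 e0 K0 h1 h2.
rewrite -(@ler_pXn2r _ 2) ?nnegrE // ?mulr_ge0 ?sqrtr_ge0 //.
rewrite exprMn sqr_sqrtr ?addr_ge0 //; apply: (le_trans h1).
by apply: (le_trans (ler_wpM2l K0 h2)); rewrite ler_wpM2r ?sqr_ge0 // lerDl.
Qed.

Lemma space_functional_L2 (D : set 'rV[R]_n) Phi : measurable D -> bounded_functional D Phi ->
  space_functional (L2sp D) Phi.
Proof.
move=> mD [lin [K K0 hK]]; split=> //=.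
- by move=> c v w Lv Lw; apply: L2D => //; exact: L2Z.
- exists (Num.sqrt (K + 1)) => [|v e Lv e0]; first by rewrite sqrtr_gt0 ltr_wpDl.
  rewrite (L2_norm_le Lv e0) => h.
  exact: (le_sqrt_mul (cabs_ge0 _) e0 K0 (hK v Lv) h).
Qed.
End SpaceFunctionals.

Lemma space_functional_H2 (R : realType) d (D : set 'rV[R]_d.+1)
    (Psi : ('rV[R]_d.+1 -> R[i]) -> 'rV[R]_d.+1 -> R[i]) Phi :
  open D -> bounded_set D -> H2_bounded D Psi ->
  (forall c v w, Sobolev D 2 v -> Sobolev D 2 w ->
     aeq D (Psi (fun x => c * v x + w x)) (fun x => c * Psi v x + Psi w x)) ->
  bounded_functional D Phi -> space_functional (Hsp 2 D) (fun v => Phi (Psi v)).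
Proof.
move=> oD bD [M M0 hM] linM bPhi; have mD := open_measurable_rV oD.
have [lin [K K0 hK]] := bPhi.
have S_lin c v w : Sobolev D 2 v -> Sobolev D 2 w -> Sobolev D 2 (fun x => c * v x + w x).
  exact: Sobolev_lin.
split=> //=.
- move=> c v w Sv Sw; rewrite -lin; [|exact: (hM _ _).1|exact: (hM _ _).1].
  apply: (bounded_functional_aeq mD bPhi _ _ (linM _ _ _ Sv Sw)).
    exact: (hM _ (S_lin c _ _ Sv Sw)).1.
  by apply: (L2D mD _ (hM _ Sw).1); apply: (L2Z mD _ (hM _ Sv).1).
- exists (Num.sqrt (K * M + 1)) => [|v e Sv e0]; first by rewrite sqrtr_gt0 ltr_wpDl // mulr_ge0.
  rewrite (Hnorm_le Sv e0) => h; have [L1 h1] := hM v Sv.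
  apply: (le_sqrt_mul (cabs_ge0 _) e0 (mulr_ge0 K0 M0) _ h).
  by rewrite -mulrA; exact: (le_trans (hK _ L1) (ler_wpM2l K0 h1)).
Qed.

(** The generator is described by quotients with real t tending to 0 from above. This one direction
    suffices to identify a complex derivative already known to exist. *)
Lemma cderiv_uniq (R : realType) (A : set R[i]) F l m s : cderiv A F l s ->
  (forall e : R, 0 < e -> \forall t \near 0^'+,
     A (s + t%:C) /\ cabs (t^-1%:C * (F (s + t%:C) - F s) - m) <= e) ->
  l = m.
Proof.
move=> hF hm; apply/eqP; rewrite -subr_eq0 -cabs_eq0 eq_le cabs_ge0 andbT.
apply/ler_addgt0Pr => e e0; rewrite add0r.
have e2 : 0 < e / 2 by rewrite divr_gt0.
have [dl dl0 H] := hF _ e2.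
have [t [[At mt] [t0 tdl]]] : exists t : R, (A (s + t%:C) /\
    cabs (t^-1%:C * (F (s + t%:C) - F s) - m) <= e / 2) /\ 0 < t /\ t < dl.
  have PF : ProperFilter (0 : R)^'+ by exact: at_right_proper_filter.
  apply: (@filter_ex _ _ PF); apply: filterS2 (hm _ e2) (filterI (nbhs_right_gt 0) (nbhs_right_lt dl0)).
  by move=> t.
have t0C : t%:C != 0 by rewrite fmorph_eq0 gt_eqF.
have := H _ At; rewrite addrC addKr cabsR gtr0_norm // => /(_ tdl) ht.
have {ht} ht : cabs (t^-1%:C * (F (s + t%:C) - F s) - l) <= e / 2.
  rewrite (_ : _ - l = t^-1%:C * (F (s + t%:C) - F s - l * t%:C)); last first.
    by rewrite fmorphV /=; field.
  by rewrite cabsM cabsR ger0_norm ?invr_ge0 ?(ltW t0) // ler_pdivrMl // [leRHS]mulrC.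
rewrite (_ : l - m = (t^-1%:C * (F (s + t%:C) - F s) - m) - (t^-1%:C * (F (s + t%:C) - F s) - l)); last by ring.
by apply: (le_trans (cabsB _ _)); rewrite [leRHS]splitr lerD.
Qed.

(** The source f acts with weights a, 1/2, ab and -q with weights a, a + ab, ab. These agree because
    a + ab = 1/2, so only F - Q survives; the terms in D1 and D2, the lift over two sides of the
    triangle, cancel against the third side. *)
Lemma step_algebra (R : realType) (l s a ab W Y E1 E2 K D1 D2 F Q : R[i]) :
  l != 0 -> s != 0 -> a + ab = 2^-1 ->
  E2 * (E1 * (W + a * s * F + a * s * - Q) + K * D1 + Q / l * (E1 - 1)
        + a * s * - Q + 2%:R^-1 * s * F + ab * s * - Q)
    + E2 * K * D2 + Q / l * (E2 - 1) + ab * s * - Q + ab * s * F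
    - (E1 * E2 * Y + E2 * K * (D1 + D2) + F / l * (E1 * E2 - 1))
  = E1 * E2 * (W - Y)
    + s * (a * (E1 * E2) + 2^-1 * E2 + ab - (E1 * E2 - 1) / (s * l)) * (F - Q).
Proof.
by move=> l0 s0 aab; rewrite (_ : a = 2^-1 - ab) -?aab ?addrK //; field; rewrite l0 s0.
Qed.

(** * Coefficients in the eigenbasis *)

Section Spectral.
Context {R : realType} {d : nat}.
Local Notation fn := ('rV[R]_d.+1 -> R[i]).
Variables (Om : set 'rV[R]_d.+1) (co : coefficients R d.+1) (B : boundary_operator R d.+1).
Hypotheses (oOm : open Om) (bOm : bounded_set Om).
Hypothesis ell : elliptic_coefficients Om co.
Hypothesis so : standing_operator Om co B.
Variables (lam : nat -> R) (e : nat -> fn).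
Hypothesis lam_le0 : forall j, lam j <= 0.
Hypothesis eigen : forall j, domA Om B (e j) /\
  aeq Om (Dop Om co (e j)) (fun x => (lam j)%:C * e j x).
Hypothesis ortho : forall j k, inner Om (e j) (e k) = (j == k)%:R.
Hypothesis complete : forall v, L2 Om v ->
  L2norm Om (fun x => v x - \sum_(j < N) inner Om v (e j) * e j x)%R @[N --> \oo] --> 0%E.
Implicit Types (v g : fn) (j k : nat).

Let mOm : measurable Om. Proof. exact: open_measurable_rV. Qed.

Definition coef j v := inner Om v (e j).

Lemma eigen_L2 j : L2 Om (e j).
Proof. exact: Sobolev_L2 (eigen j).1.1. Qed.

Lemma coef_functional j : bounded_functional Om (coef j).
Proof. exact: (bounded_functional_inner mOm (eigen_L2 j)). Qed.

Lemma coef_aeq j v w : L2 Om v -> L2 Om w -> aeq Om v w -> coef j v = coef j w.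
Proof. move=> Lv Lw vw; exact: (inner_aeql mOm Lv Lw (eigen_L2 j) vw). Qed.

Lemma coefD j v w : L2 Om v -> L2 Om w -> coef j (fun x => v x + w x) = coef j v + coef j w.
Proof. move=> Lv Lw; exact: (innerDl mOm Lv Lw (eigen_L2 j)). Qed.

Lemma coefB j v w : L2 Om v -> L2 Om w -> coef j (fun x => v x - w x) = coef j v - coef j w.
Proof. move=> Lv Lw; exact: (innerBl mOm Lv Lw (eigen_L2 j)). Qed.

Lemma coefZ j c v : L2 Om v -> coef j (fun x => c * v x) = c * coef j v.
Proof. move=> Lv; exact: (innerZl mOm c Lv (eigen_L2 j)). Qed.

Lemma coefN j v : L2 Om v -> coef j (fun x => - v x) = - coef j v.
Proof. move=> Lv; exact: (innerNl mOm Lv (eigen_L2 j)). Qed.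

Lemma coef_Dop j v : domA Om B v -> coef j (Dop Om co v) = (lam j)%:C * coef j v.
Proof.
move=> Av; have [Ae De] := eigen j; have Lv := Sobolev_L2 Av.1; have Le := eigen_L2 j.
rewrite /coef (so_symmetric so Av Ae) (inner_conj mOm (L2_Dop oOm bOm ell Ae.1) Lv).
rewrite (inner_aeql mOm (L2_Dop oOm bOm ell Ae.1) (L2Z mOm _ Le) Lv De) (innerZl mOm _ Le Lv).
rewrite (inner_conj mOm Le Lv); case: (inner Om (e j) v) => a b.
by apply/eqP; rewrite eq_complex /=; apply/andP; split; apply/eqP; ring.
Qed.

(* The sector of so_sectorial contains 0. *)
Lemma lam_lt0 j : lam j < 0.
Proof.
rewrite lt_neqAle lam_le0 andbT; apply/eqP => lam0.
have [theta [M [/andP[th0 th1] hs]]] := so_sectorial so.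
have [] : in_resolvent_set Om co B 0.
  apply: (hs 0 _).1; exists 0, 0; split => //; last by rewrite !mul0r.
  by rewrite normr0 subr_ge0 (le_trans (ltW th1)) // ler_pdivrMr // ler_peMr ?pi_ge0 // ler1n.
move=> _ inj _; have [Ae De] := eigen j; have Le := eigen_L2 j.
have : aeq Om (e j) (fun=> 0).
  apply: inj Ae _; apply: filterS De => x h Ox; rewrite h // lam0.
  by rewrite !mul0r subr0.
move=> /(inner_aeql mOm Le (L2_0 mOm) Le); rewrite ortho eqxx (inner0l mOm Le).
by move/eqP; rewrite oner_eq0.
Qed.

Variable S : R[i] -> fn -> fn.
Hypothesis sg : analytic_semigroup Om co B S.

Lemma coef_S_functional j z : semigroup_time z -> bounded_functional Om (fun v => coef j (S z v)).
Proof.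
move=> tz; split=> [c v w Lv Lw|].
  have L1 := sg_L2 sg tz Lv; have L2' := sg_L2 sg tz Lw.
  have L3 := L2Z mOm c L1.
  rewrite -(coefZ j c L1) -(coefD j L3 L2').
  apply: coef_aeq; [|exact: (L2D mOm L3 L2')|exact: (sg_linear sg c tz Lv Lw)].
  apply: (sg_L2 sg tz); exact: (L2D mOm (L2Z mOm c Lv) Lw).
have [K hK] := sg_bounded sg tz.
exists ((1 + nrm2 Om (e j)) * K ^+ 2) => [|v Lv].
  by apply: mulr_ge0; [apply: addr_ge0 => //; exact: nrm2_ge0|exact: sqr_ge0].
rewrite -mulrA; apply: (le_trans (inner_bound mOm (sg_L2 sg tz Lv) (eigen_L2 j))).
apply: ler_wpM2l; first by apply: addr_ge0 => //; exact: nrm2_ge0.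
have s0 : 0 <= `|K| * Num.sqrt (nrm2 Om v) by rewrite mulr_ge0 // sqrtr_ge0.
have : (L2norm Om (S z v) <= (`|K| * Num.sqrt (nrm2 Om v))%:E)%E.
  apply: (le_trans (hK v Lv)); rewrite (L2_normE Lv) -EFinM lee_fin.
  by apply: ler_wpM2r; [exact: sqrtr_ge0|exact: ler_norm].
rewrite (L2_norm_le (sg_L2 sg tz Lv) s0) exprMn.
by rewrite -normrX ger0_norm ?sqr_ge0 // sqr_sqrtr // nrm2_ge0.
Qed.

Let halfplane : set R[i] := [set w | 0 < complex.Re w].

Lemma halfplane_semigroup_time z : halfplane z -> semigroup_time z.
Proof. by right. Qed.

(** Analyticity supplies some derivative. Its value comes from S(z + t) e_j = S(z) S(t) e_j and the
    generator at e_j, passed through the bounded functional v |-> <S(z) v, e_k>. *)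
Lemma coef_S_cderiv j k z : halfplane z ->
  cderiv halfplane (fun w : R[i] => coef k (S w (e j))) ((lam j)%:C * coef k (S z (e j))) z.
Proof.
move=> z0; have Le := eigen_L2 j; have [Ae De] := eigen j.
have [v' hv'] := sg_analytic sg Le.
have h := holomorphic_cderiv (space_functional_L2 mOm (coef_functional k)) hv' z0.
suff <- : coef k (v' z) = (lam j)%:C * coef k (S z (e j)) by [].
apply: (cderiv_uniq h) => eps eps0.
have tz := halfplane_semigroup_time z0.
have sf := space_functional_L2 mOm (coef_S_functional k tz).
have [K K0 hK] := sf_bound sf.
have LlE : L2 Om (fun x => (lam j)%:C * e j x) by exact: (L2Z mOm _ Le).
have := (sg_generator sg Le LlE).2 (conj Ae De).
have FF : Filter (0 : R)^'+ by exact: at_right_proper_filter.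
move=> /(ecvg0P FF (fun t => L2norm_ge0 _ _)) /(_ (eps / K) (divr_gt0 eps0 K0)) gen.
apply: filterS2 gen (nbhs_right_gt 0) => t ht t0.
have tt : semigroup_time t%:C by right.
have zt : halfplane (z + t%:C) by rewrite /halfplane /= ReD addr_gt0.
split => //.
have LSt := sg_L2 sg tt Le.
have -> : coef k (S (z + t%:C) (e j)) = coef k (S z (S t%:C (e j))).
  apply: coef_aeq; [|exact: (sg_L2 sg tz LSt)|exact: (sg_add sg tz tt Le)].
  exact: (sg_L2 sg (halfplane_semigroup_time zt) Le).
have [X1 E1] := sf_quotient sf (t^-1)%:C LSt Le LlE.
have [_ E2] := sfZ sf (lam j)%:C Le.
rewrite -E2 -E1; apply: (le_trans (hK _ (eps / K) X1 (ltW (divr_gt0 eps0 K0)) ht)).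
by rewrite mulrC divfK // gt_eqF.
Qed.

Lemma halfplane_seg p q : halfplane p -> halfplane q -> seg p q `<=` halfplane.
Proof.
move=> p0 q0 _ [x /andP[x0 x1] ->].
rewrite /halfplane /pt /= ReD ReM ReD ReN ImD /= mul0r subr0.
rewrite (_ : _ + _ = (1 - x) * complex.Re p + x * complex.Re q); last by ring.
have [->|xn0] := eqVneq x 0; first by rewrite subr0 mul1r mul0r addr0.
by apply: ltr_wpDl; [apply: mulr_ge0; rewrite ?subr_ge0 // ltW|rewrite mulr_gt0 // lt_def xn0].
Qed.

(* The function w |-> e^(- lam_j w) <S w e_j, e_k> has derivative 0 in the half-plane and
   tends to <e_j, e_k> at 0. *)
Lemma coef_S_eigen j k z : halfplane z ->
  coef k (S z (e j)) = cexp ((lam j)%:C * z) * coef k (e j).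
Proof.
move=> z0; have Le := eigen_L2 j.
set a := (lam j)%:C; pose h w := coef k (S w (e j)); pose F w := cexp (- a * w) * h w.
have dF w : halfplane w -> cderiv halfplane F 0 w.
  move=> w0; have := cderivM (cderiv_cexpZ halfplane (- a) w) (coef_S_cderiv j k w0).
  by congr cderiv; rewrite /=; ring.
have Fconst (t : R) : 0 < t -> F z = F t%:C.
  move=> t0; have sub := halfplane_seg (t0 : halfplane t%:C) z0.
  apply: seg_const => x x01; [exists 0|]; apply: (cderiv_sub sub); apply: dF; apply: sub; apply: seg_pt => //.
  by case/andP: x01 => /ltW -> /ltW ->.
have hE (t : R) : 0 < t -> h t%:C = cexp (a * t%:C) * F z.
  move=> t0; rewrite (Fconst t t0) /F mulrA -cexpD mulNr subrr cexp0 mul1r.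
  by [].
suff Fz : F z = coef k (e j).
  rewrite -Fz /F mulrA -cexpD mulNr subrr cexp0 mul1r.
  by [].
apply/eqP; rewrite -subr_eq0 -cabs_eq0 eq_le cabs_ge0 andbT.
apply/ler_addgt0Pr => eps eps0; rewrite add0r.
have sf := space_functional_L2 mOm (coef_functional k); have [K K0 hK] := sf_bound sf.
have e2 : 0 < eps / 2 by rewrite divr_gt0.
(* Aperture 0: continuity at 0 is used along the positive real axis only, where [hE] evaluates the
   coefficient. *)
have [d1 d10 H1] := sg_continuous sg 0 Le (divr_gt0 e2 K0).
have [d2 d20 H2] := cderiv_continuous (cderivM (cderiv_cexpZ setT a 0) (cderiv_cst setT (F z) 0)) e2.
pose t := Num.min d1 d2 / 2.
have m0 : 0 < Num.min d1 d2 by rewrite lt_min d10.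
have t0 : 0 < t by rewrite divr_gt0.
have tm : t < Num.min d1 d2 by rewrite ltr_pdivrMr // ltr_pMr // ltr1n.
have := tm; rewrite lt_min => /andP[t1 t2].
have tt : semigroup_time t%:C by right.
have tIm : `|complex.Im t%:C| <= 0 * complex.Re t%:C by rewrite /= normr0 mul0r.
have td1 : cabs t%:C < d1 by rewrite cabsR gtr0_norm.
have b1 := H1 t%:C t0 tIm td1.
have [X1 E1] := sfB sf (sg_L2 sg tt Le) Le.
have {}b1 := hK _ _ X1 (ltW (divr_gt0 e2 K0)) b1.
rewrite E1 mulrCA divff ?gt_eqF // mulr1 -/(h _) hE // in b1.
have := H2 t%:C I; rewrite subr0 cabsR gtr0_norm // mulr0 cexp0 mul1r => /(_ t2) b2.
rewrite (_ : F z - _ = (cexp (a * t%:C) * F z - coef k (e j)) - (cexp (a * t%:C) * F z - F z)); last by ring.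
by apply: (le_trans (cabsB _ _)); rewrite [leRHS]splitr lerD.
Qed.

(** The bounded functional <S(z) v, e_j> - e^(lam_j z) <v, e_j> vanishes on the basis by
    orthogonality, hence everywhere; z = 0 lies outside the open half-plane and is settled by
    [sg_0]. *)
Lemma coef_S j z v : semigroup_time z -> L2 Om v ->
  coef j (S z v) = cexp ((lam j)%:C * z) * coef j v.
Proof.
move=> tz Lv; case: (tz) => [->|z0].
  rewrite mulr0 cexp0 mul1r; apply: coef_aeq (sg_0 sg Lv) => //.
  by apply: (sg_L2 sg) => //; left.
have bF := bounded_functionalZB (cexp ((lam j)%:C * z)) (coef_S_functional j tz) (coef_functional j).
apply/eqP; rewrite -subr_eq0; apply/eqP.
apply: (bounded_functional_ext mOm eigen_L2 complete bF) Lv => k.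
rewrite coef_S_eigen // /coef ortho; case: eqP => [->|_]; first by rewrite subrr.
by rewrite !mulr0 subrr.
Qed.

(** * Duhamel's formula in one coefficient *)

Section Step.
Variables (U : set R[i]) (z z' : R[i] -> fn).
Hypothesis hz : holomorphic (Hsp 2 Om) U z z'.

(* By Duhamel's formula, z contributes e^(lam_j t) times an integral of this function to
   the j-th coefficient of any solution of the inhomogeneous boundary value problem. *)
Definition lift_density j (s : R[i]) :=
  cexp (- (lam j)%:C * s) * (coef j (Dop Om co (z s)) - (lam j)%:C * coef j (z s)).

Lemma coef_space_functional j : space_functional (Hsp 2 Om) (coef j).
Proof.
apply: (@space_functional_H2 _ _ Om id (coef j) oOm bOm _ _ (coef_functional j)).
  exact: H2_bounded_id.
by move=> c v w _ _; exact: (aeq_refl Om).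
Qed.

Lemma lift_cderiv j s : U s -> cderiv U (fun s => coef j (z s)) (coef j (z' s)) s.
Proof.
move=> Us; exact: (holomorphic_cderiv (coef_space_functional j) hz Us).
Qed.

Lemma lift_Dop_cderiv j s : U s ->
  cderiv U (fun s => coef j (Dop Om co (z s))) (coef j (Dop Om co (z' s))) s.
Proof.
move=> Us; apply: (@holomorphic_cderiv _ _ _ (fun v => coef j (Dop Om co v)) _ _ _ _ _ hz Us).
apply: (@space_functional_H2 _ _ Om (Dop Om co)) => //.
- exact: H2_bounded_Dop.
- by move=> c v w; exact: Dop_lin.
- exact: coef_functional.
Qed.

Lemma lift_density_cderiv j s : U s -> exists l, cderiv U (lift_density j) l s.
Proof.
move=> Us; have h1 := cderiv_cexpZ U (- (lam j)%:C) s.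
have h2 := cderivB (lift_Dop_cderiv j Us) (cderivZ (lam j)%:C (lift_cderiv j Us)).
by eexists; exact: (cderivM h1 h2).
Qed.

Lemma seg_shift (t p1 p2 s : R[i]) : seg p1 p2 s -> seg (t + p1) (t + p2) (t + s).
Proof. by move=> [x x01 ->]; exists x => //; rewrite /pt; ring. Qed.

Lemma seg_semigroup_time (p1 p2 s : R[i]) : 0 < complex.Re (p2 - p1) -> seg p1 p2 s ->
  semigroup_time (p2 - s).
Proof.
move=> p0 [x /andP[x0 x1] ->].
rewrite (_ : p2 - _ = (1 - x)%:C * (p2 - p1)); last by rewrite /pt rmorphB /=; ring.
have [->|xn1] := eqVneq x 1; first by left; rewrite subrr mul0r.
right; rewrite ReM /= mul0r subr0 mulr_gt0 // subr_gt0 lt_neqAle xn1; exact: x1.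
Qed.

Lemma coef_flow j (q w w' : fn) (t p1 p2 : R[i]) (L : R[i] -> R[i]) :
  L2 Om q -> L2 Om w -> 0 < complex.Re (p2 - p1) ->
  seg (t + p1) (t + p2) `<=` U ->
  (forall s, seg (t + p1) (t + p2) s -> cderiv (seg (t + p1) (t + p2)) L (lift_density j s) s) ->
  flow_Dq Om co S z z' q t p1 p2 w w' ->
  coef j w' = cexp ((lam j)%:C * (p2 - p1)) * coef j w
    + cexp ((lam j)%:C * (t + p2)) * (L (t + p2) - L (t + p1))
    + coef j q / (lam j)%:C * (cexp ((lam j)%:C * (p2 - p1)) - 1).
Proof.
move=> Lq Lw p0 segU hL [Lw' [I hI w'E]].
set l := (lam j)%:C; have l0 : l != 0 by rewrite fmorph_eq0 lt_eqF // lam_lt0.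
have sU s : seg p1 p2 s -> U (t + s) by move=> /(seg_shift t)/segU.
have LZ s : U s -> [/\ L2 Om (z s), L2 Om (z' s) & L2 Om (Dop Om co (z s))].
  move=> Us; have [h1 h2] := hz.1 s Us.
  by split; [exact: Sobolev_L2 h1|exact: Sobolev_L2 h2|exact: (L2_Dop oOm bOm ell h1)].
have Lg s : seg p1 p2 s -> L2 Om (fun x => Dop Om co (z (t + s)) x - z' (t + s) x + q x).
  by move=> /sU/LZ[h1 h2 h3]; exact: (L2D mOm (L2B mOm h3 h2) Lq).
(* An explicit antiderivative of the scalar integrand, in absolute time. Its middle term is the
   integration by parts that removes [z']; its end values cancel the two lift terms of the flow, and
   [L] accounts for the lift density that remains. *)
pose G s := cexp (l * (p2 + t)) * (L s - cexp (- l * s) * coef j (z s) - coef j q / l * cexp (- l * s)).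
have IE : coef j I = G (t + p2) - G (t + p1).
  have sf := space_functional_L2 mOm (coef_functional j).
  apply: (segment_integral_functional sf _ hI (L := fun s => G (t + s))) => s hs /=.
    exact: (sg_L2 sg (seg_semigroup_time p0 hs) (Lg s hs)).
  rewrite (coef_S _ (seg_semigroup_time p0 hs) (Lg s hs)).
  have [h1 h2 h3] := LZ _ (sU s hs).
  rewrite (coefD j (L2B mOm h3 h2) Lq) (coefB j h3 h2).
  have hs' := seg_shift t hs.
  have d1 := cderiv_sub segU (lift_cderiv j (segU _ hs')).
  have d2 := cderiv_cexpZ (seg (t + p1) (t + p2)) (- l) (t + s).
  have d3 := cderivB (cderivB (hL _ hs') (cderivM d2 d1)) (cderivZ (coef j q / l) d2).
  have d4 := cderiv_shift (cderivZ (cexp (l * (p2 + t))) d3).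
  have := cderiv_sub (A' := seg p1 p2) (fun s hs => seg_shift t hs) d4.
  congr cderiv; rewrite /lift_density -/l.
  rewrite (_ : l * (p2 - s) = l * (p2 + t) + - l * (t + s)); last by ring.
  by rewrite cexpD; field.
have [hz2 _ _] := LZ _ (sU _ (seg_right p1 p2)); have [hz1 _ _] := LZ _ (sU _ (seg_left p1 p2)).
have tp : semigroup_time (p2 - p1) by right.
have LS := sg_L2 sg tp (L2B mOm Lw hz1); have LI := hI.1.
rewrite (coef_aeq j Lw' (L2D mOm (L2D mOm hz2 LS) LI) w'E) (coefD j (L2D mOm hz2 LS) LI).
rewrite (coefD j hz2 LS) (coef_S _ tp (L2B mOm Lw hz1)) (coefB j Lw hz1) IE /G.
have e1 : cexp (- l * (t + p2)) = (cexp (l * (p2 + t)))^-1 by rewrite -cexpN; congr cexp; ring.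
have e2 : cexp (- l * (t + p1)) = cexp (l * (p2 - p1)) * (cexp (l * (p2 + t)))^-1.
  by rewrite -cexpN -cexpD; congr cexp; ring.
rewrite e1 e2 (addrC p2 t); have E0 := cexp_neq0 (l * (t + p2)).
by field; rewrite E0 l0.
Qed.

(** * The exact solution and the error of one step *)

Section Exact.
Variables (T : R) (b : R[i] -> fn) (f : fn) (u u' : R -> fn).
Hypothesis Uint : forall t : R, 0 <= t <= T -> U t%:C.
Hypothesis Lf : L2 Om f.
Hypothesis du : path_derivative (Hsp 2 Om) T u u'.
Hypothesis ode : forall t, 0 < t <= T -> aeq Om (u' t) (fun x => Dop Om co (u t) x + f x).
Hypothesis ubc : forall t, 0 < t <= T -> Bop Om B (u t) (b t%:C).
Hypothesis zbc : forall t : R, 0 <= t <= T -> Bop Om B (z t%:C) (b t%:C).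

(** Symmetry of A cannot be applied to u(t) itself, only to u(t) - z(t) in the domain. The
    correction left over is the lift density without its exponential factor. *)
Lemma coef_ode j t : 0 < t <= T -> coef j (u' t) =
  (lam j)%:C * coef j (u t) +
  (coef j (Dop Om co (z t%:C)) - (lam j)%:C * coef j (z t%:C)) + coef j f.
Proof.
move=> t0T; have tT : 0 <= t <= T by case/andP: t0T => /ltW -> ->.
have [Su Su'] := du.1 t tT; have [Sz _] := hz.1 _ (Uint tT).
have LDu := L2_Dop oOm bOm ell Su; have LDz := L2_Dop oOm bOm ell Sz.
have Lu := Sobolev_L2 Su; have Lz := Sobolev_L2 Sz.
rewrite (coef_aeq j (Sobolev_L2 Su') (L2D mOm LDu Lf) (ode t0T)) (coefD j LDu Lf).
have Auz := Bop_sub oOm bOm Su Sz (ubc t0T) (zbc tT).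
have := coef_Dop j Auz; rewrite (coefB j Lu Lz).
rewrite (coef_aeq j (L2_Dop oOm bOm ell Auz.1) (L2B mOm LDu LDz) (Dop_B oOm bOm co Su Sz)).
rewrite (coefB j LDu LDz) => /eqP; rewrite subr_eq => /eqP ->; ring.
Qed.

Lemma coef_exact j (t tau : R) (L : R[i] -> R[i]) : 0 <= t -> 0 < tau -> t + tau <= T ->
  (forall s, seg t%:C (t%:C + tau%:C) s -> cderiv (seg t%:C (t%:C + tau%:C)) L (lift_density j s) s) ->
  coef j (u (t + tau)) = cexp ((lam j)%:C * tau%:C) * coef j (u t)
    + cexp ((lam j)%:C * (t%:C + tau%:C)) * (L (t%:C + tau%:C) - L t%:C)
    + coef j f / (lam j)%:C * (cexp ((lam j)%:C * tau%:C) - 1).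
Proof.
move=> t0 tau0 tT hL; set l := (lam j)%:C.
have l0 : l != 0 by rewrite fmorph_eq0 lt_eqF // lam_lt0.
pose Y (s : R[i]) := coef j (u (complex.Re s)).
(* Integrating factor e^(-l s), with primitives of the two source terms subtracted: [L] for the lift
   and -(f_j / l) e^(-l s) for f. The claim is that H is constant. *)
pose H s := cexp (- l * s) * Y s - L s + coef j f / l * cexp (- l * s).
have ptE x : pt t%:C (t%:C + tau%:C) x = (t + x * tau)%:C.
  by rewrite /pt (addrC t%:C tau%:C) addrK rmorphD rmorphM.
have xT x : 0 <= x <= 1 -> 0 <= t + x * tau <= T.
  move=> /andP[x0 x1]; rewrite addr_ge0 ?mulr_ge0 ?(ltW tau0) //=.
  by apply: le_trans tT; rewrite lerD2l ler_piMl // ltW.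
have segA : seg t%:C (t%:C + tau%:C) `<=` [set w | exists2 s : R, 0 <= s <= T & w = s%:C].
  by move=> _ [x x01 ->]; exists (t + x * tau); rewrite ?ptE; [exact: xT|].
have dH x : 0 <= x <= 1 -> cderiv (seg t%:C (t%:C + tau%:C)) H
    (- l * cexp (- l * (t + x * tau)%:C) * Y (t + x * tau)%:C +
     cexp (- l * (t + x * tau)%:C) * coef j (u' (t + x * tau)) - lift_density j (t + x * tau)%:C +
     coef j f / l * (- l * cexp (- l * (t + x * tau)%:C))) (t + x * tau)%:C.
  move=> x01; have d1 := cderiv_sub segA (path_cderiv (coef_space_functional j) du (xT x x01)).
  have d2 := cderiv_cexpZ (seg t%:C (t%:C + tau%:C)) (- l) (t + x * tau)%:C.
  have d3 : cderiv (seg t%:C (t%:C + tau%:C)) L (lift_density j (t + x * tau)%:C) (t + x * tau)%:C.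
    by apply: hL; rewrite -ptE; exact: seg_pt.
  exact: cderivD (cderivB (cderivM d2 d1) d3) (cderivZ (coef j f / l) d2).
have : H (t%:C + tau%:C) = H t%:C.
  (* The differential equation is assumed for positive times only, and the segment may start at 0; a
     vanishing derivative is required just at interior points. *)
  apply: seg_const => x x01; rewrite ptE.
    by eexists; exact: dH x01.
  have /andP[x0 x1] := x01; have x01' : 0 <= x <= 1 by rewrite !ltW.
  have := dH x x01'; congr cderiv.
  rewrite coef_ode; last first.
    by have /andP[_ ->] := xT x x01'; rewrite ltr_wpDl // mulr_gt0.
  by rewrite /lift_density /Y /= -/l; field.
rewrite /H /Y -rmorphD /= -/(Y _).
have e1 : cexp (- l * (t + tau)%:C) = (cexp (l * (t + tau)%:C))^-1 by rewrite -cexpN mulNr.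
have e2 : cexp (- l * t%:C) = cexp (l * tau%:C) * (cexp (l * (t + tau)%:C))^-1.
  by rewrite -cexpN -cexpD; congr cexp; rewrite rmorphD /=; ring.
rewrite e1 e2; have E0 := cexp_neq0 (l * (t + tau)%:C).
move: (cexp _) (cexp _) E0 (coef j (u _)) (coef j (u _)) (L _) (L _) => X Y' X0 u1 u2 L1 L2' hH.
have -> : u2 = Y' * ((Y'^-1 * u2 - L2' + coef j f / l * Y'^-1) + L2' - coef j f / l * Y'^-1).
  by field; rewrite X0 l0.
by rewrite hH; field; rewrite X0 l0.
Qed.

Lemma coef_step j (q w w' : fn) (tau : R) k :
  0 < tau -> k.+1%:R * tau <= T -> L2 Om q -> L2 Om w ->
  (forall x y : R, 0 <= x -> 0 <= y -> x + y <= 1 ->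
     U ((k%:R * tau)%:C + x%:C * (2%:R * step_a R * tau%:C) + (y * tau)%:C)) ->
  Phi Om co S z z' f q tau k w w' ->
  coef j w' - coef j (u (k.+1%:R * tau)) =
    (expR (tau * lam j))%:C * (coef j w - coef j (u (k%:R * tau)))
    + tau%:C * quad_defect (tau * lam j) * (coef j f - coef j q).
Proof.
move=> tau0 kT Lq Lw hU [w1 [w2 [fl1 fl2 Lw' w'E]]].
set l := (lam j)%:C; have l0 : l != 0 by rewrite fmorph_eq0 lt_eqF // lam_lt0.
move: fl1 fl2 w'E; set t := (k%:R * tau)%:C; set s := tau%:C; set a := step_a R; set ab := step_abar R.
move=> fl1 fl2 w'E.
have s0 : s != 0 by rewrite fmorph_eq0 gt_eqF.
(* Admissibility of the step places the full triangle in U, not only its sides, as Goursat's theorem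
   demands. *)
have tri_U : triangle t (2%:R * a * s) s `<=` U.
  by move=> _ [x [y [x0 y0 xy ->]]]; have := hU x y x0 y0 xy; rewrite [(y * tau)%:C]rmorphM.
have hF w0 : triangle t (2%:R * a * s) s w0 ->
    exists m, cderiv (triangle t (2%:R * a * s) s) (lift_density j) m w0.
  move=> tw; have [m hm] := lift_density_cderiv j (tri_U _ tw).
  by exists m; exact: (cderiv_sub tri_U hm).
have [L1 [L2' [L3 [hL1 hL2 hL3 LE]]]] := triangle_primitives hF.
(* 2 a + 2 abar = 1: the second flow has length 2 abar tau. Both lengths have positive real part, so
   the semigroup is available along both segments. *)
have aE : 2%:R * a * s + 2%:R * ab * s = s.
  by rewrite -mulrDl -mulrDr step_sum; field.
have Re1 : 0 < complex.Re (2%:R * a * s - 0).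
  rewrite subr0 /a step_aE -(rmorph_nat (real_complex R)) ReM ReM /= !(mul0r, mulr0, subr0).
  by rewrite !mulr_gt0 // invr_gt0.
have Re2 : 0 < complex.Re (s - 2%:R * a * s).
  rewrite -{1}aE addrC addKr /ab step_abarE -(rmorph_nat (real_complex R)) ReM ReM /=.
  by rewrite !(mul0r, mulr0, subr0) !mulr_gt0 // invr_gt0.
have seg1 : seg (t + 0) (t + 2%:R * a * s) `<=` triangle t (2%:R * a * s) s.
  move=> _ [x /andP[x0 x1] ->]; exists x, 0; split; rewrite ?addr0 //.
  by rewrite /tri /pt; ring.
have seg2 : seg (t + 2%:R * a * s) (t + s) `<=` triangle t (2%:R * a * s) s.
  move=> _ [x /andP[x0 x1] ->]; exists (1 - x), x; split; rewrite ?subr_ge0 ?subrK //.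
  by rewrite /tri /pt rmorphB rmorph1; ring.
have LP (c : R[i]) g v : L2 Om g -> L2 Om v -> L2 Om (fun x => v x + c * g x).
  by move=> Lg Lv; exact: (L2D mOm Lv (L2Z mOm c Lg)).
have cP (c : R[i]) g v : L2 Om g -> L2 Om v -> coef j (fun x => v x + c * g x) = coef j v + c * coef j g.
  by move=> Lg Lv; rewrite (coefD j Lv (L2Z mOm c Lg)) (coefZ j c Lg).
have LNq := L2N mOm Lq.
have Lw1 := fl1.1; have Lw2 := fl2.1.
have La := LP (a * s) _ _ LNq (LP (a * s) _ _ Lf Lw).
have Lb1 := LP (a * s) _ _ LNq Lw1.
have Lb2 := LP (step_c R * s) _ _ Lf Lb1.
have Lb := LP (ab * s) _ _ LNq Lb2.
have hL1' w0 : seg (t + 0) (t + 2%:R * a * s) w0 ->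
    cderiv (seg (t + 0) (t + 2%:R * a * s)) L1 (lift_density j w0) w0.
  by rewrite addr0; exact: hL1.
have C1 := coef_flow Lq La Re1 (subset_trans seg1 tri_U) hL1' fl1.
have C2 := coef_flow Lq Lb Re2 (subset_trans seg2 tri_U) hL2 fl2.
move: C1 C2.
rewrite /flow_Nq /flow_f /shift (cP _ _ _ LNq (LP (a * s) _ _ Lf Lw)) (cP _ _ _ Lf Lw).
rewrite (cP _ _ _ LNq Lb2) (cP _ _ _ Lf Lb1) (cP _ _ _ LNq Lw1) (coefN j Lq).
rewrite addr0 subr0 => C1 C2.
have Lc := LP (ab * s) _ _ LNq Lw2.
rewrite (coef_aeq j Lw' (LP (ab * s) _ _ Lf Lc) w'E) /flow_f /flow_Nq /shift.
rewrite (cP _ _ _ Lf Lc) (cP _ _ _ LNq Lw2) (coefN j Lq).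
have kE : k.+1%:R * tau = k%:R * tau + tau by rewrite -addn1 natrD mulrDl mul1r.
have t0 : 0 <= k%:R * tau by rewrite mulr_ge0 // ltW.
rewrite kE; rewrite kE in kT.
have C3 := coef_exact t0 tau0 kT hL3; rewrite -/t -/s -/l in C3.
rewrite C3 -LE C2 C1.
have lC : (tau * lam j)%:C = s * l by rewrite rmorphM.
(* The two complex propagators multiply to the real one over the full step, and the second alone is
   the middle exponential of [quad_defect]. *)
have eE : (expR (tau * lam j))%:C = cexp (l * (2%:R * a * s)) * cexp (l * (s - 2%:R * a * s)).
  by rewrite -cexpD -mulrDr addrCA subrr addr0 -cexpR lC mulrC.
have abE : 2 * ab * (tau * lam j)%:C = l * (s - 2%:R * a * s) by rewrite lC -{2}aE; ring.
have KE : cexp (l * (t + s)) = cexp (l * (s - 2%:R * a * s)) * cexp (l * (t + 2%:R * a * s)).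
  by rewrite -cexpD; congr cexp; ring.
have sE : cexp (l * s) = cexp (l * (2%:R * a * s)) * cexp (l * (s - 2%:R * a * s)).
  by rewrite -cexpD; congr cexp; ring.
rewrite /quad_defect abE rmorphM fmorphV rmorphB rmorph1 /= lC eE KE sE /step_c -/a -/ab.
exact: (step_algebra _ _ _ _ _ _ _ _ _ l0 s0 step_sum).
Qed.

(** * Accumulation of the error over the steps *)

Section Scheme.
Variables (q : fn) (tau : R) (un : nat -> fn).
Hypotheses (Lq : L2 Om q) (tau0 : 0 < tau) (adm : admissible_step T U tau).
Hypotheses (Lun0 : L2 Om (un 0%N)) (un0 : aeq Om (un 0%N) (u 0)).
Hypothesis step : forall n, n.+1%:R * tau <= T -> Phi Om co S z z' f q tau n (un n) (un n.+1).

Lemma scheme_L2 n : n%:R * tau <= T -> L2 Om (un n).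
Proof. by case: n => [//|n] /step[w1 [w2 []]]. Qed.

Lemma time_mono m n : (m <= n)%N -> n%:R * tau <= T -> 0 <= m%:R * tau <= T.
Proof.
move=> mn nT; rewrite mulr_ge0 ?(ltW tau0) //=; apply: le_trans nT.
by rewrite ler_wpM2r ?(ltW tau0) // ler_nat.
Qed.

Lemma coef_error j n : n%:R * tau <= T ->
  cabs (coef j (fun x => un n x - u (n%:R * tau) x)) <=
    56 * tau ^+ 3 * (lam j ^+ 2 * cabs (coef j f - coef j q)).
Proof.
move=> nT; have Lu m : (m <= n)%N -> L2 Om (u (m%:R * tau)).
  by move=> mn; exact: Sobolev_L2 (du.1 _ (time_mono mn nT)).1.
have Lun m : (m <= n)%N -> L2 Om (un m).
  by move=> mn; apply: scheme_L2; case/andP: (time_mono mn nT).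
rewrite (coefB j (Lun _ (leqnn n)) (Lu _ (leqnn n))).
apply: (@error_recursion _ tau (lam j) (coef j f - coef j q)
  (fun m => coef j (un m) - coef j (u (m%:R * tau))) n) => //.
- exact: lam_lt0.
- have := Lu _ (leq0n n); rewrite mul0r => Lu0.
  by rewrite (coef_aeq j Lun0 Lu0 un0) subrr.
- move=> m mn; have /andP[_ mT] := time_mono mn nT.
  by apply: coef_step => //; [exact: Lun (ltnW mn)|exact: adm|exact: step].
Qed.

Lemma error_bound (h : fn) n : L2 Om h -> n%:R * tau <= T ->
  (forall j, cabs (coef j h) = lam j ^+ 2 * cabs (coef j f - coef j q)) ->
  (L2norm Om (fun x => un n x - u (n%:R * tau) x)%R <=
     (112 * Num.sqrt (nrm2 Om h) * tau ^+ 3)%:E)%E.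
Proof.
move=> Lh nT hE; have t3 : 0 <= tau ^+ 3 by rewrite exprn_ge0 // ltW.
have Lu : L2 Om (u (n%:R * tau)) by exact: Sobolev_L2 (du.1 _ (time_mono (leqnn n) nT)).1.
have Ld := L2B mOm (scheme_L2 nT) Lu.
have s0 := sqrtr_ge0 (nrm2 Om h).
rewrite (L2_norm_le Ld (mulr_ge0 (mulr_ge0 (ler0n _ 112) s0) t3)).
have K0 : 0 <= 56 * tau ^+ 3 by rewrite mulr_ge0.
(* The factor 4 in the comparison of squared norms doubles the constant of each coefficient: 112^2 =
   4 * 56^2. *)
have := nrm2_coef_le mOm eigen_L2 ortho complete Ld Lh K0.
move=> /(_ _)/le_trans; apply=> [j|].
  by rewrite -/(coef j h) hE; exact: coef_error.
have := sqr_sqrtr (nrm2_ge0 Om h); move: (Num.sqrt _) => N; move: (nrm2 Om h) => M <-.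
by rewrite le_eqVlt; apply/orP; left; apply/eqP; ring.
Qed.
End Scheme.
End Exact.
End Step.

Lemma coef_correctors j f r q : Sobolev Om 2 f -> correctors Om co B f r q ->
  coef j (Dop Om co (fun x => r x - Dop Om co f x)) = (lam j)%:C ^+ 2 * (coef j q - coef j f).
Proof.
move=> Sf [[Sr Sq] _ Ar Dq Aq].
have LDf := L2_Dop oOm bOm ell Sf; have LDq := L2_Dop oOm bOm ell Sq.
have Lf := Sobolev_L2 Sf; have Lq := Sobolev_L2 Sq; have Lr := Sobolev_L2 Sr.
rewrite (coef_Dop j Ar) (coefB j Lr LDf) -(coef_aeq j LDq Lr Dq) -(coefB j LDq LDf).
rewrite -(coef_aeq j (L2_Dop oOm bOm ell Aq.1) (L2B mOm LDq LDf) (Dop_B oOm bOm co Sq Sf)).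
by rewrite (coef_Dop j Aq) (coefB j Lq Lf) expr2 mulrA.
Qed.
End Spectral.

Unset Implicit Arguments.
Set Strict Implicit.
Set Printing Implicit Defensive.

Theorem theorem4p1 (R : realType) (d : nat) (Om : set 'rV[R]_d.+1) (T : R)
    (co : coefficients R d.+1) (B : boundary_operator R d.+1)
    (S : R[i] -> ('rV[R]_d.+1 -> R[i]) -> ('rV[R]_d.+1 -> R[i]))
    (U : set R[i]) (b z z' : R[i] -> 'rV[R]_d.+1 -> R[i])
    (u0 f r q : 'rV[R]_d.+1 -> R[i]) (u : R -> 'rV[R]_d.+1 -> R[i]) :
  0 < T ->
  admissible_domain Om ->
  elliptic_coefficients Om co ->
  boundary_coefficients Om B ->
  standing_operator Om co B ->
  analytic_semigroup Om co B S ->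
  boundary_data Om B T U b z z' ->
  Sobolev Om 2 u0 -> Bop Om B u0 (b 0) ->
  Sobolev Om 4 f ->
  correctors Om co B f r q ->
  exact_solution Om co B T b f u0 u ->
  exists2 C : R, 0 < C &
    forall (tau : R) (un : nat -> 'rV[R]_d.+1 -> R[i]),
      0 < tau -> admissible_step T U tau ->
      un 0%N = u0 ->
      (forall n : nat, n.+1%:R * tau <= T ->
         Phi Om co S z z' f q tau n (un n) (un n.+1)) ->
      forall n : nat, n%:R * tau <= T ->
        (L2norm Om (fun x => un n x - u (n%:R * tau) x)%R
           <= (C * tau ^+ 3 * (1 + `|ln tau|))%:E)%E.
Proof.
move=> T0 [[oOm _ _ bOm] _] ell _ so sg bd Su0 _ Sf corr [u' [u'' [[du _] _ ode ubc u0E]]].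
have mOm := open_measurable_rV oOm.
have Sf2 : Sobolev Om 2 f by exact: Sobolev_le Sf.
have [lam [e [lam_le0 eigen ortho complete]]] := so_eigenbasis so.
have [[Sr Sq] _ Ar _ _] := corr.
pose h := Dop Om co (fun x => r x - Dop Om co f x).
have Lh : L2 Om h := L2_Dop oOm bOm ell Ar.1.
have hE j : cabs (coef Om e j h) = lam j ^+ 2 * cabs (coef Om e j f - coef Om e j q).
  rewrite (coef_correctors oOm bOm ell so eigen j Sf2 corr) cabsM -rmorphXn cabsR.
  by rewrite ger0_norm ?sqr_ge0 // cabs_sym.
have s0 : 0 <= 112 * Num.sqrt (nrm2 Om h) by rewrite mulr_ge0 ?sqrtr_ge0.
(* The added 1 keeps the constant positive even if [h] vanishes. *)
exists (112 * Num.sqrt (nrm2 Om h) + 1) => [|tau un tau0 adm un0 step n nT]; first by rewrite ltr_wpDl.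
have Lu0 : L2 Om (un 0%N) by rewrite un0; exact: Sobolev_L2 Su0.
have u0E' : aeq Om (un 0%N) (u 0) by rewrite un0; exact: aeq_sym u0E.
have := error_bound oOm bOm ell so lam_le0 eigen ortho complete sg (bz_analytic bd)
  (bd_nbhd bd) (Sobolev_L2 Sf2) du ode ubc (bz_lift bd) (Sobolev_L2 Sq) tau0 adm Lu0 u0E' step Lh nT hE.
move=> /le_trans; apply; rewrite lee_fin.
have t3 : 0 <= tau ^+ 3 by rewrite exprn_ge0 // ltW.
apply: (@le_trans _ _ ((112 * Num.sqrt (nrm2 Om h) + 1) * tau ^+ 3)).
  by rewrite ler_wpM2r // lerDl.
by rewrite ler_peMr ?lerDl // mulr_ge0 // addr_ge0.
Qed.
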